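(* There exists an absolute constant $c>0$ such that for every finite nonempty set $S\subset\mathbb{Z}^2$ and every $\phi\in L^2(\mathbb{T}^2)$, \[ \|e^{it\Delta}P_S\phi\|_{L^4_{t,x}([0,\frac{1}{\log\#S}]\times\mathbb{T}^2)}\le c\,\|\phi\|_{L^2(\mathbb{T}^2)}. \]
   Context: $\mathbb{T}^2=(\mathbb{R}/2\pi\mathbb{Z})^2$. For $f:\mathbb{T}^2\to\mathbb{C}$, $\widehat f(\xi)$, $\xi\in\mathbb{Z}^2$, denotes its Fourier coefficients. For $S\subset\mathbb{Z}^2$, $P_S$ is the Fourier multiplier $\widehat{P_Sf}=\chi_S\widehat f$ ($\chi_S$ the indicator of $S$). For $t\in\mathbb{R}$, $e^{it\Delta}\phi$ is defined by $\widehat{e^{it\Delta}\phi}(\xi)=e^{-it|\xi|^2}\widehat\phi(\xi)$. $\#S$ is the cardinality of $S$, and $\log x:=\max\{1,\log_e x\}$ for $x>0$. *)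

(* Defs.v *)
From HB Require Import structures.
From mathcomp Require Import all_boot all_order all_algebra.
From mathcomp Require Import finmap.
From mathcomp Require Import all_classical all_reals all_analysis.
Set Implicit Arguments. Unset Strict Implicit. Unset Printing Implicit Defensive.
Import Order.TTheory GRing.Theory Num.Theory.
Import numFieldNormedType.Exports.
Local Open Scope classical_set_scope.
Local Open Scope ring_scope.

Section Torus.
Variable R : realType.

Local Notation leb2 := (@lebesgue_measure R \x @lebesgue_measure R)%E.
Local Notation leb3 := ((@lebesgue_measure R \x @lebesgue_measure R) \x @lebesgue_measure R)%E.

Definition torus_box : set (R * R) :=
  `[0, 2 * pi]%classic `*` `[0, 2 * pi]%classic.

Definition zdot (xi : int * int) (x : R * R) : R :=
  xi.1%:~R * x.1 + xi.2%:~R * x.2.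
Definition znorm2 (xi : int * int) : R := xi.1%:~R ^+ 2 + xi.2%:~R ^+ 2.

(* A complex-valued function phi on T^2 is given by its real part u and
   imaginary part v (functions on the fundamental domain). *)
Definition L2_torus (u v : R * R -> R) : Prop :=
  measurable_fun torus_box u /\ measurable_fun torus_box v /\
  leb2.-integrable torus_box (fun x => (u x ^+ 2 + v x ^+ 2)%:E).

Definition L2norm_torus (u v : R * R -> R) : R :=
  powR (Rintegral leb2 torus_box (fun x => u x ^+ 2 + v x ^+ 2)) (2^-1).

(* Fourier coefficient  hat phi(xi) = (2pi)^-2 int_{T^2} phi(x) e^{-i xi.x} dx,
   real and imaginary parts. *)
Definition fourier_re (u v : R * R -> R) (xi : int * int) : R :=
  (2 * pi) ^- 2 * Rintegral leb2 torus_box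
    (fun x => u x * cos (zdot xi x) + v x * sin (zdot xi x)).
Definition fourier_im (u v : R * R -> R) (xi : int * int) : R :=
  (2 * pi) ^- 2 * Rintegral leb2 torus_box
    (fun x => v x * cos (zdot xi x) - u x * sin (zdot xi x)).

(* e^{it Delta} P_S phi (x) = sum_{xi in S} hat phi(xi) e^{-it|xi|^2} e^{i xi.x},
   real and imaginary parts. *)
Definition schrod_PS_re (S : {fset int * int}) (u v : R * R -> R)
    (t : R) (x : R * R) : R :=
  \sum_(xi <- S) (fourier_re u v xi * cos (zdot xi x - t * znorm2 xi)
                  - fourier_im u v xi * sin (zdot xi x - t * znorm2 xi)).
Definition schrod_PS_im (S : {fset int * int}) (u v : R * R -> R)
    (t : R) (x : R * R) : R :=
  \sum_(xi <- S) (fourier_re u v xi * sin (zdot xi x - t * znorm2 xi)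
                  + fourier_im u v xi * cos (zdot xi x - t * znorm2 xi)).

Definition L4norm_schrod_PS (S : {fset int * int}) (u v : R * R -> R) (T : R) : R :=
  powR (Rintegral leb3 (torus_box `*` `[0, T]%classic)
         (fun p => (schrod_PS_re S u v p.2 p.1 ^+ 2
                    + schrod_PS_im S u v p.2 p.1 ^+ 2) ^+ 2)) (4^-1).

Definition logm (x : R) : R := Num.max 1 (ln x).

End Torus.

(* Main.v *)
(* On [0, 1/M], with M comparable to log #S, the indicator function is dominated by
   |sum_(n < M) e^(int)|^2 / M^2. Expanding the fourth power of the solution and integrating over
   full periods leaves the sum of f(x1) f(x2) f(x3) f(x4), f = |hat phi|, over parallelograms
   x1 + x3 = x2 + x4 with | |x1|^2 - |x2|^2 + |x3|^2 - |x4|^2 | < M. For a fixed side v = x2 - x1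
   this quantity is a multiple of gcd(v), so by Schur's test the sum is at most the sum over
   rectangles with the weight M / gcd(v) + 1, up to degenerate terms.

   Rectangles without weight contribute O(log #S) |f|_2^4: split S into dyadic rank classes and
   bound incidences by the Szemeredi-Trotter theorem, itself a consequence of the crossing lemma.
   Rectangles with weight 1 / gcd(v) contribute O(|f|_2^4): there the incidence bound is
   interpolated with trivial ones, both for the sides parallel to v and for those orthogonal to it,
   and gains a geometric decay in the differences of the levels of opposite vertices. *)

(* The logarithm is the price of the critical exponent 3. Szemeredi-Trotter allows about 4^a / t^3
   lines with t points among 2^a points, so the sum of the cubes of these numbers receives the same
   amount from every dyadic t, and the rectangle count inherits a factor of size log #S. The short
   time interval pays for it: the kernel divided by M^2 and counted over M frequencies contributes 1
   / M, against an energy of size M + log #S. Near resonances already bring a factor M to the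
   rectangles with weight 1 / gcd(v), so their sum must be free of logarithms. It is, because the
   inverse distances from one point to n lattice points of a line add up to O(sqrt n): half a power
   is saved, the exponent becomes 5 / 2, and the dyadic sums are geometric. Part of this saving is
   kept as decay in the levels, which makes the sums over the four level indices converge. Lines too
   rich for this use of Szemeredi-Trotter are few; rectangles with two vertices on such lines are
   settled by Cauchy-Schwarz alone, so that afterwards at most one such vertex remains. *)
Require Import Defs.
From mathcomp Require Import all_boot all_order all_algebra.
From mathcomp Require Import ring lra zify.
From mathcomp Require Import reals exp.
Set Implicit Arguments. Unset Strict Implicit. Unset Printing Implicit Defensive.
Import Order.TTheory GRing.Theory Num.Theory.
Local Open Scope ring_scope.

(** * Szemeredi-Trotter for lines given by equations [Y = mu X + nu] *)

Section Planar.
Variables (R : realFieldType) (T : finType) (X Y : T -> R).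
Hypothesis Xinj : injective X.

Definition slope (e : T * T) : R := (Y e.2 - Y e.1) / (X e.2 - X e.1).
Definition height (e : T * T) (x : R) : R := Y e.1 + slope e * (x - X e.1).
Definition spans (e : T * T) (x : R) := (X e.1 < x) && (x < X e.2).
Definition meet_abscissa (e f : T * T) : R :=
  (Y f.1 - slope f * X f.1 - Y e.1 + slope e * X e.1) / (slope e - slope f).
Definition crossing (e f : T * T) : bool :=
  [&& slope e != slope f, spans e (meet_abscissa e f)
    & spans f (meet_abscissa e f)].

Lemma crossingP e f x : slope e != slope f -> spans e x -> spans f x ->
  height e x = height f x -> crossing e f.
Proof.
move=> ns se sf; rewrite /height => h.
have hx : meet_abscissa e f = x.
  have d0 : slope e - slope f != 0 by rewrite subr_eq0.
  apply: (mulIf d0); rewrite /meet_abscissa divfK //; move: h; lra.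
by rewrite /crossing ns hx se sf.
Qed.

Lemma height_l e : height e (X e.1) = Y e.1.
Proof. by rewrite /height subrr mulr0 addr0. Qed.

Lemma height_r e : X e.1 < X e.2 -> height e (X e.2) = Y e.2.
Proof.
move=> lt; rewrite /height /slope divfK ?subr_eq0 ?gt_eqF //; ring.
Qed.

Lemma height_diff e x y : height e x - height e y = slope e * (x - y).
Proof. rewrite /height; ring. Qed.

Lemma crossing_between e f x1 x2 : x1 < x2 ->
  X e.1 <= x1 -> X f.1 <= x1 -> x2 <= X e.2 -> x2 <= X f.2 ->
  height e x1 < height f x1 -> height f x2 < height e x2 -> crossing e f.
Proof.
move=> lt12 e1 f1 e2 f2 h1 h2.
pose a := height f x1 - height e x1; pose b := height e x2 - height f x2.
have a0 : 0 < a by rewrite /a; lra.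
have b0 : 0 < b by rewrite /b; lra.
have ab0 : a + b != 0 by rewrite gt_eqF //; lra.
pose x := x1 + a / (a + b) * (x2 - x1).
have t0 : 0 < a / (a + b) by rewrite divr_gt0 //; lra.
have t1 : a / (a + b) < 1 by rewrite ltr_pdivrMr; lra.
have x1x : x1 < x by rewrite /x; nra.
have xx2 : x < x2 by rewrite /x; nra.
have sab : (slope e - slope f) * (x2 - x1) = a + b.
  rewrite /a /b /height; ring.
apply: (@crossingP _ _ x).
- by rewrite -subr_eq0; apply: contraNneq ab0 => s0; rewrite -sab s0 mul0r.
- by apply/andP; split; lra.
- by apply/andP; split; lra.
apply/eqP; rewrite -subr_eq0; apply/eqP.
have -> : height e x - height f x = (slope e - slope f) * (x - x1) - a.
  by rewrite /a /height; ring.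
have -> : x - x1 = a / (a + b) * (x2 - x1) by rewrite /x; ring.
rewrite mulrCA sab divfK //; ring.
Qed.

Section Bound.
Variables (V : {set T}) (D : {set T * T}).
Hypothesis D_ends : forall e, e \in D -> [/\ e.1 \in V, e.2 \in V & X e.1 < X e.2].
Hypothesis D_vertex : forall e v, e \in D -> v \in V -> spans e (X v) ->
  height e (X v) != Y v.
Hypothesis D_planar : forall e f, e \in D -> f \in D -> ~~ crossing e f.

(** Without a crossing the slopes agree, so the edges overlap on one line; an end of one strictly
    inside the other would be a vertex in the interior of an edge. *)
Lemma same_height_eq e f x : e \in D -> f \in D ->
  spans e x -> spans f x -> height e x = height f x -> e = f.
Proof.
move=> eD fD se sf hx.
have sl : slope e = slope f.
  by apply/eqP; apply: contraT => ns; have := D_planar eD fD;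
     rewrite (crossingP ns se sf hx).
have hE y : height e y = height f y.
  have := height_diff e y x; have := height_diff f y x; rewrite sl; lra.
move: se sf => /andP[se1 se2] /andP[sf1 sf2].
have [e1V e2V lte] := D_ends eD; have [f1V f2V ltf] := D_ends fD.
have h1 : e.1 = f.1.
  apply: Xinj; case: (ltgtP (X e.1) (X f.1)) => // lt.
  - have := D_vertex eD f1V; rewrite /spans lt (lt_trans sf1 se2) => /(_ isT).
    by rewrite hE height_l eqxx.
  - have := D_vertex fD e1V; rewrite /spans lt (lt_trans se1 sf2) => /(_ isT).
    by rewrite -hE height_l eqxx.
have h2 : e.2 = f.2.
  apply: Xinj; case: (ltgtP (X e.2) (X f.2)) => // lt.
  - have := D_vertex fD e2V; rewrite /spans lt (lt_trans sf1 se2) => /(_ isT).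
    by rewrite -hE height_r // eqxx.
  - have := D_vertex eD f2V; rewrite /spans lt (lt_trans se1 sf2) => /(_ isT).
    by rewrite hE height_r // eqxx.
by move: h1 h2; case: (e) => ? ?; case: (f) => ? ? /= -> ->.
Qed.

Definition top_right e := [forall f in D, (f.1 == e.1) ==> (slope f <= slope e)].
(** Seen from a common right end, the topmost edge is the one of smallest slope, hence the reversed
    inequality. *)
Definition top_left e := [forall f in D, (f.2 == e.2) ==> (slope e <= slope f)].
Definition just_below e v := [&& v \in V, spans e (X v), height e (X v) < Y v &
  [forall f in D, spans f (X v) ==> (height e (X v) < height f (X v))
     ==> (Y v <= height f (X v))]].

Lemma below_exists e : e \in D -> ~~ top_right e -> ~~ top_left e ->
  exists v, just_below e v.
Proof.
move=> eD /forall_inPn[f0 f0D]; rewrite negb_imply -ltNge => f0e.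
move=> /forall_inPn[g gD]; rewrite negb_imply -ltNge => /andP[/eqP g2 slg].
have [e1V e2V lte] := D_ends eD.
pose P f := [&& f \in D, f.1 == e.1 & slope e < slope f].
have Pf0 : P f0 by rewrite /P f0D.
(* [e'] is the upper neighbour of [e] at the left end, [g] an edge that reaches the right end of [e]
   from above. *)
case: (arg_minP slope Pf0) => e' /and3P[e'D /eqP e'1 sle'] mine'.
have [_ e'2V lte'] := D_ends e'D; rewrite e'1 in lte'.
have [g1V _ ltg] := D_ends gD; rewrite g2 in ltg.
pose W v := [&& v \in V, X e.1 < X v, X v < X e.2, X v <= X e'.2,
  height e (X v) < Y v & Y v <= height e' (X v)].
have he' x : height e' x = Y e.1 + slope e' * (x - X e.1) by rewrite /height e'1.
have hg x : height g x = Y e.2 + slope g * (x - X e.2).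
  have := height_diff g x (X g.2); rewrite height_r ?g2 //; lra.
have her x : height e x = Y e.2 + slope e * (x - X e.2).
  have := height_diff e x (X e.2); rewrite height_r //; lra.
(* The wedge contains the right end of [e'] if that comes before the right end of [e]; otherwise it
   contains the left end of [g], which cannot start outside without crossing [e']. *)
have [v0 Wv0] : exists v, W v.
  case: (ltgtP (X e'.2) (X e.2)) => [lt2|lt2|/Xinj eq2].
  - exists e'.2; rewrite /W e'2V lte' lt2 lexx /=; apply/andP; split.
      have <- : height e' (X e'.2) = Y e'.2 by rewrite height_r ?e'1.
      rewrite he' /height.
      by rewrite ltrD2l ltr_pM2r // subr_gt0.
    by rewrite height_r ?e'1.
  - have q_lt : Y e.2 < height e' (X e.2).
      rewrite -{1}(height_r lte) he' /height ltrD2l ltr_pM2r // subr_gt0 //.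
    have ncr := D_planar e'D gD.
    have lt1 : X e.1 < X g.1.
      case: (ltgtP (X e.1) (X g.1)) => // [lt1|/Xinj eq1].
        case/negP: ncr; apply: (@crossing_between _ _ (X e.1) (X e.2)) => //.
        + by rewrite e'1.
        + exact: ltW.
        + exact: ltW.
        + by rewrite g2.
        + rewrite {1}he' subrr mulr0 addr0.
          have -> : Y e.1 = height e (X e.1) by rewrite height_l.
          by rewrite her hg ltrD2l ltr_nM2r // subr_lt0.
        + by rewrite [in X in X < _]hg subrr mulr0 addr0.
      have ge : g = e by move: eq1 g2; case: (g) => ? ?; case: (e) => ? ? /= -> ->.
      by rewrite ge ltxx in slg.
    exists g.1; rewrite /W g1V lt1 ltg (ltW (lt_trans ltg lt2)) /=.
    rewrite -[Y g.1](height_l g); apply/andP; split.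
      by rewrite her hg ltrD2l ltr_nM2r // subr_lt0.
    rewrite leNgt; apply: contra ncr => lth.
    apply: (@crossing_between _ _ (X g.1) (X e.2)) => //.
    + by rewrite e'1 ltW.
    + exact: ltW.
    + by rewrite g2.
    + by rewrite [in X in X < _]hg subrr mulr0 addr0.
  - have ee : e' = e by move: e'1 eq2; case: (e') => ? ?; case: (e) => ? ? /= -> ->.
    by rewrite ee ltxx in sle'.
case: (arg_minP X Wv0) => v /and5P[vV v1 v2 v3 /andP[v4 v5]] minv.
exists v; rewrite /just_below vV /spans v1 v2 v4 /=.
apply/forall_inP => f fD; apply/implyP => /andP[sf1 sf2]; apply/implyP => hef.
rewrite leNgt; apply/negP => hfv.
have [f1V f2V ltf] := D_ends fD.
have nef := D_planar fD eD; have ne'f := D_planar e'D fD.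
(* An edge passing between [e] and [v] crosses [e] or [e'], unless it starts inside the wedge,
   against the minimality of [X v], or at [e.1], against the choice of [e']. *)
case: (ltgtP (X f.1) (X e.1)) => [lt1|lt1|/Xinj eq1].
- have hne := D_vertex fD e1V; rewrite /spans lt1 (lt_trans v1 sf2) in hne.
  case: (ltgtP (height f (X e.1)) (Y e.1)) (hne isT) => // h _.
  + case/negP: nef; apply: (@crossing_between _ _ (X e.1) (X v)) => //.
    * exact: ltW.
    * exact: ltW.
    * exact: ltW.
    * by rewrite height_l.
  + case/negP: ne'f; apply: (@crossing_between _ _ (X e.1) (X v)) => //.
    * by rewrite e'1.
    * exact: ltW.
    * exact: ltW.
    * by rewrite he' subrr mulr0 addr0.
    * exact: (lt_le_trans hfv).
- case: (ltP (height e' (X f.1)) (Y f.1)) => h1.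
    case/negP: ne'f; apply: (@crossing_between _ _ (X f.1) (X v)) => //.
    * by rewrite e'1 ltW.
    * exact: ltW.
    * by rewrite height_l.
    * exact: (lt_le_trans hfv).
  have hne := D_vertex eD f1V; rewrite /spans lt1 (lt_trans sf1 v2) in hne.
  case: (ltgtP (height e (X f.1)) (Y f.1)) (hne isT) => // h _.
    have := minv f.1; rewrite /W f1V lt1 (lt_trans sf1 v2) h h1.
    by rewrite (ltW (lt_le_trans sf1 v3)) => /(_ isT); rewrite leNgt sf1.
  case/negP: nef; apply: (@crossing_between _ _ (X f.1) (X v)) => //.
  * exact: ltW.
  * exact: ltW.
  * exact: ltW.
  * by rewrite height_l.
- have := mine' f; rewrite /P fD eq1 eqxx /=.
  have hf x : height f x = Y e.1 + slope f * (x - X e.1) by rewrite /height eq1.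
  move: hef; rewrite hf /height ltrD2l ltr_pM2r ?subr_gt0 // => -> /(_ isT).
  move: (lt_le_trans hfv v5); rewrite hf he' ltrD2l ltr_pM2r ?subr_gt0 //.
  by rewrite ltNge => /negP.
Qed.

(* Every edge has the largest slope at its left end, or the smallest slope at its right end, or
   is the first edge below some vertex (the leftmost one in the wedge between the edge and its
   upper neighbour), and each of the three alternatives determines the edge from a vertex. *)
Lemma planar_bound : (#|D| <= 3 * #|V|)%N.
Proof.
pose D1 := [set e in D | top_right e]; pose D2 := [set e in D | top_left e].
pose D3 := [set e in D | [exists v, just_below e v]].
have sub : D \subset D1 :|: D2 :|: D3.
  apply/fintype.subsetP => e eD; rewrite !inE eD /=.
  case: (boolP (top_right e)) => //= n1; case: (boolP (top_left e)) => //= n2.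
  by have [v jv] := below_exists eD n1 n2; apply/existsP; exists v.
have same_eq (e f : T * T) : e \in D -> f \in D -> slope e = slope f ->
    (e.1 = f.1 \/ e.2 = f.2) -> e = f.
  move=> eD fD sl ends.
  have [e1V e2V lte] := D_ends eD; have [f1V f2V ltf] := D_ends fD.
  have hE y : height e y = height f y.
    case: ends => h; first by rewrite /height sl h.
    have := height_diff e y (X e.2); have := height_diff f y (X f.2).
    rewrite !height_r // sl h; lra.
  pose x1 := Num.max (X e.1) (X f.1); pose x2 := Num.min (X e.2) (X f.2).
  have lt12 : x1 < x2.
    by rewrite /x1 /x2 lt_min !gt_max lte ltf; case: ends => h;
       rewrite h ?ltf -?h ?lte.
  have [y [l1 l2]] : exists y, x1 < y /\ y < x2 by exists ((x1 + x2) / 2); lra.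
  move: l1 l2; rewrite /x1 /x2 gt_max lt_min => /andP[? ?] /andP[? ?].
  by apply: (@same_height_eq e f y); rewrite // /spans; apply/andP.
have c1 : (#|D1| <= #|V|)%N.
  rewrite -(@card_in_imset _ _ fst D1) => [|e f].
    apply: subset_leq_card; apply/fintype.subsetP => _ /imsetP[e + ->].
    by rewrite inE => /andP[/D_ends[]].
  rewrite !inE => /andP[eD /forall_inP te] /andP[fD /forall_inP tf] ef.
  apply: same_eq => //; last by left.
  apply/eqP; rewrite eq_le; have := te f fD; have := tf e eD.
  by rewrite ef eqxx /= => -> ->.
have c2 : (#|D2| <= #|V|)%N.
  rewrite -(@card_in_imset _ _ snd D2) => [|e f].
    apply: subset_leq_card; apply/fintype.subsetP => _ /imsetP[e + ->].
    by rewrite inE => /andP[/D_ends[]].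
  rewrite !inE => /andP[eD /forall_inP te] /andP[fD /forall_inP tf] ef.
  apply: same_eq => //; last by right.
  apply/eqP; rewrite eq_le; have := te f fD; have := tf e eD.
  by rewrite ef eqxx /= => -> ->.
have c3 : (#|D3| <= #|V|)%N.
  pose F e := odflt e.1 [pick v | just_below e v].
  have FP e : e \in D3 -> just_below e (F e).
    rewrite inE /F => /andP[_ /existsP[v jv]].
    by case: pickP => [//|/(_ v)]; rewrite jv.
  rewrite -(@card_in_imset _ _ F D3) => [|e f].
    apply: subset_leq_card; apply/fintype.subsetP => _ /imsetP[e + ->].
    by move=> /FP /andP[].
  move=> e3 f3 ef; have := FP e e3; have := FP f f3; rewrite -ef.
  move: e3 f3; rewrite !inE => /andP[eD _] /andP[fD _].
  case/and4P=> vV sf hf /forall_inP bf /and4P[_ se he /forall_inP be].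
  apply: (same_height_eq eD fD se sf).
  case: (ltgtP (height e (X (F e))) (height f (X (F e)))) => // lt.
  - by have := be f fD; rewrite sf lt /= leNgt hf.
  - by have := bf e eD; rewrite se lt /= leNgt he.
apply: leq_trans (subset_leq_card sub) _.
apply: leq_trans (leq_card_setU _ _) _.
rewrite !mulSn addn0 addnA leq_add //.
by apply: leq_trans (leq_card_setU _ _) _; rewrite leq_add.
Qed.
End Bound.

(** * The crossing lemma *)

(** Deleting one edge of a crossing pair destroys at least one crossing; once none is left, the
    planar bound applies. *)
Lemma crossing_excess (V : {set T}) (D : {set T * T}) :
  (forall e, e \in D -> [/\ e.1 \in V, e.2 \in V & X e.1 < X e.2]) ->
  (forall e v, e \in D -> v \in V -> spans e (X v) -> height e (X v) != Y v) ->
  (#|D| <= 3 * #|V| + #|[set p | [&& p.1 \in D, p.2 \in D & crossing p.1 p.2]]|)%N.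
Proof.
elim: {D}_.+1 {-2}D (ltnSn #|D|) => // n IHn D cD Dends Dvert.
have [noc|] := boolP [forall e in D, forall f in D, ~~ crossing e f].
  apply: leq_trans (leq_addr _ _); apply: planar_bound Dends Dvert _.
  by move=> e f eD fD; have /forall_inP := forall_inP noc _ eD; apply.
case/forall_inPn=> e eD /forall_inPn[f fD]; rewrite negbK => cef.
have sub g : g \in D :\ e -> g \in D by rewrite !inE => /andP[].
have := IHn (D :\ e); rewrite (cardsD1 e D) eD add1n in cD *.
move=> /(_ cD (fun g gD => Dends g (sub g gD))
  (fun g v gD => Dvert g v (sub g gD))) h.
set C := [set p | _]; set C' := [set p | _] in h.
have : C' \proper C.
  apply/properP; split.
    by apply/fintype.subsetP => p; rewrite !inE => /and3P[/andP[_ ->] /andP[_ ->] ->].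
  by exists (e, f); rewrite !inE /= ?eD ?fD ?cef // eqxx.
move/proper_card => lt; apply: leq_ltn_trans h _.
by rewrite ltn_add2l.
Qed.

(** A uniformly random [g] vanishes on [Q] with probability [n.+1 ^- #|Q|], written without
    division. *)
Lemma card_ffun_vanish (n : nat) (Q : {set T}) :
  (#|[set g : {ffun T -> 'I_n.+1} | [forall x in Q, g x == ord0]]| * n.+1 ^ #|Q|
   = n.+1 ^ #|T|)%N.
Proof.
have -> : #|[set g : {ffun T -> 'I_n.+1} | [forall x in Q, g x == ord0]]|
  = #|pffun_on (ord0 : 'I_n.+1) (mem (~: Q)) predT|.
  apply: eq_card => g; rewrite inE; apply/forall_inP/pffun_onP => [h|[h _] x xQ].
    split=> //; apply/fintype.subsetP => x; rewrite !inE => gx.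
    by apply: contra gx => /h.
  by apply: contraLR xQ => gx; have := fintype.subsetP h x; rewrite !inE; apply.
by rewrite card_pffun_on card_ord -expnD addnC cardsC.
Qed.

(** With four distinct ends a crossing survives the sampling with the fourth power of the vertex
    probability, against the second power for an edge. *)
Lemma crossing_ends e f : X e.1 < X e.2 -> X f.1 < X f.2 -> crossing e f ->
  #|[set e.1; e.2; f.1; f.2]| = 4%N.
Proof.
move=> lte ltf /and3P[ns /andP[se1 se2] /andP[sf1 sf2]].
set x := meet_abscissa e f in se1 se2 sf1 sf2.
have hx : height e x = height f x.
  have d0 : slope e - slope f != 0 by rewrite subr_eq0.
  have hm : x * (slope e - slope f) =
      Y f.1 - slope f * X f.1 - Y e.1 + slope e * X e.1 by rewrite divfK.
  rewrite /height; move: hm; lra.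
have ne y : y != x -> height e y != height f y.
  apply: contraNneq => hy; apply: contraR ns => xy.
  apply/eqP; apply: (@mulIf _ (y - x)); first by rewrite subr_eq0.
  by rewrite -!height_diff hy hx.
have n11 : e.1 != f.1.
  by apply: contraTneq (ne (X e.1) (negbT (lt_eqF se1))) => h;
     rewrite negbK height_l h height_l.
have n22 : e.2 != f.2.
  by apply: contraTneq (ne (X e.2) (negbT (gt_eqF se2))) => h;
     rewrite negbK height_r // h height_r.
have n12 : e.1 != f.2.
  by apply: contraTneq (lt_trans se1 sf2) => ->; rewrite ltxx.
have n21 : e.2 != f.1.
  by apply: contraTneq (lt_trans sf1 se2) => ->; rewrite ltxx.
have ne12 : e.1 != e.2 by apply: contraTneq lte => ->; rewrite ltxx.
have nf12 : f.1 != f.2 by apply: contraTneq ltf => ->; rewrite ltxx.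
by rewrite -!setUA !cardsU1 !cards1 !inE !negb_or ne12 n11 n12 n21 n22 nf12.
Qed.

(* Averaging [crossing_excess] over the vertex subsets [g @^-1 0], [g : T -> 'I_r]. *)
Lemma crossing_sampling (V : {set T}) (D : {set T * T}) (r : nat) :
  (forall e, e \in D -> [/\ e.1 \in V, e.2 \in V & X e.1 < X e.2]) ->
  (forall e v, e \in D -> v \in V -> spans e (X v) -> height e (X v) != Y v) ->
  (0 < r)%N ->
  (#|D| * r ^ 2 <= 3 * #|V| * r ^ 3
     + #|[set p | [&& p.1 \in D, p.2 \in D & crossing p.1 p.2]]|)%N.
Proof.
case: r => // r Dends Dvert _.
set C := [set p | _].
pose van (Q : {set T}) (g : {ffun T -> 'I_r.+1}) := [forall x in Q, g x == ord0].
pose Vg (g : {ffun T -> 'I_r.+1}) := [set v in V | van [set v] g].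
pose Dg (g : {ffun T -> 'I_r.+1}) := [set e in D | van [set e.1; e.2] g].
pose Cg (g : {ffun T -> 'I_r.+1}) :=
  [set p in C | van [set p.1.1; p.1.2; p.2.1; p.2.2] g].
have main g : (#|Dg g| <= 3 * #|Vg g| + #|Cg g|)%N.
  have sub e : e \in Dg g -> [/\ e \in D, e.1 \in Vg g & e.2 \in Vg g].
    rewrite !inE => /andP[eD /forall_inP h]; have [e1 e2 _] := Dends e eD.
    split; rewrite // ?e1 ?e2 /=; apply/forall_inP => x; rewrite inE => /eqP ->;
      by apply: h; rewrite !inE eqxx ?orbT.
  have := @crossing_excess (Vg g) (Dg g).
  move=> /(_ (fun e h => let: And3 eD e1 e2 := sub e h in
                let: And3 _ _ lt := Dends e eD in And3 e1 e2 lt)) h.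
  apply: leq_trans (h _) _ => [e v /sub[eD _ _]|].
    by rewrite inE => /andP[vV _]; apply: Dvert.
  rewrite leq_add2l; apply: subset_leq_card; apply/fintype.subsetP => p.
  rewrite !inE => /and3P[/andP[p1 /forall_inP g1] /andP[p2 /forall_inP g2] ->].
  rewrite p1 p2 /=; apply/forall_inP => x; rewrite !inE -!orbA => /or4P[] /eqP ->;
    solve [apply: g1; rewrite !inE eqxx ?orbT // | apply: g2; rewrite !inE eqxx ?orbT //].
have sum_card (U : finType) (A : {set U}) (Q : U -> {set T}) (k : nat) :
  (forall u, u \in A -> #|Q u| = k) ->
  ((\sum_(g : {ffun T -> 'I_r.+1}) #|[set u in A | van (Q u) g]|) * r.+1 ^ k
    = #|A| * r.+1 ^ #|T|)%N.
  move=> hQ; under eq_bigr do rewrite -sum1_card.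
  rewrite (eq_bigr (fun g => \sum_(u in A) (van (Q u) g : nat))%N); last first.
    move=> g _; rewrite big_mkcond [RHS]big_mkcond /=; apply: eq_bigr => u _.
    by rewrite inE; case: (u \in A); case: (van _ _).
  rewrite exchange_big big_distrl /= -sum_nat_const; apply: eq_bigr => u uA.
  rewrite -(card_ffun_vanish r (Q u)) hQ //; congr (_ * _)%N.
  rewrite -sum1_card big_mkcond [RHS]big_mkcond /=; apply: eq_bigr => g _.
  by rewrite inE /van; case: ifP.
have sV := @sum_card _ V (fun v => [set v]) 1%N (fun _ _ => cards1 _).
have sD : ((\sum_g #|Dg g|) * r.+1 ^ 2 = #|D| * r.+1 ^ #|T|)%N.
  apply: sum_card => e /Dends[_ _ lt]; rewrite cards2.
  by rewrite (_ : e.1 != e.2) //; apply: contraTneq lt => ->; rewrite ltxx.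
have sC : ((\sum_g #|Cg g|) * r.+1 ^ 4 = #|C| * r.+1 ^ #|T|)%N.
  apply: sum_card => p; rewrite inE => /and3P[/Dends[_ _ l1] /Dends[_ _ l2] c].
  exact: crossing_ends.
have rT0 : (0 < r.+1 ^ #|T|)%N by rewrite expn_gt0.
(* With r for [r.+1], the averages over [g] satisfy D / r^2 <= 3 V / r + C / r^4; everything is
   multiplied by r^4 and by the number of maps [g]. *)
rewrite -(leq_pmul2r rT0) mulnDl.
have -> : (#|D| * r.+1 ^ 2 * r.+1 ^ #|T| = (\sum_g #|Dg g|) * r.+1 ^ 4)%N.
  by rewrite mulnAC -sD -mulnA -expnD.
have -> : (3 * #|V| * r.+1 ^ 3 * r.+1 ^ #|T| = (\sum_g (3 * #|Vg g|)) * r.+1 ^ 4)%N.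
  rewrite -big_distrr /= -2!mulnA [(r.+1 ^ 3 * _)%N]mulnC [(#|V| * _)%N]mulnA -sV.
  by rewrite -!mulnA -expnD.
rewrite -sC -mulnDl -big_split /=.
by rewrite leq_mul2r leq_sum ?orbT.
Qed.

(** * Lines with many points *)

Section RichLines.
Variables (V : {set T}) (I : finType) (mu nu : I -> R).
Hypothesis line_inj : forall i j, mu i = mu j -> nu i = nu j -> i = j.

Definition line_points i := [set x in V | Y x == mu i * X x + nu i].
Definition consecutive i e := [&& e.1 \in line_points i, e.2 \in line_points i,
  X e.1 < X e.2 & [forall v in line_points i, ~~ spans e (X v)]].

Lemma consecutive_height i e : consecutive i e ->
  slope e = mu i /\ forall x, height e x = mu i * x + nu i.
Proof.
case/and4P; rewrite !inE => /andP[_ /eqP y1] /andP[_ /eqP y2] lt _.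
have d0 : X e.2 - X e.1 != 0 by rewrite subr_eq0 gt_eqF.
have sl : slope e = mu i.
  by apply: (mulIf d0); rewrite /slope divfK // y1 y2; ring.
by split=> // x; rewrite /height sl y1; ring.
Qed.

Lemma consecutive_inj_span i e f x : consecutive i e -> consecutive i f ->
  spans e x -> spans f x -> e = f.
Proof.
case/and4P=> e1 e2 lte /forall_inP he /and4P[f1 f2 ltf /forall_inP hf].
case/andP=> ex1 ex2 /andP[fx1 fx2].
have h1 : e.1 = f.1.
  apply: Xinj; case: (ltgtP (X e.1) (X f.1)) => // lt.
  - by have := he _ f1; rewrite /spans lt (lt_trans fx1 ex2).
  - by have := hf _ e1; rewrite /spans lt (lt_trans ex1 fx2).
have h2 : e.2 = f.2.
  apply: Xinj; case: (ltgtP (X e.2) (X f.2)) => // lt.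
  - by have := hf _ e2; rewrite /spans lt (lt_trans fx1 ex2).
  - by have := he _ f2; rewrite /spans lt (lt_trans ex1 fx2).
by move: h1 h2; case: (e) => ? ?; case: (f) => ? ? /= -> ->.
Qed.

Lemma consecutive_inj_line i j e : consecutive i e -> consecutive j e -> i = j.
Proof.
move=> /consecutive_height[sl hi] /consecutive_height[sl' hj].
have mm : mu i = mu j by rewrite -sl.
by apply: line_inj => //; have := hi 0; rewrite hj mm; lra.
Qed.

Lemma card_consecutive i :
  (#|line_points i|.-1 <= #|[set e | consecutive i e]|)%N.
Proof.
have [->|[x0 x0i]] := set_0Vmem (line_points i); first by rewrite cards0.
case: (arg_maxP X x0i) => m im maxm; have mi : m \in line_points i by exact: im.
rewrite (cardsD1 m) mi /=.
apply: leq_trans (leq_imset_card fst (mem [set e | consecutive i e])).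
apply: subset_leq_card; apply/fintype.subsetP => x; rewrite in_setD1 => /andP[xm xi].
have xltm : X x < X m.
  by rewrite lt_neqAle (inj_eq Xinj) xm; apply: maxm.
pose P y := (y \in line_points i) && (X x < X y).
have Pm : P m by rewrite /P mi.
case: (arg_minP X Pm) => y /andP[yi xy] miny.
apply/imsetP; exists (x, y) => //; rewrite inE /consecutive /= xi yi xy /=.
apply/forall_inP => v vi; apply/negP => /andP[/= xv vy].
by have := miny v; rewrite /P vi xv leNgt vy => /(_ isT).
Qed.

(** [D] counts the segments between neighbouring points of the rich lines: a line with t points
    carries t - 1 of them, and an ordered pair of lines accounts for at most one crossing of
    segments. *)
Lemma rich_lines_sampling (t : nat) :
  let L := #|[set i | (t <= #|line_points i|)%N]| in
  exists2 D, (L * t.-1 <= D)%N & forall r, (0 < r)%N ->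
    (D * r ^ 2 <= 3 * #|V| * r ^ 3 + L ^ 2)%N.
Proof.
move=> L; pose Lt := [set i | (t <= #|line_points i|)%N].
pose D := [set e | [exists i in Lt, consecutive i e]].
exists #|D|.
  pose li (e : T * T) := [pick i in Lt | consecutive i e].
  have -> : #|D| = (\sum_(i in Lt) #|[set e | consecutive i e]|)%N.
    rewrite -sum1_card; under [RHS]eq_bigr do rewrite -sum1_card.
    rewrite (exchange_big_dep (mem D)) /=; last first.
      by move=> i e iL; rewrite !inE => ce; apply/existsP; exists i; rewrite inE in iL *; rewrite iL.
    apply: eq_bigr => e; rewrite inE => /exists_inP[i iL ce].
    rewrite (big_pred1 i) // => j; rewrite !inE /=; apply/andP/eqP => [[_ cj]|->].
      exact: consecutive_inj_line cj ce.
    by rewrite inE in iL.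
  rewrite /L -/Lt -sum_nat_const; apply: leq_sum => i; rewrite inE => ti.
  by apply: leq_trans (card_consecutive i); case: (t) ti => // t' ti; rewrite -ltnS; apply: leq_trans ti (leqSpred _).
have De e : e \in D -> exists2 i, i \in Lt & consecutive i e.
  by rewrite inE => /exists_inP.
move=> r r0; apply: leq_trans (crossing_sampling (V := V) (D := D) _ _ r0) _.
- move=> e /De[i _ /and4P[]]; rewrite !inE => /andP[-> _] /andP[-> _] ->.
  by [].
- move=> e v /De[i _ ce] vV se; apply: contraTneq se => hv.
  have [_ hE] := consecutive_height ce.
  case/and4P: ce => _ _ _ /forall_inP; apply.
  by rewrite inE vV -hE hv /=.
rewrite leq_add2l /L -/Lt expnS expn1 -cardsX.
pose line (e : T * T) := [pick i in Lt | consecutive i e].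
have lineP e : e \in D -> exists2 i, line e = Some i & (i \in Lt) && consecutive i e.
  move=> /De[i iL ce]; rewrite /line; case: pickP => [j jP|/(_ i)].
    by exists j.
  by rewrite iL ce.
pose F (p : (T * T) * (T * T)) := (line p.1, line p.2).
set C := [set p | _].
have CP p : p \in C -> [/\ p.1 \in D, p.2 \in D & crossing p.1 p.2].
  by rewrite inE => /and3P.
have Finj : {in C &, injective F}.
  move=> [e f] [e' f'] /CP[/= eD fD c] /CP[/= e'D f'D c'].
  rewrite /F /=.
  have [i -> /andP[_ ie]] := lineP e eD; have [j -> /andP[_ jf]] := lineP f fD.
  have [i' -> /andP[_ ie']] := lineP e' e'D.
  have [j' -> /andP[_ jf']] := lineP f' f'D.
  move=> [ii jj]; rewrite -{}ii in ie'; rewrite -{}jj in jf'.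
  have mE (g h : T * T) : slope g = slope e -> slope h = slope f ->
      (forall x, height g x = height e x) -> (forall x, height h x = height f x) ->
      meet_abscissa g h = meet_abscissa e f.
    move=> sg sh hg hh; rewrite /meet_abscissa sg sh; congr (_ / _).
    have := hg 0; have := hh 0; rewrite /height sg sh; lra.
  have [se he] := consecutive_height ie; have [se' he'] := consecutive_height ie'.
  have [sf hf] := consecutive_height jf; have [sf' hf'] := consecutive_height jf'.
  have m : meet_abscissa e' f' = meet_abscissa e f.
    apply: mE => [||x|x]; by rewrite ?se ?se' ?sf ?sf' ?he ?he' ?hf ?hf'.
  case/and3P: c => _ ce cf; case/and3P: c' => _; rewrite m => ce' cf'.
  by rewrite (consecutive_inj_span ie ie' ce ce') (consecutive_inj_span jf jf' cf cf').
rewrite -(card_in_imset Finj).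
have -> : #|setX Lt Lt| = #|[set (Some p.1, Some p.2) | p in setX Lt Lt]|.
  by rewrite card_imset // => -[? ?] [? ?] /= [-> ->].
apply: subset_leq_card; apply/fintype.subsetP => _ /imsetP[[e f] + ->].
case/CP => /= /lineP[i le /andP[iL _]] /lineP[j lf /andP[jL _]] _.
by apply/imsetP; exists (i, j); rewrite ?inE /F /= ?le ?lf //; rewrite !inE in iL jL; rewrite iL jL.
Qed.

Theorem szemeredi_trotter (t : nat) : (2 <= t)%N ->
  #|[set i | (t <= #|line_points i|)%N]|%:R
    <= 2304 * (#|V|%:R ^+ 2 / t%:R ^+ 3 + #|V|%:R / t%:R) :> R.
Proof.
move=> t2; set L := #|_|; set n := #|V|.
have t0 : (0 < t%:R :> R) by rewrite ltr0n; apply: leq_trans t2.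
have L0 : (0 <= L%:R :> R) by rewrite ler0n.
have n0 : (0 <= n%:R :> R) by rewrite ler0n.
have q1 : 0 <= n%:R ^+ 2 / t%:R ^+ 3 :> R by rewrite divr_ge0 // exprn_ge0 // ltW.
have q2 : 0 <= n%:R / t%:R :> R by rewrite divr_ge0 // ltW.
have half : (t%:R : R) <= 2 * t.-1%:R.
  by rewrite -natrM ler_nat; case: (t) t2 => [|[|k]] //= _; rewrite mulSn mul1n; lia.
have [D LD sD] := rich_lines_sampling t.
have {}LD : L%:R * t%:R <= 2 * D%:R :> R.
  have : L%:R * t.-1%:R <= D%:R :> R by rewrite -natrM ler_nat.
  by move: half L0; nra.
(* With few segments the term n / t alone suffices. *)
have [Dsmall|Dbig] := ltnP D (6 * n).
  have h : D%:R <= 6 * n%:R :> R by rewrite -natrM ler_nat ltnW.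
  have : L%:R * t%:R <= 12 * n%:R :> R by lra.
  rewrite -ler_pdivlMr // => h2; apply: le_trans h2 _.
  by rewrite -mulrA; lra.
have [n00|npos] := posnP n.
  have L00 : L = 0%N.
    apply/eqP; rewrite cards_eq0; apply/eqP/setP => i; rewrite !inE.
    apply/negbTE; rewrite -ltnNge; apply: leq_ltn_trans (ltnW t2).
    rewrite -n00 subset_leq_card //.
    by apply/fintype.subsetP => x; rewrite inE => /andP[].
  by rewrite L00 mulr_ge0 // addr_ge0.
(* At this rate [3 * n * r ^ 3] is at most half of [D * r ^ 2]. What remains gives D^3 <= 288 n^2
   L^2, and 2304 = 8 * 288 because L t <= 2 D. *)
pose r := (D %/ (6 * n))%N.
have n6 : (0 < 6 * n)%N by rewrite muln_gt0.
have r0 : (0 < r)%N by rewrite divn_gt0.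
have r1 : 1 <= r%:R :> R by rewrite ler1n.
have lo : 6 * n%:R * r%:R <= D%:R :> R.
  by rewrite -!natrM ler_nat mulnC leq_trunc_div.
have hi : D%:R <= 12 * n%:R * r%:R :> R.
  have : D%:R <= 6 * n%:R * (r%:R + 1) :> R.
    by rewrite natr1 -!natrM ler_nat mulnC ltnW // ltn_ceil.
  by nra.
have main : D%:R * r%:R ^+ 2 <= 3 * n%:R * r%:R ^+ 3 + L%:R ^+ 2 :> R.
  by rewrite -!natrX -!natrM -natrD ler_nat; exact: sD.
have m1 : D%:R * r%:R ^+ 2 <= 2 * L%:R ^+ 2 :> R.
  have : 6 * n%:R * r%:R * r%:R ^+ 2 <= D%:R * r%:R ^+ 2 :> R.
    by rewrite ler_wpM2r // sqr_ge0.
  by move: main; rewrite !exprS; lra.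
have D0 : 0 <= D%:R :> R by rewrite ler0n.
have m2 : D%:R ^+ 3 <= 288 * n%:R ^+ 2 * L%:R ^+ 2 :> R.
  have h : D%:R ^+ 2 <= (12 * n%:R * r%:R) ^+ 2 :> R.
    by rewrite lerXn2r // nnegrE // !mulr_ge0.
  have : D%:R * D%:R ^+ 2 <= D%:R * (12 * n%:R * r%:R) ^+ 2 :> R by rewrite ler_wpM2l.
  have : 144 * n%:R ^+ 2 * (D%:R * r%:R ^+ 2) <= 144 * n%:R ^+ 2 * (2 * L%:R ^+ 2) :> R.
    by rewrite ler_wpM2l // mulr_ge0 // sqr_ge0.
  by rewrite -exprS !exprMn; lra.
have m3 : (L%:R * t%:R) ^+ 3 <= 2304 * n%:R ^+ 2 * L%:R ^+ 2 :> R.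
  have : (L%:R * t%:R) ^+ 3 <= (2 * D%:R) ^+ 3 :> R.
    by rewrite lerXn2r // nnegrE // mulr_ge0 // ltW.
  by rewrite [(2 * _) ^+ 3]exprMn; lra.
have [->|Lpos] := posnP L; first by rewrite mulr_ge0 // addr_ge0.
have L1 : 0 < L%:R :> R by rewrite ltr0n.
have m4 : L%:R * t%:R ^+ 3 <= 2304 * n%:R ^+ 2 :> R.
  rewrite -(ler_pM2r (exprn_gt0 2 L1)); apply: le_trans _ m3.
  by rewrite exprMn exprS; lra.
rewrite -ler_pdivlMr ?exprn_gt0 // in m4; apply: le_trans m4 _.
by rewrite -mulrA; lra.
Qed.
End RichLines.
End Planar.

(** * Rectangles in a planar point set *)

Section FiniteSums.
Variable R : realType.

Lemma sum_CauchySchwarz (I : finType) (P : pred I) (F G : I -> R) :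
  (\sum_(i | P i) F i * G i) ^+ 2
    <= (\sum_(i | P i) F i ^+ 2) * (\sum_(i | P i) G i ^+ 2).
Proof.
have h : 0 <= \sum_(i | P i) \sum_(j | P j) (F i * G j - F j * G i) ^+ 2.
  by apply: sumr_ge0 => i _; apply: sumr_ge0 => j _; rewrite sqr_ge0.
have e : \sum_(i | P i) \sum_(j | P j) (F i * G j - F j * G i) ^+ 2
  = 2 * ((\sum_(i | P i) F i ^+ 2) * (\sum_(i | P i) G i ^+ 2)
      - (\sum_(i | P i) F i * G i) ^+ 2).
  rewrite [X in 2 * (_ - X)]expr2 !big_distrlr /= -sumrB mulr_sumr.
  under [RHS]eq_bigr do rewrite -sumrB mulr_sumr.
  rewrite (eq_bigr (fun i => \sum_(j | P j) (F i ^+ 2 * G j ^+ 2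
     - F i * G i * (F j * G j)) + \sum_(j | P j) (F j ^+ 2 * G i ^+ 2
     - F i * G i * (F j * G j)))); last first.
    by move=> i _; rewrite -big_split /=; apply: eq_bigr => j _; ring.
  rewrite big_split /= [X in _ + X]exchange_big /= -big_split /=.
  apply: eq_bigr => i _; rewrite -big_split /=; apply: eq_bigr => j _; ring.
by move: h; rewrite e pmulr_rge0 // subr_ge0.
Qed.

Lemma sum_CauchySchwarz_sqrt (I : finType) (P : pred I) (F G : I -> R) :
  \sum_(i | P i) F i * G i
    <= Num.sqrt (\sum_(i | P i) F i ^+ 2) * Num.sqrt (\sum_(i | P i) G i ^+ 2).
Proof.
rewrite -sqrtrM; last by apply: sumr_ge0 => i _; rewrite sqr_ge0.
apply: le_trans (ler_norm _) _; rewrite -sqrtr_sqr ler_wsqrtr //.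
exact: sum_CauchySchwarz.
Qed.

Lemma ler_sum_set (I : finType) (P Q : pred I) (F : I -> R) :
  (forall i, P i -> Q i) -> (forall i, Q i -> 0 <= F i) ->
  \sum_(i | P i) F i <= \sum_(i | Q i) F i.
Proof.
move=> PQ F0; rewrite [X in X <= _]big_mkcond [X in _ <= X]big_mkcond /=.
apply: ler_sum => i _; case: ifP => Pi; first by rewrite PQ.
by case: ifP => // /F0.
Qed.

Lemma sum_natr_cond (I : finType) (P Q : pred I) :
  \sum_(i | P i) (Q i)%:R = #|[set i | P i && Q i]|%:R :> R.
Proof.
rewrite -sum1_card natr_sum big_mkcond [RHS]big_mkcond /=.
by apply: eq_bigr => i _; rewrite inE; case: (P i); case: (Q i).
Qed.

(** Dyadic powers with exponents in quarters become integer powers of [u]; [7 <= 6 * u] bounds the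
    sum of its negative powers by 1 / (u - 1) <= 6. *)
Lemma fourth_root2 : exists u : R, [/\ 1 <= u, u ^+ 4 = 2 & 7 <= 6 * u].
Proof.
pose u : R := Num.sqrt (Num.sqrt 2); exists u.
have u0 : 0 <= u by rewrite sqrtr_ge0.
have u4 : u ^+ 4 = 2.
  by rewrite (exprM u 2 2) /u sqr_sqrtr ?sqrtr_ge0 // sqr_sqrtr.
have u7 : 7 <= 6 * u.
  have h : (7 : R) ^+ 4 <= (6 * u) ^+ 4 by rewrite exprMn u4; lra.
  by rewrite -(@ler_pXn2r _ 4) // nnegrE ?mulr_ge0.
by split => //; lra.
Qed.

Lemma geometric_sum_le (u : R) (n : nat) : 0 < u -> 7 <= 6 * u ->
  \sum_(1 <= i < n.+1) (u ^- i) <= 6.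
Proof.
move=> u0 u7; suff : \sum_(1 <= i < n.+1) (u ^- i) <= 6 - 6 * u ^- n.
  by have : 0 < u ^- n by [rewrite invr_gt0 exprn_gt0]; lra.
elim: n => [|n IH]; first by rewrite big_geq // expr0 invr1; lra.
rewrite big_nat_recr //=.
have : u ^- n = u * u ^- n.+1.
  by rewrite exprS invfM mulVKf // gt_eqF.
have : 0 < u ^- n.+1 by rewrite invr_gt0 exprn_gt0.
move: IH; set v := u ^- n.+1; set z := u ^- n => IH v0 zE.
have : 7 * v <= 6 * u * v by rewrite ler_wpM2r // ltW.
by move: IH; rewrite zE; lra.
Qed.

Lemma mul11 j : (11 * j = 2 * j * 5 + j)%N. Proof. by lia. Qed.
Lemma mul12 j : (12 * j = 11 * j + j)%N. Proof. by lia. Qed.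

End FiniteSums.

(* [E] indexes directions, [key e x] is the line of direction [e] through [x], [perp e] the
   orthogonal direction, and [lev x] the dyadic rank class of the value of [f] at [x]. *)
Section Rect.
Variables (R : realType) (T E K : finType) (key : E -> T -> K) (perp : E -> E).
Variables (D0 : R) (lev : T -> nat).
Hypothesis D0_ge1 : 1 <= D0.
Hypothesis perpK : involutive perp.
Hypothesis perp_neq : forall e, perp e != e.
Hypothesis key_dir : forall x y e e', x != y ->
  key e x = key e y -> key e' x = key e' y -> e = e'.
Let D0_gt0 : 0 < D0. Proof. by apply: lt_le_trans D0_ge1. Qed.
Let D0_ge0 : 0 <= D0. Proof. exact: ltW. Qed.
Definition on (l : E * K) (x : T) := key l.1 x == l.2.
Hypothesis few_rich_lines : forall (P : {set T}) (t : nat), (2 <= t)%N ->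
  #|[set l | (t <= #|[set x in P | on l x]|)%N]|%:R
    <= D0 * (#|P|%:R ^+ 2 / t%:R ^+ 3 + #|P|%:R / t%:R).
Hypothesis lev_card : forall j, (#|[set x | lev x == j]| <= 2 ^ j)%N.

Definition k a (l : E * K) : nat := #|[set x in [set x | lev x == a] | on l x]|.
(** The threshold is twice the square root of 2^a: above it double counting is enough ([sum_rich]),
    below it the cubic term of Szemeredi-Trotter dominates ([few_poor_lines]). *)
Definition rich a l := (4 * 2 ^ a < k a l ^ 2)%N.
Definition kn a e x : nat := #|[set y | [&& lev y == a, y != x & key e y == key e x]]|.

Lemma kE a l : (k a l)%:R = \sum_(x | lev x == a) (on l x)%:R :> R.
Proof. by rewrite sum_natr_cond /k; congr (_%:R); apply: eq_card => x; rewrite !inE. Qed.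

Lemma k_le a l : (k a l <= 2 ^ a)%N.
Proof.
apply: leq_trans (lev_card a); apply: subset_leq_card.
by apply/fintype.subsetP => x; rewrite !inE => /andP[].
Qed.

(** Double counting of flags, a flag being a point with a line through it: a function of the line
    alone is weighted by the number of points on the line. *)
Lemma sum_flags b (F : E * K -> R) :
  \sum_(x | lev x == b) \sum_e F (e, key e x) = \sum_l (k b l)%:R * F l.
Proof.
under [RHS]eq_bigr do rewrite kE mulr_suml.
rewrite [RHS]exchange_big /=; apply: eq_bigr => x _.
rewrite (eq_bigr (fun l => (on (l.1, l.2) x)%:R * F (l.1, l.2))); last by case.
rewrite -(pair_bigA _ (fun e c => (on (e, c) x)%:R * F (e, c))) /=.
apply: eq_bigr => e _; rewrite (bigD1 (key e x)) //= /on eqxx mul1r big1 ?addr0 //.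
by move=> c /negbTE nc /=; rewrite eq_sym nc mul0r.
Qed.

Lemma sum_perp (F : E -> R) : \sum_e F (perp e) = \sum_e F e.
Proof. by rewrite [RHS](reindex_inj (inv_inj perpK)). Qed.

Lemma knE a e x :
  (kn a e x)%:R = \sum_(y | lev y == a) ((y != x) && (key e y == key e x))%:R :> R.
Proof. by rewrite sum_natr_cond. Qed.

Lemma one_dir x y : y != x -> \sum_e (key e y == key e x)%:R <= 1 :> R.
Proof.
move=> yx; have [[e0 h0]|none] := altP (@existsP _ (fun e => key e y == key e x)).
  rewrite (bigD1 e0) //= h0 big1 ?addr0 // => e ne; case: eqP => // he.
  by case/eqP: ne; apply: key_dir yx he (eqP h0).
rewrite big1 ?ler01 // => e _; case: eqP => // he.
by case/existsP: none; exists e; apply/eqP.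
Qed.

Lemma card_lev j : \sum_(x | lev x == j) (1:R) <= 2 ^+ j.
Proof.
rewrite (eq_bigr (fun=> true%:R)) // sum_natr_cond -natrX ler_nat.
apply: leq_trans (lev_card j); apply: subset_leq_card.
by apply/fintype.subsetP => x; rewrite !inE andbT.
Qed.

(** Two distinct points share a line in at most one direction, so each pair of points counts at most
    once. *)
Lemma sum_kn_flags a b :
  \sum_(x | lev x == b) \sum_e (kn a e x)%:R <= 2 ^+ b * 2 ^+ a :> R.
Proof.
under eq_bigr => x _.
  under eq_bigr do rewrite knE.
  rewrite exchange_big; over.
apply: le_trans (_ : \sum_(x | lev x == b) \sum_(y | lev y == a) (1:R) <= _).
  apply: ler_sum => x _; apply: ler_sum => y _.
  case: (boolP (y == x)) => yx; first by rewrite big1 ?ler01 // => e _.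
  by under eq_bigr do rewrite andTb; apply: one_dir.
apply: le_trans (_ : \sum_(x | lev x == b) 2 ^+ a <= _).
  by apply: ler_sum => x _; apply: card_lev.
under eq_bigr do rewrite -[2 ^+ a]mul1r.
by rewrite -mulr_suml ler_wpM2r ?exprn_ge0 ?card_lev.
Qed.

Lemma on_two_lines l l' x y : x != y -> on l x -> on l y -> on l' x -> on l' y -> l = l'.
Proof.
case: l l' => [e c] [e' c'] xy /eqP /= hx /eqP /= hy /eqP /= hx' /eqP /= hy'.
have ee : e = e' by apply: (key_dir xy); rewrite ?hx ?hx'.
by rewrite -hx -hx' ee.
Qed.

(* Two lines share at most one point, so the incidences [I] with [n] rich lines satisfy
   I^2 <= A (I + n^2) by Cauchy-Schwarz, while n <= I / (2 sqrt A). *)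
Lemma sum_rich a : \sum_(l | rich a l) (k a l)%:R <= 2 * 2 ^+ a :> R.
Proof.
set I := \sum_(l | _) _; pose n : R := #|[set l | rich a l]|%:R.
pose deg x : R := \sum_(l | rich a l) (on l x)%:R.
have IE : I = \sum_(x | lev x == a) deg x.
  by rewrite /I; under eq_bigr do rewrite kE; rewrite exchange_big.
have I0 : 0 <= I by apply: sumr_ge0 => l _.
have nI : 2 * n * Num.sqrt (2 ^+ a) <= I.
  have -> : n = \sum_(l | rich a l) 1.
    rewrite /n (eq_bigr (fun=> true%:R)) // sum_natr_cond.
    by congr (_%:R); apply: eq_card => l; rewrite !inE andbT.
  rewrite mulrAC mulr_sumr /I; apply: ler_sum => l rl; rewrite mulr1.
  have -> : 2 * Num.sqrt (2 ^+ a) = Num.sqrt (4 * 2 ^+ a) :> R.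
    rewrite sqrtrM //; congr (_ * _).
    by rewrite (_ : 4 = 2 ^+ 2 :> R) ?sqrtr_sqr ?ger0_norm //; ring.
  rewrite -[X in _ <= X]ger0_norm // -sqrtr_sqr ler_wsqrtr //.
  by rewrite -!natrX -natrM ler_nat ltnW.
have deg2 : \sum_(x | lev x == a) deg x ^+ 2 <= I + n ^+ 2.
  have -> : \sum_(x | lev x == a) deg x ^+ 2 = \sum_(l | rich a l)
     \sum_(l' | rich a l') \sum_(x | lev x == a) (on l x && on l' x)%:R.
    under [RHS]eq_bigr do rewrite exchange_big /=.
    rewrite [RHS]exchange_big /=; apply: eq_bigr => x _.
    rewrite expr2 /deg big_distrlr /=; apply: eq_bigr => l _; apply: eq_bigr => l' _.
    by rewrite -mulnb natrM.
  have -> : n ^+ 2 = \sum_(l | rich a l) \sum_(l' | rich a l') 1.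
    have nE : n = \sum_(l | rich a l) 1.
      rewrite /n (eq_bigr (fun=> true%:R)) // sum_natr_cond.
      by congr (_%:R); apply: eq_card => l; rewrite !inE andbT.
    by rewrite expr2 {1 2}nE big_distrlr /=; under eq_bigr do under eq_bigr do rewrite mulr1.
  rewrite /I -big_split /=; apply: ler_sum => l rl.
  rewrite (bigD1 l) //=; apply: lerD.
    by rewrite kE; under eq_bigr do rewrite andbb.
  rewrite [X in _ <= X](bigD1 l) //= -[X in X <= _]add0r; apply: lerD => //.
  apply: ler_sum => l' /andP[_ ll'].
  have [/existsP[x0 /and3P[x0a x1 x2]]|none] :=
     boolP [exists x, [&& lev x == a, on l x & on l' x]].
    rewrite (bigD1 x0) //= x1 x2 big1 ?addr0 // => x /andP[_ xx0].
    case: (boolP (on l x)) => // x3; case: (boolP (on l' x)) => // x4.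
    by case/eqP: ll'; apply: on_two_lines xx0 _ _ _ _.
  rewrite big1 ?ler01 // => x xa; case: (boolP (on l x && on l' x)) => // h.
  by case/existsP: none; exists x; rewrite xa.
have CS := sum_CauchySchwarz (fun x => lev x == a) deg (fun=> 1).
have A0 : 0 < 2 ^+ a :> R by rewrite exprn_gt0.
have c1 : \sum_(x | lev x == a) (1:R) ^+ 2 <= 2 ^+ a.
  by under eq_bigr do rewrite expr1n; apply: card_lev.
have d0 : 0 <= \sum_(x | lev x == a) deg x ^+ 2 by apply: sumr_ge0 => x _; rewrite sqr_ge0.
have {CS} : I ^+ 2 <= (I + n ^+ 2) * 2 ^+ a.
  rewrite {1}IE; under eq_bigr do rewrite -[deg _]mulr1; apply: le_trans CS _.
  apply: ler_pM => //.
  by apply: sumr_ge0 => x _; rewrite sqr_ge0.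
have : 4 * n ^+ 2 * 2 ^+ a <= I ^+ 2.
  have n0 : 0 <= n by rewrite ler0n.
  have -> : 4 * n ^+ 2 * 2 ^+ a = (2 * n * Num.sqrt (2 ^+ a)) ^+ 2.
    by rewrite !exprMn sqr_sqrtr ?ltW //; ring.
  by rewrite lerXn2r // nnegrE // !mulr_ge0 // sqrtr_ge0.
move=> h1 h2.
have h3 : 3 * I ^+ 2 <= 4 * (I * 2 ^+ a) by move: h1 h2; lra.
move: h3; rewrite expr2; set A := 2 ^+ a in A0 *.
have [->|In] := eqVneq I 0; first by move=> _; rewrite mulr_ge0 // ltW.
have {In}I1 : 0 < I by rewrite lt_def In.
move=> h; have {h} : I * (3 * I) <= I * (4 * A) by lra.
by rewrite ler_pM2l //; lra.
Qed.

(** A poor line with at least [t] points forces t^2 <= 4 * 2^a, so the term n / t is at most 4 * 4^a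
    / t^3; hence 5 = 1 + 4. *)
Lemma few_poor_lines a t : (2 <= t)%N ->
  #|[set l | ~~ rich a l && (t <= k a l)%N]|%:R <= 5 * D0 * 4 ^+ a / t%:R ^+ 3 :> R.
Proof.
move=> t2; have t0 : 0 < t%:R :> R by rewrite ltr0n; apply: leq_trans t2.
have A0 : 0 < 4 ^+ a :> R by rewrite exprn_gt0.
set S := [set l | _].
have [->|[l0 l0S]] := set_0Vmem S.
  by rewrite cards0 divr_ge0 ?mulr_ge0 ?exprn_ge0 // ltW.
have t2a : t%:R ^+ 2 <= 4 * 2 ^+ a :> R.
  move: l0S; rewrite inE /rich -leqNgt => /andP[h1 h2].
  rewrite -!natrX -natrM ler_nat; apply: leq_trans h1.
  by rewrite leq_exp2r.
pose P := [set x | lev x == a].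
have cP : #|P|%:R <= 2 ^+ a :> R by rewrite -natrX ler_nat lev_card.
have -> : 4 ^+ a = (2 ^+ a) ^+ 2 :> R by rewrite expr2 -exprMn -natrM.
apply: le_trans (_ : #|[set l | (t <= #|[set x in P | on l x]|)%N]|%:R <= _).
  rewrite ler_nat subset_leq_card //; apply/fintype.subsetP => l.
  by rewrite !inE => /andP[].
apply: le_trans (few_rich_lines P t2) _.
have {A0}A0 : 0 < 2 ^+ a :> R by rewrite exprn_gt0.
set A := 2 ^+ a in t2a cP A0 *; set n : R := #|P|%:R in cP *.
have n0 : 0 <= n by rewrite ler0n.
have -> : 5 * D0 * A ^+ 2 / t%:R ^+ 3 = D0 * (5 * A ^+ 2 / t%:R ^+ 3) by rewrite -!mulrA mulrCA.
rewrite (ler_pM2l D0_gt0).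
have -> : n ^+ 2 / t%:R ^+ 3 + n / t%:R = (n ^+ 2 + n * t%:R ^+ 2) / t%:R ^+ 3.
  by field; rewrite gt_eqF.
rewrite ler_pM2r ?invr_gt0 ?exprn_gt0 //.
have : n ^+ 2 <= A ^+ 2 by rewrite lerXn2r // nnegrE // ltW.
have : n * t%:R ^+ 2 <= A * (4 * A) by rewrite ler_pM // sqr_ge0.
by rewrite !expr2; lra.
Qed.

(** Lines are sorted by the dyadic scale i of their number of points: at least two points give i >=
    1, at most 2^a points give i <= a, and [few_poor_lines] counts the lines of each scale. *)
Lemma dyadic_sum a (Q : pred (E * K)) (F : E * K -> R) (G : nat -> R) :
  (forall l, Q l -> ~~ rich a l && (2 <= k a l)%N) -> (forall i, 0 <= G i) ->
  (forall l, Q l -> F l <= G (trunc_log 2 (k a l))) ->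
  \sum_(l | Q l) F l <= \sum_(1 <= i < a.+1) G i * (5 * D0 * 4 ^+ a / 8 ^+ i).
Proof.
move=> Q2 G0 FG.
apply: le_trans (_ : \sum_l \sum_(1 <= i < a.+1)
    G i * (~~ rich a l && (2 ^ i <= k a l)%N)%:R <= _).
  rewrite big_mkcond /=; apply: ler_sum => l _; case: ifP => Ql; last first.
    by apply: sumr_ge0 => i _; rewrite mulr_ge0.
  have /andP[nr k2] := Q2 _ Ql; set i := trunc_log 2 (k a l).
  have /andP[lo hi] := trunc_log_bounds (isT : (1 < 2)%N) (ltnW k2).
  have i1 : (1 <= i)%N by apply: trunc_log_max.
  have ia : (i < a.+1)%N by rewrite ltnS -(@leq_exp2l 2) //; apply: leq_trans lo (k_le a l).
  rewrite (bigD1_seq i) ?mem_index_iota ?i1 ?ia ?iota_uniq //=.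
  rewrite nr lo mulr1 -[X in X <= _]addr0 lerD ?FG //.
  by apply: sumr_ge0 => j _; rewrite mulr_ge0.
rewrite exchange_big /= !big_nat; apply: ler_sum => i /andP[i1 _].
rewrite -mulr_sumr ler_wpM2l //.
have -> : \sum_l (~~ rich a l && (2 ^ i <= k a l)%N)%:R
   = #|[set l | ~~ rich a l && (2 ^ i <= k a l)%N]|%:R :> R.
  by rewrite sum_natr_cond; congr (_%:R); apply: eq_card => l; rewrite !inE.
have := @few_poor_lines a (2 ^ i)%N; rewrite natrX -exprM mulnC exprM.
have -> : 2 ^+ 3 = 8 :> R by ring.
by apply; rewrite -{1}(expn1 2) leq_exp2l.
Qed.

Lemma k_lt_trunc_log a l : (0 < k a l)%N -> (k a l)%:R <= 2 ^+ (trunc_log 2 (k a l)).+1 :> R.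
Proof.
move=> k0; have /andP[_ hi] := trunc_log_bounds (isT : (1 < 2)%N) k0.
by rewrite -natrX ler_nat ltnW.
Qed.

(** The exponent 3 is critical: all dyadic scales contribute equally, and their number [a] is the
    source of the logarithm in the theorem. *)
Lemma sum_poor_cube a :
  \sum_(l | ~~ rich a l && (2 <= k a l)%N) (k a l)%:R ^+ 3
    <= 40 * D0 * a%:R * 4 ^+ a :> R.
Proof.
apply: le_trans (dyadic_sum (a := a) (G := fun i => 8 ^+ i.+1) _ _ _) _.
- by [].
- by move=> i; rewrite exprn_ge0.
- move=> l /andP[_ k2]; have := k_lt_trunc_log (ltnW k2).
  have -> : 8 = 2 ^+ 3 :> R by ring.
  rewrite -exprM mulnC exprM => h; rewrite lerXn2r // nnegrE // exprn_ge0 //.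
under eq_bigr => i _.
  have -> : 8 ^+ i.+1 * (5 * D0 * 4 ^+ a / 8 ^+ i) = 40 * D0 * 4 ^+ a :> R.
    by rewrite exprS -mulrA [8 ^+ i * _]mulrC divfK ?expf_neq0 ?pnatr_eq0 //; ring.
  over.
by rewrite sumr_const_nat subSS subn0 -[X in X <= _]mulr_natr mulrAC.
Qed.

(** The exponent 5 / 2 leaves a square root of k to spare. One factor k^(1/4) pays for the gain
    [h ^- 3] where k >= h^12, the other makes the sum over scales geometric with ratio [u ^- 1]. *)
Lemma sum_poor_five_halves a (h : R) : 0 < h ->
  \sum_(l | [&& ~~ rich a l, (2 <= k a l)%N & h ^+ 12 <= (k a l)%:R])
      Num.sqrt (k a l)%:R ^+ 5 <= 240 * D0 * 4 ^+ a / h ^+ 3 :> R.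
Proof.
move=> h0; have [u [u1 u4 u7]] := @fourth_root2 R.
have u0 : 0 < u by lra.
have h3 : 0 < h ^+ 3 by rewrite exprn_gt0.
have sq i : Num.sqrt (2 ^+ i) = u ^+ (2 * i) :> R.
  by rewrite -u4 -exprM (_ : (4 * i = (2 * i) * 2)%N); [rewrite exprM sqrtr_sqr ger0_norm // exprn_ge0 // ltW | lia].
apply: le_trans (dyadic_sum (a := a) (G := fun i => u ^+ (11 * i.+1) / h ^+ 3) _ _ _) _.
- by move=> l /and3P[-> ->].
- by move=> i; rewrite divr_ge0 ?exprn_ge0 ?ltW.
- move=> l /and3P[_ k2 hk]; have kl := k_lt_trunc_log (ltnW k2).
  set i := trunc_log 2 (k a l) in kl *.
  have s1 : Num.sqrt (k a l)%:R <= u ^+ (2 * i.+1) by rewrite -sq ler_wsqrtr.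
  have s2 : h ^+ 3 <= u ^+ i.+1.
    rewrite -(@ler_pXn2r _ 4) //; try by rewrite nnegrE exprn_ge0 // ltW.
    by rewrite -!exprM [(i.+1 * 4)%N]mulnC [X in _ <= X]exprM u4; apply: le_trans hk kl.
  rewrite ler_pdivlMr //.
  have -> : u ^+ (11 * i.+1) = (u ^+ (2 * i.+1)) ^+ 5 * u ^+ i.+1.
    by rewrite -exprM -exprD mul11.
  apply: ler_pM; rewrite ?exprn_ge0 ?sqrtr_ge0 //; first exact: ltW.
  by rewrite lerXn2r // nnegrE ?sqrtr_ge0 // exprn_ge0 // ltW.
have c0 : 0 <= 40 * D0 * 4 ^+ a / h ^+ 3.
  by rewrite divr_ge0 // ?mulr_ge0 ?exprn_ge0 // ltW.
rewrite (_ : 240 * D0 * 4 ^+ a / h ^+ 3 = 40 * D0 * 4 ^+ a / h ^+ 3 * 6); last by ring.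
apply: le_trans (_ : 40 * D0 * 4 ^+ a / h ^+ 3 * \sum_(1 <= i < a.+1) u ^- i <= _); last first.
  by rewrite ler_wpM2l // geometric_sum_le.
rewrite mulr_sumr; apply: ler_sum => i _.
have -> : 8 ^+ i = u ^+ (12 * i) by rewrite (_ : 8 = u ^+ 12) -?exprM // (exprM u 4 3) u4; ring.
rewrite mulnS.
rewrite mul12 [u ^+ (11 + _)]exprD [u ^+ (11 * i + i)]exprD.
have u11 : u ^+ 11 <= 8.
  have -> : 8 = u ^+ 12 by rewrite (exprM u 4 3) u4; ring.
  by rewrite [u ^+ 12]exprS ler_peMl // exprn_ge0 // ltW.
have -> : u ^+ 11 * u ^+ (11 * i) / h ^+ 3 * (5 * D0 * 4 ^+ a / (u ^+ (11 * i) * u ^+ i))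
   = u ^+ 11 * (5 * D0 * 4 ^+ a / h ^+ 3 * u ^- i).
  by field; rewrite !gt_eqF ?exprn_gt0.
have -> : 40 * D0 * 4 ^+ a / h ^+ 3 * u ^- i = 8 * (5 * D0 * 4 ^+ a / h ^+ 3 * u ^- i).
  by field; rewrite !gt_eqF ?exprn_gt0.
rewrite ler_wpM2r //; apply: mulr_ge0; last by rewrite invr_ge0 exprn_ge0 // ltW.
by rewrite divr_ge0 // ?mulr_ge0 ?exprn_ge0 // ltW.
Qed.

Definition p2 (x : R) : R := 2 `^ x.
Lemma p2_gt0 x : 0 < p2 x. Proof. exact: powR_gt0. Qed.
Lemma p2_ge0 x : 0 <= p2 x. Proof. exact: powR_ge0. Qed.
Lemma p2D x y : p2 (x + y) = p2 x * p2 y.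
Proof. by rewrite /p2 powRD //; apply/implyP => _; rewrite pnatr_eq0. Qed.
Lemma p2_nat n : p2 n%:R = 2 ^+ n. Proof. by rewrite /p2 powR_mulrn. Qed.
Lemma p2_le x y : x <= y -> p2 x <= p2 y.
Proof. by move=> xy; rewrite /p2 ler_powR // ler1n. Qed.
Lemma p2_0 : p2 0 = 1. Proof. by rewrite /p2 powRr0. Qed.
Lemma p2N x : p2 (- x) = (p2 x)^-1.
Proof. by apply: (mulIf (lt0r_neq0 (p2_gt0 x))); rewrite -p2D addNr p2_0 mulVf ?lt0r_neq0 ?p2_gt0. Qed.
Lemma p2_ge1 x : 0 <= x -> 1 <= p2 x. Proof. by move=> x0; rewrite -p2_0 p2_le. Qed.
Lemma p2_le1 x : x <= 0 -> p2 x <= 1. Proof. by move=> x0; rewrite -p2_0 p2_le. Qed.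
Lemma p2_sqr x : p2 x ^+ 2 = p2 (2 * x).
Proof. by rewrite expr2 -p2D; congr p2; ring. Qed.

Lemma k_poor a l : ~~ rich a l -> (k a l)%:R <= 2 * p2 (a%:R / 2) :> R.
Proof.
rewrite /rich -leqNgt => h.
rewrite -(@ler_pXn2r _ 2) // ?nnegrE ?mulr_ge0 ?p2_ge0 // exprMn p2_sqr.
have -> : 2 * (a%:R / 2) = a%:R :> R by field.
by rewrite p2_nat -!natrX -natrM ler_nat.
Qed.

Lemma sum_rich_p2 a : \sum_(l | rich a l) (k a l)%:R <= 2 * p2 a%:R :> R.
Proof. by rewrite p2_nat sum_rich. Qed.

(** An elementary substitute for Young's inequality, by cases on [y <= t * x]; the balance [t]
    between the two levels is chosen at each use. *)
Lemma young_cube (s t x y : R) : 0 <= x -> 0 <= y -> 0 < t -> s * t = 1 ->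
  x * y ^+ 2 <= t ^+ 2 * x ^+ 3 + s * y ^+ 3.
Proof.
move=> x0 y0 t0 st; have s0 : 0 < s by rewrite -(pmulr_lgt0 _ t0) st.
have q1 : 0 <= t ^+ 2 * x ^+ 3 by rewrite mulr_ge0 ?sqr_ge0 ?exprn_ge0.
have q2 : 0 <= s * y ^+ 3 by rewrite mulr_ge0 ?exprn_ge0 // ltW.
have [h|h] := leP y (t * x).
  have : y ^+ 2 <= (t * x) ^+ 2 by rewrite lerXn2r // nnegrE // mulr_ge0 // ltW.
  by move=> /(ler_wpM2l x0); rewrite exprMn; move: q2; rewrite !exprS; lra.
have : x <= s * y by move: h => /ltW /(ler_wpM2l (ltW s0)); rewrite mulrA st mul1r.
by move=> /(ler_wpM2r (sqr_ge0 y)); move: q1; rewrite !exprS; lra.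
Qed.

Lemma young_square (s t y : R) : 0 <= y -> 0 < t -> s * t = 1 ->
  y ^+ 2 <= t * y + s * y ^+ 3.
Proof.
move=> y0 t0 st; have s0 : 0 < s by rewrite -(pmulr_lgt0 _ t0) st.
have q1 : 0 <= t * y by rewrite mulr_ge0 // ltW.
have q2 : 0 <= s * y ^+ 3 by rewrite mulr_ge0 ?exprn_ge0 // ltW.
have [h|h] := leP y t.
  by have := ler_wpM2r y0 h; rewrite expr2; lra.
have : 1 <= s * y by move: h => /ltW /(ler_wpM2l (ltW s0)); rewrite st.
by move=> /(ler_wpM2r (sqr_ge0 y)); move: q1; rewrite !exprS; lra.
Qed.

Lemma kn_le a e x : (kn a e x <= k a (e, key e x))%N.
Proof.
apply: subset_leq_card; apply/fintype.subsetP => y; rewrite !inE /on /=.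
by case/and3P=> -> _ ->.
Qed.

Lemma k_le_kn a e x : (k a (e, key e x) <= (kn a e x).+1)%N.
Proof.
rewrite /k (cardsD1 x) addnC -addn1 leq_add //; last by case: (x \in _).
apply: subset_leq_card; apply/fintype.subsetP => y; rewrite !inE /on /=.
by case/and3P=> -> -> ->.
Qed.

(** Two points of level [b] on the line give [k] <= 2 [kn], which reduces the sum to pairs of
    distinct points. *)
Lemma sum_k_flags a b : \sum_(l | (2 <= k b l)%N) (k a l)%:R * (k b l)%:R
  <= 2 * p2 a%:R * p2 b%:R :> R.
Proof.
rewrite big_mkcond /=.
under eq_bigr => l _.
  rewrite (_ : (if _ then _ else _) = (k a l)%:R *
    (if (2 <= k b l)%N then (k b l)%:R else 0)); last by case: ifP; rewrite ?mulr0.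
  over.
rewrite -(sum_flags a (fun l => if (2 <= k b l)%N then (k b l)%:R else 0)).
have := sum_kn_flags b a; rewrite !p2_nat -mulrA => h.
apply: le_trans (ler_wpM2l (ler0n R 2) h); rewrite mulr_sumr; apply: ler_sum => x _.
rewrite mulr_sumr; apply: ler_sum => e _; case: ifP => k2.
  by rewrite -natrM ler_nat; have := k_le_kn b e x; lia.
by rewrite mulr_ge0.
Qed.

Definition K2 a b : R := \sum_(x | lev x == a) \sum_e
  (~~ rich b (e, key e x))%:R * (kn b e x)%:R ^+ 2.

(** On a line with u points of level a and v of level b, u v^2 is bounded in three ways: if the line
    is rich for a, by v^2 <= 4 * 2^b; if u >= 2, by the two cubes; if u <= 1, by the pairs u v and
    the cube of v. Only cubes cost a factor [M], so the third way costs [Num.sqrt M]. *)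
Lemma K2_le a b (M : R) : 1 <= M -> a%:R <= M -> b%:R <= M ->
  K2 a b <= 100 * D0 * (M * p2 (3 / 4 * a%:R + 5 / 4 * b%:R)
    + M * p2 (5 / 8 * a%:R + 11 / 8 * b%:R)
    + Num.sqrt M * p2 (a%:R / 2 + 3 / 2 * b%:R) + p2 (a%:R + b%:R)).
Proof.
move=> M1 aM bM; have M0 : 0 < M by lra.
pose A := p2 a%:R; pose B := p2 b%:R.
have A0 : 0 < A by apply: p2_gt0.
have B0 : 0 < B by apply: p2_gt0.
pose u l : R := (k a l)%:R; pose v l : R := (k b l)%:R.
have u0 l : 0 <= u l by []. have v0 l : 0 <= v l by [].
have four (j : nat) : 4 ^+ j = p2 j%:R * p2 j%:R :> R.
  by rewrite p2_nat -exprMn -natrM.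
have cube j : j%:R <= M -> \sum_(l | ~~ rich j l && (2 <= k j l)%N) (k j l)%:R ^+ 3
    <= 40 * D0 * M * (p2 j%:R * p2 j%:R) :> R.
  move=> jM; apply: le_trans (sum_poor_cube j) _; rewrite four.
  by rewrite ler_wpM2r ?mulr_ge0 ?p2_ge0 // ler_wpM2l // mulr_ge0.
(* Equating the two cube terms would take the exponent 2 / 3; with 5 / 8 both resulting powers of
   2^b still exceed 1, as the later sum over b requires. *)
pose t := p2 (5 / 8 * (b%:R - a%:R)); pose s := p2 (- (5 / 8 * (b%:R - a%:R))).
have st : s * t = 1 by rewrite /s /t -p2D addNr p2_0.
(* This choice equates the pair term, which is free of [M], with the cube term, which carries
   [M]. *)
pose t' := Num.sqrt M * p2 ((b%:R - a%:R) / 2).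
pose s' := (Num.sqrt M)^-1 * p2 (- ((b%:R - a%:R) / 2)).
have sM0 : 0 < Num.sqrt M by rewrite sqrtr_gt0.
have st' : s' * t' = 1.
  by rewrite /s' /t' mulrACA -p2D addNr p2_0 mulVf ?gt_eqF // mulr1.
have t0 : 0 < t by apply: p2_gt0.
have t'0 : 0 < t' by rewrite mulr_gt0 ?p2_gt0.
have step1 : K2 a b <= \sum_(x | lev x == a) \sum_e (kn b e x)%:R
   + \sum_l u l * ((~~ rich b l && (2 <= k b l)%N)%:R * v l ^+ 2).
  rewrite -(sum_flags a (fun l => (~~ rich b l && (2 <= k b l)%N)%:R * v l ^+ 2)).
  rewrite /K2 -big_split /=; apply: ler_sum => x _.
  rewrite -big_split /=; apply: ler_sum => e _.
  case: (rich b _) => /=; first by rewrite !mul0r addr0.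
  rewrite mul1r; have knk := kn_le b e x; case: leqP => k2 /=.
    rewrite mul0r addr0; have : (kn b e x <= 1)%N := leq_trans knk k2.
    by case: (kn b e x) => [|[|//]] _; rewrite expr2 ?mul0r ?mul1r.
  rewrite mul1r -[X in X <= _]add0r lerD // lerXn2r ?nnegrE ?ler_nat //.
have step2 l : u l * ((~~ rich b l && (2 <= k b l)%N)%:R * v l ^+ 2) <=
   (rich a l)%:R * u l * (4 * B)
   + t ^+ 2 * ((~~ rich a l && (2 <= k a l)%N)%:R * u l ^+ 3)
   + (s + s') * ((~~ rich b l && (2 <= k b l)%N)%:R * v l ^+ 3)
   + t' * ((2 <= k b l)%N%:R * (u l * v l)).
  have s0 : 0 < s by apply: p2_gt0.
  have s'0 : 0 < s' by rewrite mulr_gt0 ?p2_gt0 ?invr_gt0.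
  have v30 : 0 <= v l ^+ 3 by rewrite exprn_ge0.
  have u30 : 0 <= u l ^+ 3 by rewrite exprn_ge0.
  have q1 : 0 <= (rich a l)%:R * u l * (4 * B) by rewrite !mulr_ge0 // ltW.
  have q2 : 0 <= t ^+ 2 * ((~~ rich a l && (2 <= k a l)%N)%:R * u l ^+ 3).
    by apply: mulr_ge0; [rewrite sqr_ge0 | apply: mulr_ge0].
  have q3 : 0 <= t' * ((2 <= k b l)%N%:R * (u l * v l)).
    by apply: mulr_ge0; [exact: ltW | apply: mulr_ge0 => //; apply: mulr_ge0].
  case: (boolP (rich b l)) => pb /=.
    by rewrite !mul0r !mulr0 addr0 !addr_ge0.
  case: (leqP 2 (k b l)) q3 => k2 q3 /=; last first.
    by rewrite !mul0r !mulr0 !addr0 !addr_ge0.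
  rewrite !mul1r; rewrite mul1r in q3.
  have sv : 0 <= s * v l ^+ 3 by rewrite mulr_ge0 // ltW.
  have s'v : 0 <= s' * v l ^+ 3 by rewrite mulr_ge0 // ltW.
  case: (boolP (rich a l)) q1 q2 => pa /= q1 q2.
    have : v l ^+ 2 <= 4 * B.
      apply: le_trans (_ : (2 * p2 (b%:R / 2)) ^+ 2 <= _).
        by rewrite lerXn2r ?nnegrE ?mulr_ge0 ?p2_ge0 // k_poor.
      by rewrite exprMn p2_sqr (_ : 2 * (b%:R / 2) = b%:R) -/B; [lra | field].
    by move=> /(ler_wpM2l (u0 l)); move: sv s'v q3; lra.
  case: (leqP 2 (k a l)) q2 => k2a /= q2.
    by have := young_cube (u0 l) (v0 l) t0 st; move: s'v q3; lra.
  have u1 : u l <= 1 by rewrite /u -[1]/(1%:R) ler_nat.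
  have := ler_wpM2l (u0 l) (young_square (v0 l) t'0 st').
  have := ler_wpM2r s'v u1; move: sv; lra.
have AB : \sum_(x | lev x == a) \sum_e (kn b e x)%:R <= A * B.
  by rewrite /A /B !p2_nat sum_kn_flags.
have ca := cube a aM; have cb := cube b bM.
have e1 : t ^+ 2 * (A * A) = p2 (3 / 4 * a%:R + 5 / 4 * b%:R).
  by rewrite /t /A p2_sqr -!p2D; congr p2; field.
have e2 : s * (B * B) = p2 (5 / 8 * a%:R + 11 / 8 * b%:R).
  by rewrite /s /B -!p2D; congr p2; field.
have e3 : t' * (A * B) = Num.sqrt M * p2 (a%:R / 2 + 3 / 2 * b%:R).
  by rewrite /t' /A /B -mulrA -!p2D; congr (_ * p2 _); field.
have e4 : s' * (M * (B * B)) = Num.sqrt M * p2 (a%:R / 2 + 3 / 2 * b%:R).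
  have -> : s' * (M * (B * B)) = ((Num.sqrt M)^-1 * M) * (p2 (- ((b%:R - a%:R) / 2)) * (B * B)).
    by rewrite /s'; ring.
  rewrite -{2}[M]sqr_sqrtr ?ltW // expr2 mulKf ?gt_eqF //.
  by rewrite /B -!p2D; congr (_ * p2 _); field.
have e5 : p2 (a%:R + b%:R) = A * B by rewrite p2D.
rewrite e5 -e1 -e2 -e3.
have AB0 : 0 <= A * B by rewrite mulr_ge0 // ltW.
have tAB0 : 0 <= t' * (A * B) by rewrite mulr_ge0 // ltW.
have s0 : 0 < s by apply: p2_gt0.
have s'0 : 0 < s' by rewrite mulr_gt0 ?p2_gt0 ?invr_gt0.
have dAB : A * B <= D0 * (A * B) by rewrite ler_peMl.
have dtAB : t' * (A * B) <= D0 * (t' * (A * B)) by rewrite ler_peMl.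
have f1 : \sum_l (rich a l)%:R * u l * (4 * B) <= 8 * (A * B).
  rewrite -mulr_suml.
  have -> : \sum_l (rich a l)%:R * u l = \sum_(l | rich a l) u l.
    by rewrite [RHS]big_mkcond /=; apply: eq_bigr => l _; case: ifP; rewrite ?mul1r ?mul0r.
  by have := ler_wpM2r (mulr_ge0 (ler0n R 4) (ltW B0)) (sum_rich_p2 a); rewrite -/A; lra.
have mk (P : pred (E * K)) (F : E * K -> R) : \sum_l (P l)%:R * F l = \sum_(l | P l) F l.
  by rewrite [RHS]big_mkcond /=; apply: eq_bigr => l _; case: ifP; rewrite ?mul1r ?mul0r.
have f2 := ler_wpM2l (exprn_ge0 2 (ltW t0)) ca.
have f3 := ler_wpM2l (ltW (addr_gt0 s0 s'0)) cb.
have f4 := ler_wpM2l (ltW t'0) (sum_k_flags a b).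
apply: le_trans step1 _; apply: (le_trans (lerD AB (ler_sum _ (fun l _ => step2 l)))).
rewrite !big_split /= -!mulr_sumr !mk.
have g2 : t ^+ 2 * (40 * D0 * M * (A * A)) = 40 * D0 * (M * (t ^+ 2 * (A * A))) by ring.
have g3 : (s + s') * (40 * D0 * M * (B * B)) = 40 * D0 * (M * (s * (B * B)))
   + 40 * D0 * (t' * (A * B)) by rewrite e3 -e4; ring.
rewrite -/A -/B in f2 f3 f4; rewrite g2 in f2; rewrite g3 in f3.
have P1 : 0 <= D0 * (M * (t ^+ 2 * (A * A))).
  by rewrite !mulr_ge0 ?exprn_ge0 // ltW.
have P2 : 0 <= D0 * (M * (s * (B * B))) by rewrite !mulr_ge0 // ltW.
by lra.
Qed.

(** The bounds keep a power of [rho] so that induction on [n] closes; truncated subtraction makes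
    them 1 once the first sum is complete and 0 while the second is empty. *)
Lemma geometric_kernel (rho : R) (n L : nat) : 0 < rho -> rho < 1 ->
  (1 - rho) * (\sum_(b < n | (b <= L)%N) rho ^+ (L - b)) <= rho ^+ (L.+1 - n) /\
  (1 - rho) * (\sum_(b < n | (L <= b)%N) rho ^+ (b - L)) <= 1 - rho ^+ (n - L).
Proof.
move=> r0 r1; elim: n => [|n [IH1 IH2]].
  by rewrite !big_ord0 !mulr0 sub0n expr0 subrr exprn_ge0 // ltW.
split; rewrite big_mkcond /= big_ord_recr /= -big_mkcond /=.
  rewrite mulrDr; case: leqP => nL.
    move: IH1; rewrite subSS subSn // exprS; set S := _ * \sum_(_ < _ | _) _ ; lra.
  rewrite mulr0 addr0; apply: le_trans IH1 _.
  by rewrite subSS (_ : (L.+1 - n = L - n)%N) //; lia.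
rewrite mulrDr; case: leqP => nL.
  by move: IH2; rewrite subSn // exprS; set S := _ * \sum_(_ < _ | _) _; lra.
rewrite mulr0 addr0; apply: le_trans IH2 _.
by rewrite (_ : (n.+1 - L = n - L)%N) //; lia.
Qed.

Definition kern (c : R) (L b : nat) : R := p2 (c * (b%:R - L%:R)).
Definition geo (c : R) : R := (1 - p2 (- c))^-1.

Lemma p2_lt1 c : 0 < c -> p2 (- c) < 1.
Proof.
move=> c0; rewrite p2N invf_lt1 ?p2_gt0 // /p2.
have : (1 : R) `^ c < 2 `^ c by apply: gt0_ltr_powR; rewrite // ?nnegrE ?ltr1n.
by rewrite powR1.
Qed.

Lemma geo_ge1 c : 0 < c -> 1 <= geo c.
Proof.
move=> c0; rewrite /geo invf_ge1 ?subr_gt0 ?p2_lt1 //.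
by have := p2_gt0 (- c); lra.
Qed.

Lemma kernE c L b : (b <= L)%N -> kern c L b = p2 (- c) ^+ (L - b).
Proof.
move=> bL; rewrite /kern /p2 -powR_mulrn ?powR_ge0 // -powRrM natrB //.
by congr (_ `^ _); ring.
Qed.

Lemma kern_row c n L : 0 < c -> \sum_(b < n | (b <= L)%N) kern c L b <= geo c.
Proof.
move=> c0; rewrite (eq_bigr (fun b : 'I_n => p2 (- c) ^+ (L - b))); last first.
  by move=> b bL; rewrite kernE.
have [h _] := geometric_kernel n L (p2_gt0 (- c)) (p2_lt1 c0).
have r1 := p2_lt1 c0; rewrite -(@ler_pM2l _ (1 - p2 (- c))) ?subr_gt0 //.
rewrite /geo mulfV ?gt_eqF ?subr_gt0 //; apply: le_trans h _.
by rewrite exprn_ile1 ?p2_ge0 // ltW.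
Qed.

Lemma kern_col c n L : 0 < c -> \sum_(b < n | (L <= b)%N) kern c b L <= geo c.
Proof.
move=> c0; rewrite (eq_bigr (fun b : 'I_n => p2 (- c) ^+ (b - L))); last first.
  by move=> b bL; rewrite kernE.
have [_ h] := geometric_kernel n L (p2_gt0 (- c)) (p2_lt1 c0).
have r1 := p2_lt1 c0; rewrite -(@ler_pM2l _ (1 - p2 (- c))) ?subr_gt0 //.
rewrite /geo mulfV ?gt_eqF ?subr_gt0 //; apply: le_trans h _.
by rewrite gerBl exprn_ge0 ?p2_ge0.
Qed.

Lemma schur_kernel c n (x : nat -> R) : 0 < c ->
  \sum_(L < n) \sum_(b < n | (b <= L)%N) x L * x b * kern c L b
    <= geo c * \sum_(j < n) x j ^+ 2.
Proof.
move=> c0; have kp L b : 0 <= kern c L b by apply: p2_ge0.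
apply: le_trans (_ : \sum_(L < n) \sum_(b < n | (b <= L)%N)
   (x L ^+ 2 * (kern c L b / 2) + x b ^+ 2 * (kern c L b / 2)) <= _).
  apply: ler_sum => L _; apply: ler_sum => b _.
  have : x L * x b <= (x L ^+ 2 + x b ^+ 2) / 2.
    by have := sqr_ge0 (x L - x b); rewrite sqrrB; lra.
  by move=> /(ler_wpM2r (kp L b)); lra.
under eq_bigr do rewrite big_split /= -mulr_sumr -mulr_suml.
rewrite big_split /=.
have -> : geo c * \sum_(j < n) x j ^+ 2 = \sum_(j < n) x j ^+ 2 * (geo c / 2)
   + \sum_(j < n) x j ^+ 2 * (geo c / 2).
  by rewrite -!mulr_suml; field.
apply: lerD.
  apply: ler_sum => L _; rewrite ler_wpM2l ?sqr_ge0 // ler_pM2r ?invr_gt0 //.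
  exact: kern_row.
rewrite (exchange_big_dep xpredT) //=; apply: ler_sum => b _.
rewrite -mulr_sumr -mulr_suml ler_wpM2l ?sqr_ge0 // ler_pM2r ?invr_gt0 //.
exact: kern_col.
Qed.

(** For b <= L the kernel is at most 1, so its square is below the kernel itself and the row sum is
    all that Cauchy-Schwarz asks for. *)
Lemma kern_conv_le c n L (x : nat -> R) : 0 < c -> (forall j, 0 <= x j) ->
  \sum_(b < n | (b <= L)%N) x b * kern c L b
    <= Num.sqrt (geo c) * Num.sqrt (\sum_(j < n) x j ^+ 2).
Proof.
move=> c0 x0; apply: le_trans (sum_CauchySchwarz_sqrt _ _ _) _.
rewrite mulrC; apply: ler_pM; rewrite ?sqrtr_ge0 // ler_wsqrtr //.
  apply: le_trans (kern_row n L c0); apply: ler_sum => b bL.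
  rewrite expr2 ler_piMl ?p2_ge0 // p2_le1 // pmulr_rle0 // subr_le0 ler_nat //.
by apply: ler_sum_set => // i _; rewrite sqr_ge0.
Qed.

Lemma sum_le_sqrt n (x : nat -> R) :
  \sum_(b < n) x b <= Num.sqrt n%:R * Num.sqrt (\sum_(j < n) x j ^+ 2).
Proof.
under eq_bigr do rewrite -[x _]mul1r.
apply: le_trans (sum_CauchySchwarz_sqrt _ _ _) _.
by under eq_bigr do rewrite expr1n; rewrite sumr_const card_ord.
Qed.

Lemma sum_inj_le (I J : finType) (P : pred I) (g : I -> J) (G : J -> R) :
  {in P &, injective g} -> (forall j, 0 <= G j) ->
  \sum_(i | P i) G (g i) <= \sum_j G j.
Proof.
move=> inj G0; rewrite -(big_imset G inj) /=.
by apply: ler_sum_set.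
Qed.

Lemma meet_perp e x y : key e x = key e y -> key (perp e) x = key (perp e) y -> x = y.
Proof.
move=> h1 h2; apply/eqP; apply: contraT => xy.
by have := perp_neq e; rewrite (key_dir xy h2 h1) eqxx.
Qed.

Definition quad : finType := (T * T * (T * T))%type.
Definition is_rect e (q : quad) := [&& key e q.1.1 == key e q.1.2,
  key e q.2.2 == key e q.2.1, key (perp e) q.1.1 == key (perp e) q.2.2
  & key (perp e) q.1.2 == key (perp e) q.2.1].

(** In a fixed direction a rectangle is determined by either pair of opposite vertices, so
    Cauchy-Schwarz between the two diagonals separates the four functions. *)
Lemma rect_holder e (F1 F2 F3 F4 : T -> R) :
  \sum_(q | is_rect e q) F1 q.1.1 * F2 q.1.2 * F3 q.2.1 * F4 q.2.2
  <= Num.sqrt (\sum_x F1 x ^+ 2) * Num.sqrt (\sum_x F3 x ^+ 2)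
     * (Num.sqrt (\sum_x F2 x ^+ 2) * Num.sqrt (\sum_x F4 x ^+ 2)).
Proof.
rewrite (eq_bigr (fun q : quad => (F1 q.1.1 * F3 q.2.1) * (F2 q.1.2 * F4 q.2.2)));
  last by move=> q _; ring.
apply: le_trans (sum_CauchySchwarz_sqrt _ _ _) _.
have s0 (F : T -> R) : 0 <= \sum_x F x ^+ 2 by apply: sumr_ge0 => x _; rewrite sqr_ge0.
have pairs (F G : T -> R) : \sum_(p : T * T) F p.1 ^+ 2 * G p.2 ^+ 2
    = (\sum_x F x ^+ 2) * (\sum_x G x ^+ 2).
  by rewrite big_distrlr /= pair_bigA.
have inj1 : {in is_rect e &, injective (fun q : quad => (q.1.1, q.2.1))}.
  move=> [[x1 x2] [x3 x4]] [[y1 y2] [y3 y4]]; rewrite !unfold_in /is_rect /=.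
  case/and4P=> /eqP a1 /eqP a2 /eqP a3 /eqP a4.
  case/and4P=> /eqP b1 /eqP b2 /eqP b3 /eqP b4 [h1 h3]; subst y1 y3.
  have -> : x2 = y2 by apply: (@meet_perp e); congruence.
  by have -> : x4 = y4 by apply: (@meet_perp e); congruence.
have inj2 : {in is_rect e &, injective (fun q : quad => (q.1.2, q.2.2))}.
  move=> [[x1 x2] [x3 x4]] [[y1 y2] [y3 y4]]; rewrite !unfold_in /is_rect /=.
  case/and4P=> /eqP a1 /eqP a2 /eqP a3 /eqP a4.
  case/and4P=> /eqP b1 /eqP b2 /eqP b3 /eqP b4 [h1 h3]; subst y2 y4.
  have -> : x1 = y1 by apply: (@meet_perp e); congruence.
  by have -> : x3 = y3 by apply: (@meet_perp e); congruence.
apply: ler_pM; rewrite ?sqrtr_ge0 // -sqrtrM // ler_wsqrtr // -pairs.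
  apply: le_trans (_ : \sum_(q | is_rect e q) F1 q.1.1 ^+ 2 * F3 q.2.1 ^+ 2 <= _).
    by apply: ler_sum => q _; rewrite exprMn.
  apply: (@sum_inj_le quad (T * T)%type (is_rect e) (fun q => (q.1.1, q.2.1))
    (fun p => F1 p.1 ^+ 2 * F3 p.2 ^+ 2)) => [|p]; first exact: inj1.
  by rewrite mulr_ge0 ?sqr_ge0.
apply: le_trans (_ : \sum_(q | is_rect e q) F2 q.1.2 ^+ 2 * F4 q.2.2 ^+ 2 <= _).
  by apply: ler_sum => q _; rewrite exprMn.
apply: (@sum_inj_le quad (T * T)%type (is_rect e) (fun q => (q.1.2, q.2.2))
    (fun p => F2 p.1 ^+ 2 * F4 p.2 ^+ 2)) => [|p]; first exact: inj2.
  by rewrite mulr_ge0 ?sqr_ge0.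
Qed.

Variables (m : nat) (lam : nat -> R) (f : T -> R).
Hypothesis lev_lt : forall x, (lev x < m)%N.
Hypothesis m_gt0 : (0 < m)%N.
Hypothesis lam_ge0 : forall j, 0 <= lam j.
Hypothesis f_ge0 : forall x, 0 <= f x.
Hypothesis f_le : forall x, f x <= lam (lev x) * p2 (- ((lev x)%:R / 2)).

(** If all of 2^a points had the value [phi a], the l^2 norm of the level would be [lam a]. *)
Definition phi a := lam a * p2 (- (a%:R / 2)).
Definition N2 := \sum_(j < m) lam j ^+ 2.
(* Szemeredi-Trotter controls poor lines well; a vertex lying on a rich side or on a rich
   perpendicular side is treated separately, as few points have this property. *)
Definition special x e :=
  rich (lev x) (e, key e x) || rich (lev x) (perp e, key (perp e) x).
Definition prodf (q : quad) := f q.1.1 * f q.1.2 * f q.2.1 * f q.2.2.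
Definition nspecial e (q : quad) : nat :=
  special q.1.1 e + special q.1.2 e + special q.2.1 e + special q.2.2 e.

Lemma N2_ge0 : 0 <= N2. Proof. by apply: sumr_ge0 => j _; rewrite sqr_ge0. Qed.
Lemma phi_ge0 a : 0 <= phi a. Proof. by rewrite mulr_ge0 ?p2_ge0. Qed.
Lemma phi_sqr a : phi a ^+ 2 * p2 a%:R = lam a ^+ 2.
Proof.
rewrite exprMn p2_sqr -mulrA -p2D.
have -> : 2 * (- (a%:R / 2)) + a%:R = 0 :> R by field.
by rewrite p2_0 mulr1.
Qed.

Lemma sum_by_level (F : T -> R) : \sum_x F x = \sum_(a < m) \sum_(x | lev x == a) F x.
Proof.
rewrite (partition_big (fun x => Ordinal (lev_lt x)) xpredT) //=.
Qed.

Lemma sum_f2 : \sum_x f x ^+ 2 <= N2.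
Proof.
rewrite sum_by_level; apply: ler_sum => a _.
apply: le_trans (_ : \sum_(x | lev x == a) phi a ^+ 2 * 1 <= _).
  apply: ler_sum => x /eqP xa; rewrite mulr1 lerXn2r ?nnegrE ?phi_ge0 //.
  by have := f_le x; rewrite xa.
rewrite -mulr_sumr -phi_sqr ler_wpM2l ?sqr_ge0 // p2_nat; exact: card_lev.
Qed.

Definition special_mass e := \sum_x (f x * (special x e)%:R) ^+ 2.

(** By [sum_rich] a level has at most 2 * 2^a flags on its rich lines; this counts once for the
    direction and once for its perpendicular. *)
Lemma sum_special_mass : \sum_e special_mass e <= 4 * N2.
Proof.
rewrite /special_mass exchange_big /= sum_by_level /N2 mulr_sumr.
apply: ler_sum => a _.
pose r e x : R := (rich a (e, key e x))%:R.
apply: le_trans (_ : \sum_(x | lev x == a) \sum_e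
   (phi a ^+ 2 * r e x + phi a ^+ 2 * r (perp e) x) <= _).
  apply: ler_sum => x /eqP xa; apply: ler_sum => e _.
  rewrite -mulrDr exprMn; apply: ler_pM; rewrite ?sqr_ge0 //.
    by rewrite lerXn2r ?nnegrE ?phi_ge0 //; have := f_le x; rewrite xa.
  by rewrite /special xa /r; do 2!case: (rich _ _); rewrite /= ?expr1n ?expr0n /= ?addr0 ?add0r ?lerDl.
under eq_bigr => x _ do rewrite big_split /= -!mulr_sumr (sum_perp (fun e => r e x)).
rewrite big_split /= -!mulr_sumr (sum_flags a (fun l => (rich a l)%:R)).
have -> : \sum_l (k a l)%:R * (rich a l)%:R = \sum_(l | rich a l) (k a l)%:R :> R.
  by rewrite [RHS]big_mkcond /=; apply: eq_bigr => l _; case: (rich a l); rewrite ?mulr1 ?mulr0.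
have := ler_wpM2l (sqr_ge0 (phi a)) (sum_rich_p2 a).
by rewrite mulrCA phi_sqr; lra.
Qed.

(** Two special vertices bring the factor [special_mass e] into [rect_holder], which can be summed
    over [e], while the other two vertices contribute a norm independent of [e]. In 24 = 6 * 4 the 6
    counts the choices of the two vertices. *)
Lemma two_special : \sum_e \sum_(q | is_rect e q && (2 <= nspecial e q)%N) prodf q
  <= 24 * N2 ^+ 2.
Proof.
pose g (b : bool) x e := f x * (if b then (special x e)%:R else 1).
pose S b1 b2 b3 b4 e := \sum_(q | is_rect e q)
  g b1 q.1.1 e * g b2 q.1.2 e * g b3 q.2.1 e * g b4 q.2.2 e.
pose B := \sum_x f x ^+ 2.
have B0 : 0 <= B by apply: sumr_ge0 => x _; rewrite sqr_ge0.
have sm0 e : 0 <= special_mass e by apply: sumr_ge0 => x _; rewrite sqr_ge0.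
have gE b e : \sum_x g b x e ^+ 2 = if b then special_mass e else B.
  by case: b; apply: eq_bigr => x _; rewrite /g ?mulr1.
have SE (b1 b2 b3 b4 : bool) e : (b1 + b2 + b3 + b4 = 2)%N -> S b1 b2 b3 b4 e <= special_mass e * B.
  move=> h; apply: le_trans (rect_holder e (fun x => g b1 x e) (fun x => g b2 x e)
    (fun x => g b3 x e) (fun x => g b4 x e)) _; rewrite !gE.
  have <- : (Num.sqrt (special_mass e) * Num.sqrt B) ^+ 2 = special_mass e * B.
    by rewrite exprMn !sqr_sqrtr.
  by case: b1 b2 b3 b4 h => [] [] [] [] //= _; rewrite expr2; lra.
apply: le_trans (_ : \sum_e (6 * (special_mass e * B)) <= _); last first.
  rewrite -mulr_sumr -mulr_suml.
  have := ler_pM (sumr_ge0 _ (fun e _ => sm0 e)) B0 sum_special_mass sum_f2.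
  by rewrite expr2; lra.
apply: ler_sum => e _.
apply: le_trans (_ : S true true false false e + S true false true false e
  + S true false false true e + S false true true false e + S false true false true e
  + S false false true true e <= _); last first.
  have := SE true true false false e erefl; have := SE true false true false e erefl.
  have := SE true false false true e erefl; have := SE false true true false e erefl.
  have := SE false true false true e erefl; have := SE false false true true e erefl.
  lra.
rewrite /S -!big_split /= big_mkcondr /=; apply: ler_sum => q _.
rewrite /nspecial /prodf /g !mulr1.
have F0 : 0 <= f q.1.1 * f q.1.2 * f q.2.1 * f q.2.2 by rewrite !mulr_ge0.
by do 4!case: (special _ _); rewrite /= ?mulr1 ?mulr0 ?mul0r; lra.
Qed.

Definition nondeg (q : quad) :=
  [&& q.1.1 != q.1.2, q.2.2 != q.2.1, q.1.1 != q.2.2 & q.1.2 != q.2.1].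
Definition good_rect e (q : quad) := [&& is_rect e q, nondeg q & (nspecial e q <= 1)%N].
Definition top3 (q : quad) :=
  [&& (lev q.1.1 <= lev q.2.1)%N, (lev q.1.2 <= lev q.2.1)%N & (lev q.2.2 <= lev q.2.1)%N].

Lemma prodf_ge0 q : 0 <= prodf q. Proof. by rewrite /prodf !mulr_ge0. Qed.

Lemma good_rect_flip1 e x1 x2 x3 x4 :
  good_rect e (x2, x1, (x4, x3)) = good_rect e (x1, x2, (x3, x4)).
Proof.
rewrite /good_rect /is_rect /nondeg /nspecial /=.
rewrite [key e x2 == _]eq_sym [key e x3 == _]eq_sym [x2 == x1]eq_sym [x3 == x4]eq_sym.
rewrite (_ : special x2 e + _ + _ + _ = special x1 e + special x2 e + special x3 e + special x4 e)%N; last by ring.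
by case: (_ <= 1)%N; rewrite ?andbF // !andbT; do ![case: (_ == _) => //].
Qed.

Lemma good_rect_flip2 e x1 x2 x3 x4 :
  good_rect e (x4, x3, (x2, x1)) = good_rect e (x1, x2, (x3, x4)).
Proof.
rewrite /good_rect /is_rect /nondeg /nspecial /=.
rewrite [key _ x4 == key _ x1]eq_sym [key _ x3 == key _ x2]eq_sym [x4 == x1]eq_sym [x3 == x2]eq_sym.
rewrite (_ : special x4 e + _ + _ + _ = special x1 e + special x2 e + special x3 e + special x4 e)%N; last by ring.
by case: (_ <= 1)%N; rewrite ?andbF // !andbT; do ![case: (_ == _) => //].
Qed.

(** The symmetries generated by two reflections of the rectangle bring a vertex of largest level to
    the third place. *)
Lemma sum_top3 e : \sum_(q | good_rect e q) prodf q
  <= 4 * \sum_(q | good_rect e q && top3 q) prodf q.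
Proof.
pose s1 (q : quad) : quad := (q.1.2, q.1.1, (q.2.2, q.2.1)).
pose s2 (q : quad) : quad := (q.2.2, q.2.1, (q.1.2, q.1.1)).
have s1K : involutive s1 by move=> [[? ?] [? ?]].
have s2K : involutive s2 by move=> [[? ?] [? ?]].
have g1 q : good_rect e (s1 q) = good_rect e q.
  by case: q => [[? ?] [? ?]]; rewrite /s1 /= good_rect_flip1.
have g2 q : good_rect e (s2 q) = good_rect e q.
  by case: q => [[? ?] [? ?]]; rewrite /s2 /= good_rect_flip2.
have f1 q : prodf (s1 q) = prodf q by rewrite /prodf /=; ring.
have f2 q : prodf (s2 q) = prodf q by rewrite /prodf /=; ring.
pose H q := (good_rect e q && top3 q)%:R * prodf q.
have -> : \sum_(q | good_rect e q && top3 q) prodf q = \sum_q H q.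
  by rewrite big_mkcond /=; apply: eq_bigr => q _; rewrite /H; case: ifP; rewrite ?mul1r ?mul0r.
have e1 : \sum_q H (s1 q) = \sum_q H q by rewrite [RHS](reindex_inj (inv_inj s1K)).
have e2 : \sum_q H (s2 q) = \sum_q H q by rewrite [RHS](reindex_inj (inv_inj s2K)).
have e3 : \sum_q H (s1 (s2 q)) = \sum_q H q.
  by rewrite -e1 [RHS](reindex_inj (inv_inj s2K)).
have -> : 4 * \sum_q H q = \sum_q H q + \sum_q H (s1 q) + \sum_q H (s2 q) + \sum_q H (s1 (s2 q)).
  by rewrite e1 e2 e3; ring.
rewrite -!big_split /= big_mkcond /=; apply: ler_sum => q _.
rewrite /H !g1 !g2 !f1 !f2; case: ifP => gq /=; last by rewrite !mul0r !addr0.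
have p0 := prodf_ge0 q.
have : [|| top3 q, top3 (s1 q), top3 (s2 q) | top3 (s1 (s2 q))].
  rewrite /top3 /=; clear.
  set a := lev q.1.1; set b := lev q.1.2; set c := lev q.2.1; set d := lev q.2.2.
  by clearbody a b c d; lia.
by case: (top3 q); case: (top3 _); case: (top3 _); case: (top3 _) => //= _; lra.
Qed.

Definition corner L e (z : T * (T * T)) :=
  [&& (lev z.1 <= L)%N, (lev z.2.1 <= L)%N, (lev z.2.2 <= L)%N,
      key e z.2.1 == key e z.1, key (perp e) z.2.2 == key (perp e) z.1,
      z.2.1 != z.1, z.2.2 != z.1
    & (special z.1 e + special z.2.1 e + special z.2.2 e <= 1)%N].

(* The fourth vertex, being the one of largest level, is dropped. *)
Lemma sum_corner e : \sum_(q | good_rect e q && top3 q) prodf q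
  <= \sum_(L < m) phi L * \sum_z (corner L e z)%:R * (f z.1 * f z.2.1 * f z.2.2).
Proof.
rewrite (partition_big (fun q : quad => Ordinal (lev_lt q.2.1)) xpredT) //=.
apply: ler_sum => L _; rewrite mulr_sumr.
pose P (q : quad) := good_rect e q && top3 q && (Ordinal (lev_lt q.2.1) == L).
pose g (q : quad) := (q.1.1, (q.1.2, q.2.2)).
pose G (z : T * (T * T)) := phi L * ((corner L e z)%:R * (f z.1 * f z.2.1 * f z.2.2)).
have G0 z : 0 <= G z by apply: mulr_ge0; [exact: phi_ge0 | rewrite !mulr_ge0].
apply: le_trans (_ : \sum_(q | P q) G (g q) <= _).
  apply: ler_sum => -[[x1 x2] [x3 x4]] /andP[/andP[/and3P[/and4P[/= r1 r2 r3 r4]]]].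
  case/and4P=> /= n1 n2 n3 n4; rewrite /nspecial /= => ns.
  case/and3P=> /= t1 t2 t3 /eqP EL; have L3 : lev x3 = L by rewrite -EL.
  have -> : G (g (x1, x2, (x3, x4))) = phi L * (f x1 * f x2 * f x4).
    rewrite /G /corner /= -L3 t1 t2 t3 [key e x2 == _]eq_sym r1.
    rewrite [key _ x4 == _]eq_sym r3 [x2 == _]eq_sym n1 [x4 == _]eq_sym n3 /=.
    rewrite (_ : (_ <= 1)%N = true) ?mul1r //.
    by apply: leq_trans ns; rewrite leq_add2r leq_addr.
  rewrite /prodf /= (_ : f x1 * f x2 * f x3 * f x4 = f x3 * (f x1 * f x2 * f x4)); last by ring.
  rewrite ler_wpM2r ?mulr_ge0 //.
  by rewrite /phi -L3; apply: f_le.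
apply: sum_inj_le => // -[[x1 x2] [x3 x4]] [[y1 y2] [y3 y4]]; rewrite !unfold_in.
case/andP=> /andP[/and3P[/and4P[/= /eqP r1 /eqP r2 /eqP r3 /eqP r4] _ _] _] _.
case/andP=> /andP[/and3P[/and4P[/= /eqP q1 /eqP q2 /eqP q3 /eqP q4] _ _] _] _.
rewrite /g /= => -[h1 h2 h4]; subst y1 y2 y4.
have -> : x3 = y3 by apply: (@meet_perp e); congruence.
by [].
Qed.

Definition line_sum (r : nat -> bool) L e x : R :=
  \sum_y ([&& (lev y <= L)%N, y != x, key e y == key e x & r (lev y)])%:R * f y.

Lemma line_sum_ge0 r L e x : 0 <= line_sum r L e x.
Proof. by apply: sumr_ge0 => y _; rewrite mulr_ge0. Qed.

Lemma line_sum_le r L e x : line_sum r L e x <=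
  \sum_(b < m | (b <= L)%N) phi b * ((r b)%:R * (kn b e x)%:R).
Proof.
rewrite /line_sum sum_by_level [X in _ <= X]big_mkcond /=; apply: ler_sum => b _.
case: leqP => bL; last first.
  rewrite big1 // => y /eqP ->.
  by rewrite leqNgt bL /= mul0r.
rewrite knE !mulr_sumr; apply: ler_sum => y /eqP yb; rewrite yb bL /=.
case: (y != x) => /=; last by rewrite mul0r !mulr0.
case: (key e y == _) => /=; last by rewrite mul0r !mulr0.
case: (r b); rewrite /= ?mul0r ?mulr0 // !mul1r mulr1.
by have := f_le y; rewrite yb.
Qed.

Definition poor_sum L e x := line_sum (fun j => ~~ rich j (e, key e x)) L e x.
Definition rich_sum L e x := line_sum (fun j => rich j (e, key e x)) L e x.

(** A companion on a line rich for its own level is special, so the corner [x] is not: the same line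
    is poor for the level of [x]. This is the first factor. *)
Definition mixed_term L e x :=
  (~~ rich (lev x) (e, key e x))%:R * (rich_sum L e x * poor_sum L (perp e) x).

(** Since at most one of the three vertices is special, at most one of the two sides is rich for the
    level of its far end. *)
Lemma corner_split L e :
  \sum_z (corner L e z)%:R * (f z.1 * f z.2.1 * f z.2.2) <=
  \sum_(x | (lev x <= L)%N) f x * (poor_sum L e x * poor_sum L (perp e) x
    + mixed_term L e x + mixed_term L (perp e) x).
Proof.
rewrite [X in _ <= X]big_mkcond /=.
pose F x y z : R := (corner L e (x, (y, z)))%:R * (f x * f y * f z).
rewrite (eq_bigr (fun z => F z.1 z.2.1 z.2.2)); last by case=> ? [].
rewrite -(pair_bigA _ (fun x p => F x p.1 p.2)) /=; apply: ler_sum => x _.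
rewrite -(pair_bigA _ (fun y z => F x y z)) /=.
case: leqP => xL; last first.
  by rewrite big1 // => y _; rewrite big1 // => z _; rewrite /F /corner /= leqNgt xL mul0r.
rewrite /mixed_term perpK /poor_sum /rich_sum /line_sum.
set n := (X in _ + X * _ + _); set n' := (X in _ + _ + X * _).
set A := (X in X * _ + _ + _); set B := (X in A * X + _ + _).
set C := (X in _ + n * (X * _) + _); set D := (X in _ + n' * (X * _)).
rewrite [D * A]mulrC.
rewrite /A /B /C /D !big_distrlr /= !mulr_sumr -!big_split /= mulr_sumr.
apply: ler_sum => y _; rewrite !mulr_sumr -!big_split /= mulr_sumr.
apply: ler_sum => z _; rewrite /F /corner /n /n' /special /= xL /=.
have fx := f_ge0 x; have fy := f_ge0 y; have fz := f_ge0 z.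
have fyz : 0 <= f x * (f y * f z) by rewrite !mulr_ge0.
case: (lev y <= L)%N; case: (lev z <= L)%N; rewrite ?andbF /= ?(mul0r, mulr0, addr0) //.
case: (key e y =P key e x) => [ky|_]; rewrite ?andbF /= ?(mul0r, mulr0, addr0) //.
case: (key (perp e) z =P key (perp e) x) => [kz|_]; rewrite ?andbF /= ?(mul0r, mulr0, addr0) //.
case: (y != x) => /=; rewrite ?(mul0r, mulr0, addr0) //.
case: (z != x) => /=; rewrite ?(mul0r, mulr0, addr0) //.
rewrite ky kz.
set rx := rich (lev x) _; set rx' := rich (lev x) _; set ry := rich (lev y) _.
set ry' := rich (lev y) _; set rz' := rich (lev z) _; set rz := rich (lev z) _.
have h : ((rx || rx') + (ry || ry') + (rz' || rz) <= 1)%N ->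
    [|| ~~ ry && ~~ rz, ~~ rx && (ry && ~~ rz) | ~~ rx' && (~~ ry && rz)].
  by clearbody rx rx' ry ry' rz rz'; clear; case: rx; case: rx'; case: ry; case: ry'; case: rz; case: rz'.
apply: le_trans (_ : ((~~ ry && ~~ rz)%:R + (~~ rx && (ry && ~~ rz))%:R
   + (~~ rx' && (~~ ry && rz))%:R) * (f x * (f y * f z)) <= _); last first.
  by rewrite -!mulnb !natrM; lra.
rewrite -mulrA; apply: ler_wpM2r => //; move: h.
by case: (_ <= 1)%N => [/(_ isT)|_]; do 3!case: (_ && _) => //=; try move=> _; lra.
Qed.

Lemma sum_dir_corner L x :
  \sum_e (poor_sum L e x * poor_sum L (perp e) x + mixed_term L e x + mixed_term L (perp e) x)
  <= \sum_e (poor_sum L e x ^+ 2 + 2 * mixed_term L e x).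
Proof.
rewrite !big_split /= (sum_perp (fun e => mixed_term L e x)) -mulr_sumr.
suff : \sum_e poor_sum L e x * poor_sum L (perp e) x <= \sum_e poor_sum L e x ^+ 2 by lra.
have -> : \sum_e poor_sum L e x ^+ 2 =
    \sum_e (poor_sum L e x ^+ 2 / 2 + poor_sum L (perp e) x ^+ 2 / 2).
  rewrite big_split /= (sum_perp (fun e => poor_sum L e x ^+ 2 / 2)) -!mulr_suml.
  by field.
apply: ler_sum => e _.
by have := sqr_ge0 (poor_sum L e x - poor_sum L (perp e) x); rewrite sqrrB; lra.
Qed.

(** Minkowski's inequality in l^2 of the flags (x, e), over the levels of the companions. *)
Lemma sum_poor_sqr L a : \sum_(x | lev x == a) \sum_e poor_sum L e x ^+ 2
  <= (\sum_(b < m | (b <= L)%N) phi b * Num.sqrt (K2 a b)) ^+ 2.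
Proof.
pose w b x e : R := (~~ rich b (e, key e x))%:R * (kn b e x)%:R.
have w0 b x e : 0 <= w b x e by rewrite mulr_ge0.
apply: le_trans (_ : \sum_(x | lev x == a) \sum_e
    (\sum_(b < m | (b <= L)%N) phi b * w b x e) ^+ 2 <= _).
  apply: ler_sum => x _; apply: ler_sum => e _.
  rewrite lerXn2r ?nnegrE ?line_sum_ge0 ?line_sum_le //.
  by apply: sumr_ge0 => b _; rewrite mulr_ge0 ?phi_ge0.
rewrite [X in _ <= X]expr2 big_distrlr /=.
under eq_bigr do under eq_bigr do rewrite expr2 big_distrlr /=.
rewrite pair_big_dep /= exchange_big /=; apply: ler_sum => b _.
rewrite exchange_big /=; apply: ler_sum => b' _.
rewrite (eq_bigr (fun p : T * E => phi b * phi b' * (w b p.1 p.2 * w b' p.1 p.2)));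
  last by move=> p _; ring.
rewrite -mulr_sumr.
have -> : phi b * Num.sqrt (K2 a b) * (phi b' * Num.sqrt (K2 a b'))
   = phi b * phi b' * (Num.sqrt (K2 a b) * Num.sqrt (K2 a b')) by ring.
rewrite ler_wpM2l ?(mulr_ge0 (phi_ge0 b) (phi_ge0 b')) //; apply: le_trans (sum_CauchySchwarz_sqrt _
  (fun p : T * E => w b p.1 p.2) (fun p : T * E => w b' p.1 p.2)) _.
have KE j : \sum_(p : T * E | (lev p.1 == a) && true) w j p.1 p.2 ^+ 2 = K2 a j.
  rewrite -(pair_big_dep (fun x => lev x == a) (fun _ _ => true) (fun x e => w j x e ^+ 2)) /=.
  apply: eq_bigr => x _; apply: eq_bigr => e _.
  by rewrite /w exprMn; case: (rich _ _); rewrite /= ?expr1n ?expr0n.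
by rewrite !KE.
Qed.

(** The smallest positive excess 5 / 8 - 1 / 2 of the powers of 2^b in [sqrt_K2_le] over the power 1
    / 2 that [phi b] takes away. *)
Let c8 : R := 1 / 8.
Let G := geo c8.
Let M : R := m%:R.
Let n := Num.sqrt N2.
Let Lam L := \sum_(b < m | (b <= L)%N) lam b * kern c8 L b.

Let c8_gt0 : 0 < c8. Proof. by rewrite /c8; lra. Qed.
Let G_ge1 : 1 <= G. Proof. exact: geo_ge1. Qed.
Let M_ge1 : 1 <= M. Proof. by rewrite /M ler1n. Qed.
Let n_ge0 : 0 <= n. Proof. exact: sqrtr_ge0. Qed.
Let n_sqr : n ^+ 2 = N2. Proof. by rewrite sqr_sqrtr ?N2_ge0. Qed.
Let Lam_ge0 L : 0 <= Lam L.
Proof. by apply: sumr_ge0 => b _; rewrite mulr_ge0 ?p2_ge0. Qed.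
Let Lam_le L : Lam L <= Num.sqrt G * n. Proof. exact: kern_conv_le. Qed.
Let sum_lam : \sum_(b < m) lam b <= Num.sqrt M * n. Proof. exact: sum_le_sqrt. Qed.
Let schur : \sum_(L < m) \sum_(b < m | (b <= L)%N) lam L * lam b * kern c8 L b <= G * N2.
Proof. exact: schur_kernel. Qed.

Let sqrtM_ge0 : 0 <= Num.sqrt M. Proof. exact: sqrtr_ge0. Qed.
Let sqrtM_sqr : Num.sqrt M ^+ 2 = M. Proof. by rewrite sqr_sqrtr // ltW // (lt_le_trans ltr01). Qed.

Lemma sqrt_K2_le a b : (a < m)%N -> (b < m)%N ->
  Num.sqrt (K2 a b) <= 10 * Num.sqrt D0 *
   (Num.sqrt M * p2 (3 / 8 * a%:R + 5 / 8 * b%:R)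
    + Num.sqrt M * p2 (5 / 16 * a%:R + 11 / 16 * b%:R)
    + Num.sqrt (Num.sqrt M) * p2 (a%:R / 4 + 3 / 4 * b%:R) + p2 (a%:R / 2 + b%:R / 2)).
Proof.
move=> am bm.
have := @K2_le a b M M_ge1; rewrite /M !ler_nat => /(_ (ltnW am) (ltnW bm)); rewrite -/M.
pose x1 := Num.sqrt M * p2 (3 / 8 * a%:R + 5 / 8 * b%:R).
pose x2 := Num.sqrt M * p2 (5 / 16 * a%:R + 11 / 16 * b%:R).
pose x3 := Num.sqrt (Num.sqrt M) * p2 (a%:R / 4 + 3 / 4 * b%:R).
pose x4 := p2 (a%:R / 2 + b%:R / 2).
rewrite -/x1 -/x2 -/x3 -/x4.
have -> : M * p2 (3 / 4 * a%:R + 5 / 4 * b%:R) = x1 ^+ 2.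
  by rewrite exprMn sqrtM_sqr p2_sqr; congr (_ * p2 _); field.
have -> : M * p2 (5 / 8 * a%:R + 11 / 8 * b%:R) = x2 ^+ 2.
  by rewrite exprMn sqrtM_sqr p2_sqr; congr (_ * p2 _); field.
have -> : Num.sqrt M * p2 (a%:R / 2 + 3 / 2 * b%:R) = x3 ^+ 2.
  by rewrite exprMn sqr_sqrtr // p2_sqr; congr (_ * p2 _); field.
have -> : p2 (a%:R + b%:R) = x4 ^+ 2 by rewrite p2_sqr; congr p2; field.
have x10 : 0 <= x1 by rewrite mulr_ge0 ?p2_ge0.
have x20 : 0 <= x2 by rewrite mulr_ge0 ?p2_ge0.
have x30 : 0 <= x3 by rewrite mulr_ge0 ?p2_ge0 ?sqrtr_ge0.
have x40 : 0 <= x4 by apply: p2_ge0.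
clearbody x1 x2 x3 x4; move=> h.
have s0 : 0 <= x1 + x2 + x3 + x4 by rewrite !addr_ge0.
rewrite -[X in _ <= X]ger0_norm; last by rewrite mulr_ge0 // mulr_ge0 // sqrtr_ge0.
rewrite -sqrtr_sqr ler_wsqrtr //; apply: le_trans h _.
have -> (s : R) : (10 * Num.sqrt D0 * s) ^+ 2 = 100 * D0 * s ^+ 2.
  by rewrite -[in RHS](sqr_sqrtr D0_ge0); ring.
rewrite (ler_wpM2l (mulr_ge0 (ler0n R 100) D0_ge0)) //.
have := mulr_ge0 x10 x20; have := mulr_ge0 x10 x30; have := mulr_ge0 x10 x40.
have := mulr_ge0 x20 x30; have := mulr_ge0 x20 x40; have := mulr_ge0 x30 x40.
by rewrite !expr2; lra.
Qed.

(** Three of the powers of 2^b exceed 1 / 2 and leave a decaying kernel. The fourth does not and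
    costs [Num.sqrt M] by Cauchy-Schwarz; it can afford this because [K2_le] gives it no [M]. *)
Lemma sum_phi_sqrt_K2 a L : (a <= L)%N -> (L < m)%N ->
  \sum_(b < m | (b <= L)%N) phi b * Num.sqrt (K2 a b) <= 10 * Num.sqrt D0 *
   (2 * Num.sqrt M * p2 (5 / 16 * a%:R + 3 / 16 * L%:R) * Lam L
    + Num.sqrt (Num.sqrt M) * p2 (a%:R / 4 + L%:R / 4) * Lam L
    + p2 (a%:R / 2) * (Num.sqrt M * n)).
Proof.
move=> aL Lm; have am := leq_ltn_trans aL Lm.
have aLR : a%:R <= L%:R :> R by rewrite ler_nat.
apply: le_trans (_ : \sum_(b < m | (b <= L)%N) 10 * Num.sqrt D0 *
   (2 * Num.sqrt M * p2 (5 / 16 * a%:R + 3 / 16 * L%:R) * (lam b * kern c8 L b)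
    + Num.sqrt (Num.sqrt M) * p2 (a%:R / 4 + L%:R / 4) * (lam b * kern c8 L b)
    + p2 (a%:R / 2) * lam b) <= _); last first.
  rewrite -mulr_sumr !big_split /= -!mulr_sumr -/(Lam L).
  rewrite ler_wpM2l ?mulr_ge0 ?sqrtr_ge0 // lerD2l ler_wpM2l ?p2_ge0 //.
  apply: le_trans sum_lam; apply: ler_sum_set => // b _; exact: lam_ge0.
apply: ler_sum => b bL; have bLR : b%:R <= L%:R :> R by rewrite ler_nat.
apply: le_trans (ler_wpM2l (phi_ge0 b) (sqrt_K2_le am (ltn_ord b))) _.
rewrite mulrCA ler_wpM2l ?mulr_ge0 ?sqrtr_ge0 // /phi.
have e (x y z : R) : lam b * p2 x * (y * p2 z) = lam b * (y * p2 (x + z)).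
  by rewrite p2D; ring.
have e' (x z : R) : lam b * p2 x * p2 z = lam b * p2 (x + z) by rewrite p2D; ring.
rewrite !mulrDr !e e' /kern /c8.
have lb := lam_ge0 b.
have h1 : p2 (- (b%:R / 2) + (3 / 8 * a%:R + 5 / 8 * b%:R))
   <= p2 (5 / 16 * a%:R + 3 / 16 * L%:R) * p2 (1 / 8 * (b%:R - L%:R)).
  by rewrite -p2D p2_le //; lra.
have h2 : p2 (- (b%:R / 2) + (5 / 16 * a%:R + 11 / 16 * b%:R))
   <= p2 (5 / 16 * a%:R + 3 / 16 * L%:R) * p2 (1 / 8 * (b%:R - L%:R)).
  by rewrite -p2D p2_le //; lra.
have h3 : p2 (- (b%:R / 2) + (a%:R / 4 + 3 / 4 * b%:R))
   <= p2 (a%:R / 4 + L%:R / 4) * p2 (1 / 8 * (b%:R - L%:R)).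
  by rewrite -p2D p2_le //; lra.
have -> : p2 (- (b%:R / 2) + (a%:R / 2 + b%:R / 2)) = p2 (a%:R / 2).
  by congr p2; ring.
have := ler_wpM2l lb (ler_wpM2l sqrtM_ge0 h1).
have := ler_wpM2l lb (ler_wpM2l sqrtM_ge0 h2).
have := ler_wpM2l lb (ler_wpM2l (sqrtr_ge0 (Num.sqrt M)) h3).
lra.
Qed.

Lemma sum_level_le L (F : T -> R) : (forall x, 0 <= F x) ->
  \sum_(x | (lev x <= L)%N) f x * F x
    <= \sum_(a < m | (a <= L)%N) phi a * \sum_(x | lev x == a) F x.
Proof.
move=> F0; rewrite big_mkcond sum_by_level [X in _ <= X]big_mkcond /=.
apply: ler_sum => a _; case: leqP => aL; last first.
  by rewrite big1 // => x /eqP ->; rewrite leqNgt aL.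
rewrite mulr_sumr; apply: ler_sum => x /eqP xa; rewrite xa aL ler_wpM2r //.
by have := f_le x; rewrite xa.
Qed.

Lemma sqr_sum3_le (x y z : R) : (x + y + z) ^+ 2 <= 3 * (x ^+ 2 + y ^+ 2 + z ^+ 2).
Proof.
have := sqr_ge0 (x - y); have := sqr_ge0 (x - z); have := sqr_ge0 (y - z).
by rewrite !expr2; lra.
Qed.

Lemma poor_total :
  \sum_(L < m) phi L * \sum_(x | (lev x <= L)%N) f x * \sum_e poor_sum L e x ^+ 2
    <= 1800 * D0 * G ^+ 2 * M * N2 ^+ 2.
Proof.
have G0 : 0 <= G by apply: le_trans G_ge1.
have D00 := D0_ge0; have n0 := n_ge0; have sM0 := sqrtM_ge0; have L0 := Lam_ge0.
have G1 := G_ge1; have SL := sum_lam; have SC := schur.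
have N0 := N2_ge0.
have M0 : 0 <= M by apply: le_trans M_ge1.
have Lam2 L : Lam L ^+ 2 <= G * N2.
  rewrite -n_sqr -[X in X * _](sqr_sqrtr G0) -exprMn.
  by apply: lerXn2r; rewrite ?nnegrE ?Lam_ge0 ?Lam_le // mulr_ge0 ?sqrtr_ge0 ?n_ge0.
apply: le_trans (_ : \sum_(L < m) \sum_(a < m | (a <= L)%N) 300 * D0 *
   (5 * M * G * N2 * (lam L * lam a * kern c8 L a)
    + Num.sqrt M * Num.sqrt G * n * (lam L * Lam L * lam a)) <= _).
  apply: ler_sum => L _.
  apply: le_trans (ler_wpM2l (phi_ge0 L) (sum_level_le _ _)) _.
    by move=> x; apply: sumr_ge0 => e _; rewrite sqr_ge0.
  rewrite mulr_sumr; apply: ler_sum => a aL.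
  have aLR : a%:R <= L%:R :> R by rewrite ler_nat.
  apply: le_trans (ler_wpM2l (phi_ge0 L) (ler_wpM2l (phi_ge0 a) (sum_poor_sqr L a))) _.
  pose T1 := 2 * Num.sqrt M * p2 (5 / 16 * a%:R + 3 / 16 * L%:R) * Lam L.
  pose T2 := Num.sqrt (Num.sqrt M) * p2 (a%:R / 4 + L%:R / 4) * Lam L.
  pose T3 := p2 (a%:R / 2) * (Num.sqrt M * n).
  have T10 : 0 <= T1 by rewrite !mulr_ge0 ?p2_ge0 ?sqrtr_ge0 ?Lam_ge0.
  have T20 : 0 <= T2 by rewrite !mulr_ge0 ?p2_ge0 ?sqrtr_ge0 ?Lam_ge0.
  have T30 : 0 <= T3 by rewrite !mulr_ge0 ?p2_ge0 ?sqrtr_ge0.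
  have Y0 : 0 <= \sum_(b < m | (b <= L)%N) phi b * Num.sqrt (K2 a b).
    by apply: sumr_ge0 => b _; rewrite mulr_ge0 ?sqrtr_ge0 ?phi_ge0.
  have hY := sum_phi_sqrt_K2 aL (ltn_ord L); rewrite -/T1 -/T2 -/T3 in hY.
  have {hY}hY2 : (\sum_(b < m | (b <= L)%N) phi b * Num.sqrt (K2 a b)) ^+ 2
      <= 300 * D0 * (T1 ^+ 2 + T2 ^+ 2 + T3 ^+ 2).
    apply: le_trans (_ : (10 * Num.sqrt D0 * (T1 + T2 + T3)) ^+ 2 <= _).
      by rewrite lerXn2r ?nnegrE ?mulr_ge0 ?sqrtr_ge0 ?addr_ge0.
    have -> (s : R) : (10 * Num.sqrt D0 * s) ^+ 2 = D0 * (100 * s ^+ 2).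
      by rewrite -[in RHS](sqr_sqrtr D0_ge0); ring.
    rewrite (_ : 300 * D0 * (T1 ^+ 2 + T2 ^+ 2 + T3 ^+ 2) =
      D0 * (100 * (3 * (T1 ^+ 2 + T2 ^+ 2 + T3 ^+ 2)))); last by ring.
    by apply: (ler_wpM2l D0_ge0); have := sqr_sum3_le T1 T2 T3; lra.
  rewrite mulrA; apply: le_trans (ler_wpM2l (mulr_ge0 (phi_ge0 L) (phi_ge0 a)) hY2) _.
  rewrite mulrCA ler_wpM2l ?(mulr_ge0 (ler0n R 300) D0_ge0) // !mulrDr.
  have la := lam_ge0 a; have lL := lam_ge0 L.
  have ll : 0 <= lam L * lam a by rewrite mulr_ge0.
  have kp : 0 <= kern c8 L a by apply: p2_ge0.
  have e1 : phi L * phi a * T1 ^+ 2 = 4 * M * (lam L * lam a * kern c8 L a) * Lam L ^+ 2.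
    have -> : kern c8 L a = p2 (- (L%:R / 2)) * p2 (- (a%:R / 2))
        * p2 (5 / 16 * a%:R + 3 / 16 * L%:R) ^+ 2.
      by rewrite p2_sqr -!p2D /kern /c8; congr p2; field.
    by rewrite -sqrtM_sqr /phi /T1; ring.
  (* All powers of 2 cancel, so no decay in [a] is left; the sum over [a] costs another
     [Num.sqrt M], and the total is again [M]. *)
  have e2 : phi L * phi a * T2 ^+ 2 = Num.sqrt M * (lam L * lam a) * Lam L ^+ 2.
    have h : p2 (- (L%:R / 2)) * p2 (- (a%:R / 2)) * p2 (a%:R / 4 + L%:R / 4) ^+ 2 = 1.
      by rewrite -[RHS]p2_0 p2_sqr -!p2D; congr p2; field.
    rewrite -[Num.sqrt M in RHS](sqr_sqrtr sqrtM_ge0) /phi /T2 -[RHS]mulr1 -[X in _ = _ * X]h; ring.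
  have e3 : phi L * phi a * T3 ^+ 2 <= M * N2 * (lam L * lam a * kern c8 L a).
    have -> : phi L * phi a * T3 ^+ 2 = M * N2 * (lam L * lam a *
       (p2 (- (L%:R / 2)) * p2 (- (a%:R / 2)) * p2 (a%:R / 2) ^+ 2)).
      by rewrite -sqrtM_sqr -n_sqr /phi /T3; ring.
    rewrite ler_wpM2l ?mulr_ge0 // ler_wpM2l // p2_sqr -!p2D /kern /c8 p2_le //; lra.
  have e3' : M * N2 * (lam L * lam a * kern c8 L a)
     <= M * N2 * (lam L * lam a * kern c8 L a) * G.
    by rewrite ler_peMr // !mulr_ge0.
  have e1' : 4 * M * (lam L * lam a * kern c8 L a) * Lam L ^+ 2
     <= 4 * M * (lam L * lam a * kern c8 L a) * (G * N2).
    by apply: ler_wpM2l; [rewrite !mulr_ge0 | exact: Lam2].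
  have e2' : Num.sqrt M * (lam L * lam a) * Lam L ^+ 2
     <= Num.sqrt M * (lam L * lam a) * (Lam L * (Num.sqrt G * n)).
    apply: ler_wpM2l; first by rewrite mulr_ge0.
    by rewrite expr2; apply: ler_wpM2l; [exact: L0 | exact: Lam_le].
  by rewrite e1 e2; lra.
under eq_bigr do rewrite -mulr_sumr big_split /= -!mulr_sumr.
rewrite -mulr_sumr big_split /= -!mulr_sumr.
rewrite -!mulrA [X in _ <= X]mulrA [X in _ <= X](_ : _ = 300 * D0 * (6 * G ^+ 2 * M * N2 ^+ 2)); last by ring.
rewrite mulrA ler_wpM2l ?mulr_ge0 //.
set S1 := \sum_(i < m) _; set S2 := \sum_(i < m) _.
have hS1 : S1 <= G * N2 by apply: schur.
have hS2 : S2 <= Num.sqrt M * n * (G * N2).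
  apply: le_trans (_ : \sum_(L < m) (lam L * Lam L) * (Num.sqrt M * n) <= _).
    apply: ler_sum => L _; rewrite ler_wpM2l ?mulr_ge0 //.
    apply: le_trans sum_lam; apply: ler_sum_set => // b _; exact: lam_ge0.
  rewrite -mulr_suml mulrC ler_wpM2l ?mulr_ge0 //; apply: le_trans schur.
  by apply: ler_sum => L _; rewrite mulr_sumr; apply: ler_sum => b _; rewrite mulrA.
have sG : Num.sqrt G <= G.
  rewrite -[X in _ <= X]sqr_sqrtr // expr2 ler_peMl ?sqrtr_ge0 //.
  by rewrite -[X in X <= _]sqrtr1 ler_wsqrtr.
have c1 : 0 <= 5 * M * G * N2 by rewrite !mulr_ge0.
have c2 : 0 <= Num.sqrt M * Num.sqrt G * n by rewrite !mulr_ge0 ?sqrtr_ge0.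
have h1 := ler_wpM2l c1 hS1; have h2 := ler_wpM2l c2 hS2.
have h3 : Num.sqrt M * Num.sqrt G * n * (Num.sqrt M * n * (G * N2)) = M * N2 * (G * N2) * Num.sqrt G.
  by rewrite -[in RHS]sqrtM_sqr -{3}n_sqr; ring.
have h4 : M * N2 * (G * N2) * Num.sqrt G <= M * N2 * (G * N2) * G by rewrite ler_wpM2l // !mulr_ge0.
move: h1 h2 h4; rewrite h3 !expr2; lra.
Qed.

(** A poor line has at most 2 * 2^(b/2) points of level b, which [phi b] turns into twice [lam b];
    Cauchy-Schwarz over the levels does the rest. *)
Lemma poor_sum_le L e x : poor_sum L e x <= 2 * (Num.sqrt M * n).
Proof.
apply: le_trans (line_sum_le _ _ _ _) _.
apply: le_trans (_ : \sum_(b < m) 2 * lam b <= _); last first.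
  by rewrite -mulr_sumr; apply: ler_wpM2l => //; exact: sum_lam.
apply: le_trans (_ : \sum_(b < m | (b <= L)%N) 2 * lam b <= _); last first.
  by apply: ler_sum_set => // b _; rewrite mulr_ge0.
apply: ler_sum => b _; case: (boolP (rich b _)) => nr /=.
  by rewrite mul0r mulr0 mulr_ge0.
rewrite mul1r; apply: le_trans (_ : phi b * (2 * p2 (b%:R / 2)) <= _).
  apply: ler_wpM2l; first exact: phi_ge0.
  by apply: le_trans (k_poor nr); rewrite ler_nat kn_le.
have -> : phi b * (2 * p2 (b%:R / 2)) = 2 * lam b * (p2 (- (b%:R / 2)) * p2 (b%:R / 2)).
  by rewrite /phi; ring.
by rewrite -p2D addNr p2_0 mulr1.
Qed.

(** The poor factor is bounded uniformly. In the other one, lines rich for b and poor for a carry at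
    most 2 * 2^(a/2) points of level a, and [sum_rich_p2] sums over them. *)
Lemma sum_mixed_level L a : \sum_(x | lev x == a) \sum_e mixed_term L e x
  <= 2 * (Num.sqrt M * n) * \sum_(b < m | (b <= L)%N) phi b * (4 * p2 (a%:R / 2) * p2 b%:R).
Proof.
pose h b (l : E * K) : R := (~~ rich a l && rich b l)%:R * (k b l)%:R.
apply: le_trans (_ : 2 * (Num.sqrt M * n) * (\sum_(x | lev x == a) \sum_e
    \sum_(b < m | (b <= L)%N) phi b * h b (e, key e x)) <= _).
  rewrite mulr_sumr; apply: ler_sum => x /eqP xa.
  rewrite mulr_sumr; apply: ler_sum => e _; rewrite /mixed_term xa.
  rewrite mulrA [X in _ <= X]mulrC; apply: ler_pM; rewrite ?mulr_ge0 ?line_sum_ge0 //;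
    last exact: poor_sum_le.
  apply: le_trans (ler_wpM2l (ler0n R _) (line_sum_le _ _ _ _)) _.
  rewrite mulr_sumr; apply: ler_sum => b _.
  rewrite mulrCA; apply: ler_wpM2l; first exact: phi_ge0.
  rewrite /h -mulnb natrM -mulrA; apply: ler_wpM2l => //; apply: ler_wpM2l => //.
  by rewrite ler_nat kn_le.
have c0 : 0 <= 2 * (Num.sqrt M * n) by rewrite mulr_ge0 // mulr_ge0 ?sqrtr_ge0.
apply: ler_wpM2l => //.
under eq_bigr do rewrite exchange_big /=.
rewrite exchange_big /=; apply: ler_sum => b _.
under eq_bigr do rewrite -mulr_sumr.
rewrite -mulr_sumr; apply: ler_wpM2l; first exact: phi_ge0.
rewrite (sum_flags a (h b)).
apply: le_trans (_ : 2 * p2 (a%:R / 2) * \sum_(l | rich b l) (k b l)%:R <= _); last first.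
  have pa : 0 <= 2 * p2 (a%:R / 2) by rewrite mulr_ge0 ?p2_ge0.
  by have := ler_wpM2l pa (sum_rich_p2 b); lra.
rewrite mulr_sumr [X in _ <= X]big_mkcond /=; apply: ler_sum => l _; rewrite /h.
case: (boolP (rich a l)) => ra /=.
  by rewrite mul0r mulr0; case: ifP => // _; rewrite !mulr_ge0 ?p2_ge0.
by case: (rich b l); rewrite /= ?mul0r ?mulr0 // mul1r ler_wpM2r // k_poor.
Qed.

Lemma mixed_total :
  \sum_(L < m) phi L * \sum_(x | (lev x <= L)%N) f x * \sum_e mixed_term L e x
    <= 8 * G * M * N2 ^+ 2.
Proof.
have n0 := n_ge0; have sM0 := sqrtM_ge0; have N0 := N2_ge0.
apply: le_trans (_ : \sum_(L < m) (8 * (Num.sqrt M * n) * (Num.sqrt M * n)) *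
  \sum_(b < m | (b <= L)%N) lam L * lam b * kern c8 L b <= _); last first.
  rewrite -mulr_sumr.
  have -> : 8 * (Num.sqrt M * n) * (Num.sqrt M * n) = 8 * M * N2.
    by rewrite -[M in RHS]sqrtM_sqr -n_sqr; ring.
  have -> : 8 * G * M * N2 ^+ 2 = 8 * M * N2 * (G * N2) by ring.
  apply: ler_wpM2l; last exact: schur.
  by rewrite !mulr_ge0 // /M.
apply: ler_sum => L _.
apply: le_trans (ler_wpM2l (phi_ge0 L) (sum_level_le _ _)) _.
  move=> x; apply: sumr_ge0 => e _; rewrite /mixed_term.
  by rewrite mulr_ge0 // mulr_ge0 ?line_sum_ge0.
set X := \sum_(b < m | _) _ * kern c8 L b.
have X0 : 0 <= X.
  by apply: sumr_ge0 => b _; rewrite !mulr_ge0 ?p2_ge0.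
apply: le_trans (_ : \sum_(a < m | (a <= L)%N) lam a * (8 * (Num.sqrt M * n) * X) <= _); last first.
  rewrite -mulr_suml.
  have -> : 8 * (Num.sqrt M * n) * (Num.sqrt M * n) * X
    = (Num.sqrt M * n) * (8 * (Num.sqrt M * n) * X) by ring.
  apply: ler_wpM2r; first by rewrite !mulr_ge0.
  apply: le_trans sum_lam; apply: ler_sum_set => // b _; exact: lam_ge0.
rewrite mulr_sumr; apply: ler_sum => a aL.
apply: le_trans (ler_wpM2l (phi_ge0 L) (ler_wpM2l (phi_ge0 a) (sum_mixed_level L a))) _.
have -> : phi L * (phi a * (2 * (Num.sqrt M * n) *
     \sum_(b < m | (b <= L)%N) phi b * (4 * p2 (a%:R / 2) * p2 b%:R)))
   = lam a * (8 * (Num.sqrt M * n)) *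
     \sum_(b < m | (b <= L)%N) phi L * (phi b * p2 b%:R) * (p2 (- (a%:R / 2)) * p2 (a%:R / 2)).
  rewrite !mulr_sumr; apply: eq_bigr => b _; rewrite /phi; ring.
rewrite -mulrA; apply: ler_wpM2l => //.
apply: ler_wpM2l; first by rewrite !mulr_ge0.
apply: ler_sum => b bL; have bLR : b%:R <= L%:R :> R by rewrite ler_nat.
rewrite -p2D addNr p2_0 mulr1 /phi.
have -> : lam L * p2 (- (L%:R / 2)) * (lam b * p2 (- (b%:R / 2)) * p2 b%:R)
  = lam L * lam b * (p2 (- (L%:R / 2)) * p2 (- (b%:R / 2)) * p2 b%:R) by ring.
apply: ler_wpM2l; first by rewrite mulr_ge0.
by rewrite -!p2D /kern /c8 p2_le //; lra.
Qed.

Theorem rect_sum_le :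
  \sum_e \sum_(q | is_rect e q && nondeg q) prodf q
    <= 8000 * D0 * geo (1 / 8) ^+ 2 * m%:R * N2 ^+ 2.
Proof.
have N0 := N2_ge0; have M1 := M_ge1; have G1 := G_ge1; have n0 := n_ge0.
have D1 := D0_ge1.
apply: le_trans (_ : \sum_e \sum_(q | is_rect e q && (2 <= nspecial e q)%N) prodf q
    + \sum_e \sum_(q | good_rect e q) prodf q <= _).
  rewrite -big_split /=; apply: ler_sum => e _.
  rewrite big_mkcond [X in X + _]big_mkcond [X in _ + X]big_mkcond /= -big_split /=.
  apply: ler_sum => q _; have p0 := prodf_ge0 q.
  rewrite /good_rect [(_ <= 1)%N]leqNgt.
  by case: (is_rect e q); case: (nondeg q); case: (1 < _)%N => /=; lra.
have hg : \sum_e \sum_(q | good_rect e q) prodf q <=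
   4 * (1800 * D0 * G ^+ 2 * M * N2 ^+ 2 + 2 * (8 * G * M * N2 ^+ 2)).
  apply: le_trans (ler_sum _ (fun e _ => sum_top3 e)) _.
  rewrite -mulr_sumr ler_wpM2l //.
  apply: le_trans (ler_sum _ (fun e _ => sum_corner e)) _.
  rewrite exchange_big /=.
  apply: le_trans (_ : \sum_(L < m) phi L * \sum_(x | (lev x <= L)%N) f x *
      \sum_e (poor_sum L e x ^+ 2 + 2 * mixed_term L e x) <= _).
    apply: ler_sum => L _; rewrite -mulr_sumr; apply: ler_wpM2l; first exact: phi_ge0.
    apply: le_trans (ler_sum _ (fun e _ => corner_split L e)) _.
    rewrite exchange_big /=; apply: ler_sum => x _; rewrite -mulr_sumr.
    by apply: ler_wpM2l => //; exact: sum_dir_corner.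
  apply: le_trans (lerD poor_total (ler_wpM2l (ler0n R 2) mixed_total)).
  rewrite [X in _ <= _ + X]mulr_sumr -big_split /=; apply: ler_sum => L _.
  rewrite [2 * _]mulrCA -mulrDr; apply: ler_wpM2l; first exact: phi_ge0.
  rewrite [X in _ <= _ + X]mulr_sumr -big_split /=; apply: ler_sum => x _.
  rewrite [2 * _]mulrCA -mulrDr; apply: ler_wpM2l => //.
  by rewrite big_split /= -mulr_sumr.
apply: le_trans (lerD two_special hg) _; rewrite -[geo (1 / 8)]/G -/M.
have q0 : 0 <= N2 ^+ 2 by rewrite sqr_ge0.
have h1 : 1 <= D0 * G ^+ 2 * M.
  by rewrite -[1]mulr1 ler_pM // -[1]mulr1 ler_pM // -(expr1n _ 2) lerXn2r ?nnegrE // ltW // (lt_le_trans ltr01).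
have h2 : G * M <= D0 * G ^+ 2 * M.
  apply: ler_wpM2r; first by rewrite (le_trans ler01).
  rewrite expr2 mulrA; apply: ler_peMl; first by rewrite (le_trans ler01).
  by rewrite -[1]mulr1 ler_pM.
have := ler_wpM2r q0 h1; have := ler_wpM2r q0 h2.
lra.
Qed.

Lemma young_sqrt_cube (t s r : R) : 0 <= r -> 0 < t -> s * t = 1 ->
  r ^+ 3 <= t * r ^+ 2 + s ^+ 2 * r ^+ 5.
Proof.
move=> r0 t0 st; have s0 : 0 < s by rewrite -(pmulr_lgt0 _ t0) st.
have r2 : 0 <= r ^+ 2 by rewrite sqr_ge0.
have r3 : 0 <= r ^+ 3 by rewrite exprn_ge0.
have q1 : 0 <= t * r ^+ 2 by rewrite mulr_ge0 // ltW.
have q2 : 0 <= s ^+ 2 * r ^+ 5 by rewrite mulr_ge0 ?sqr_ge0 ?exprn_ge0.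
have [h|h] := leP r t.
  by have := ler_wpM2r r2 h; rewrite -exprS; lra.
have : 1 <= (s * r) ^+ 2.
  by rewrite exprn_ege1 //; move: h => /ltW /(ler_wpM2l (ltW s0)); rewrite st.
by move=> /(ler_wpM2r r3); rewrite mul1r (_ : (s * r) ^+ 2 * r ^+ 3 = s ^+ 2 * r ^+ 5); [lra | ring].
Qed.

Lemma young_mixed (t s x y : R) : 0 <= x -> 0 <= y -> 0 < t -> s * t = 1 ->
  x ^+ 2 * y ^+ 3 <= t ^+ 3 * x ^+ 5 + s ^+ 2 * y ^+ 5.
Proof.
move=> x0 y0 t0 st; have s0 : 0 < s by rewrite -(pmulr_lgt0 _ t0) st.
have x2 : 0 <= x ^+ 2 by rewrite sqr_ge0.
have y3 : 0 <= y ^+ 3 by rewrite exprn_ge0.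
have q1 : 0 <= t ^+ 3 * x ^+ 5 by apply: mulr_ge0; apply: exprn_ge0 => //; apply: ltW.
have q2 : 0 <= s ^+ 2 * y ^+ 5 by rewrite mulr_ge0 ?sqr_ge0 ?exprn_ge0.
have [h|h] := leP y (t * x).
  have : y ^+ 3 <= (t * x) ^+ 3 by rewrite lerXn2r // nnegrE // mulr_ge0 // ltW.
  by move=> /(ler_wpM2l x2); rewrite (_ : x ^+ 2 * (t * x) ^+ 3 = t ^+ 3 * x ^+ 5); [lra | ring].
have : x <= s * y by move: h => /ltW /(ler_wpM2l (ltW s0)); rewrite mulrA st mul1r.
move=> hx; have : x ^+ 2 <= (s * y) ^+ 2.
  by apply: lerXn2r => //; rewrite nnegrE // mulr_ge0 // ltW.
by move=> /(ler_wpM2r y3); rewrite (_ : (s * y) ^+ 2 * y ^+ 3 = s ^+ 2 * y ^+ 5); [lra | ring].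
Qed.

Definition rt (j : nat) : R := Num.sqrt j%:R.
Lemma rt_ge0 j : 0 <= rt j. Proof. exact: sqrtr_ge0. Qed.
Lemma rt_sqr j : rt j ^+ 2 = j%:R. Proof. by rewrite sqr_sqrtr. Qed.
Lemma rt_le i j : (i <= j)%N -> rt i <= rt j.
Proof. by move=> ij; rewrite ler_wsqrtr // ler_nat. Qed.

Lemma sum_poor_rt a (h : R) : 0 < h ->
  \sum_(l | [&& ~~ rich a l, (2 <= k a l)%N & h ^+ 12 <= (k a l)%:R]) rt (k a l) ^+ 5
    <= 240 * D0 * p2 (2 * a%:R) / h ^+ 3.
Proof.
move=> h0; apply: le_trans (sum_poor_five_halves _ h0) _.
have -> // : p2 (2 * a%:R) = 4 ^+ a by rewrite -p2_sqr p2_nat expr2 -exprMn -natrM.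
Qed.

Definition K32 b a : R := \sum_(x | lev x == b) \sum_e
  (~~ rich a (e, key e x))%:R * rt (kn a e x) ^+ 3.

(** The scheme of [K2_le] with 3 / 2 in place of 2: the total degree in the point counts of a line
    is 5 / 2, below the critical 3, so the number of levels does not enter. *)
Lemma K32_le a b : (b <= a)%N -> K32 b a <= 800 * D0 * p2 (3 / 2 * a%:R + b%:R / 2).
Proof.
move=> ba; have baR : b%:R <= a%:R :> R by rewrite ler_nat.
have D00 := D0_ge0; have D1 := D0_ge1.
pose u l : R := (k b l)%:R; pose v l : R := (k a l)%:R.
have u0 l : 0 <= u l by []. have v0 l : 0 <= v l by [].
pose x := p2 (3 / 2 * a%:R + b%:R / 2).
pose t := p2 ((a%:R - b%:R) / 2); pose s := p2 (- ((a%:R - b%:R) / 2)).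
have st : s * t = 1 by rewrite /s /t -p2D addNr p2_0.
pose t' := p2 ((a%:R - b%:R) / 4); pose s' := p2 (- ((a%:R - b%:R) / 4)).
have st' : s' * t' = 1 by rewrite /s' /t' -p2D addNr p2_0.
have t0 : 0 < t by apply: p2_gt0. have t'0 : 0 < t' by apply: p2_gt0.
have step1 : K32 b a <= \sum_(x | lev x == b) \sum_e (kn a e x)%:R
   + \sum_l u l * ((~~ rich a l && (2 <= k a l)%N)%:R * rt (k a l) ^+ 3).
  rewrite -(sum_flags b (fun l => (~~ rich a l && (2 <= k a l)%N)%:R * rt (k a l) ^+ 3)).
  rewrite /K32 -big_split /=; apply: ler_sum => y _.
  rewrite -big_split /=; apply: ler_sum => e _.
  case: (rich a _) => /=; first by rewrite !mul0r addr0.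
  rewrite mul1r; have knk := kn_le a e y; case: leqP => k2 /=.
    rewrite mul0r addr0; have : (kn a e y <= 1)%N := leq_trans knk k2.
    case: (kn a e y) => [|[|//]] _; rewrite /rt ?sqrtr0 ?sqrtr1 ?expr1n //.
    by rewrite expr0n.
  rewrite mul1r -[X in X <= _]add0r lerD // lerXn2r ?nnegrE ?rt_ge0 ?rt_le //.
have step2 l : u l * ((~~ rich a l && (2 <= k a l)%N)%:R * rt (k a l) ^+ 3) <=
   (rich b l)%:R * u l * (4 * p2 a%:R)
   + t * ((2 <= k a l)%N%:R * (u l * v l))
   + (s ^+ 2 + s' ^+ 2) * ((~~ rich a l && (2 <= k a l)%N)%:R * rt (k a l) ^+ 5)
   + t' ^+ 3 * ((~~ rich b l && (2 <= k b l)%N)%:R * rt (k b l) ^+ 5).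
  have ra5 : 0 <= rt (k a l) ^+ 5 by rewrite exprn_ge0 ?rt_ge0.
  have rb5 : 0 <= rt (k b l) ^+ 5 by rewrite exprn_ge0 ?rt_ge0.
  have q1 : 0 <= (rich b l)%:R * u l * (4 * p2 a%:R) by rewrite !mulr_ge0 ?p2_ge0.
  have q2 : 0 <= t * ((2 <= k a l)%N%:R * (u l * v l)).
    by apply: mulr_ge0; [exact: ltW | apply: mulr_ge0 => //; apply: mulr_ge0].
  have q3 : 0 <= t' ^+ 3 * ((~~ rich b l && (2 <= k b l)%N)%:R * rt (k b l) ^+ 5).
    by apply: mulr_ge0; [apply: exprn_ge0; exact: ltW | exact: mulr_ge0].
  case: (boolP (rich a l)) => pa /=.
    by rewrite !mul0r !mulr0 addr0 !addr_ge0.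
  case: (leqP 2 (k a l)) q2 => k2 q2 /=; last first.
    by rewrite !mul0r !mulr0 !addr0 !addr_ge0.
  rewrite !mul1r; rewrite mul1r in q2.
  have sa : 0 <= s ^+ 2 * rt (k a l) ^+ 5 by rewrite mulr_ge0 ?sqr_ge0.
  have sa' : 0 <= s' ^+ 2 * rt (k a l) ^+ 5 by rewrite mulr_ge0 ?sqr_ge0.
  case: (boolP (rich b l)) q1 q3 => pb /= q1 q3.
    have : rt (k a l) ^+ 3 <= 4 * p2 a%:R.
      apply: le_trans (_ : v l ^+ 2 <= _).
        rewrite /v -rt_sqr -exprM; apply: ler_weXn2l => //.
        by rewrite -[1]sqrtr1 ler_wsqrtr // ler1n ltnW.
      apply: le_trans (_ : (2 * p2 (a%:R / 2)) ^+ 2 <= _).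
        by rewrite lerXn2r ?nnegrE ?mulr_ge0 ?p2_ge0 // k_poor.
      by rewrite exprMn p2_sqr (_ : 2 * (a%:R / 2) = a%:R); [lra | field].
    by move=> /(ler_wpM2l (u0 l)); move: sa sa' q2 q3; lra.
  case: (leqP 2 (k b l)) q3 => k2b /= q3.
    have := young_mixed (rt_ge0 (k b l)) (rt_ge0 (k a l)) t'0 st'.
    by rewrite rt_sqr -/(u l); move: sa q2; lra.
  have u1 : u l <= 1 by rewrite /u -[1]/(1%:R) ler_nat.
  have := ler_wpM2l (u0 l) (young_sqrt_cube (rt_ge0 (k a l)) t0 st).
  have := ler_wpM2r sa u1; rewrite rt_sqr -/(v l); move: sa'; lra.
have mk (P : pred (E * K)) (F : E * K -> R) : \sum_l (P l)%:R * F l = \sum_(l | P l) F l.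
  by rewrite [RHS]big_mkcond /=; apply: eq_bigr => l _; case: ifP; rewrite ?mul1r ?mul0r.
have five j : \sum_(l | ~~ rich j l && (2 <= k j l)%N) rt (k j l) ^+ 5 <= 240 * D0 * p2 (2 * j%:R).
  have := @sum_poor_rt j 1 ltr01; rewrite !expr1n divr1; apply: le_trans.
  apply: ler_sum_set => [l /andP[-> k2]|l _]; last by rewrite exprn_ge0 ?rt_ge0.
  by rewrite k2 ler1n ltnW.
have AB : p2 a%:R * p2 b%:R <= x by rewrite -p2D p2_le //; lra.
have h1 : \sum_(x | lev x == b) \sum_e (kn a e x)%:R <= x.
  by apply: le_trans AB; rewrite mulrC !p2_nat sum_kn_flags.
have h2 : \sum_l (rich b l)%:R * u l * (4 * p2 a%:R) <= 8 * x.
  rewrite -mulr_suml mk.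
  have := ler_wpM2r (mulr_ge0 (ler0n R 4) (p2_ge0 a%:R)) (sum_rich_p2 b).
  by move: AB; lra.
have h3 : t * \sum_(l | (2 <= k a l)%N) u l * v l <= 2 * x.
  apply: le_trans (ler_wpM2l (ltW t0) (sum_k_flags b a)) _.
  have -> : t * (2 * p2 b%:R * p2 a%:R) = 2 * (t * p2 b%:R * p2 a%:R) by ring.
  by rewrite ler_wpM2l // /t -!p2D p2_le //; lra.
have h4 : (s ^+ 2 + s' ^+ 2) * (240 * D0 * p2 (2 * a%:R)) <= 480 * D0 * x.
  have -> : (s ^+ 2 + s' ^+ 2) * (240 * D0 * p2 (2 * a%:R))
    = 240 * D0 * (s ^+ 2 * p2 (2 * a%:R) + s' ^+ 2 * p2 (2 * a%:R)) by ring.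
  rewrite (_ : 480 * D0 * x = 240 * D0 * (x + x)); last by ring.
  apply: ler_wpM2l; first by rewrite mulr_ge0.
  by rewrite /s /s' !p2_sqr -!p2D lerD // p2_le //; lra.
have h5 : t' ^+ 3 * (240 * D0 * p2 (2 * b%:R)) <= 240 * D0 * x.
  rewrite mulrCA; apply: ler_wpM2l; first by rewrite mulr_ge0.
  by rewrite exprS p2_sqr -!p2D p2_le //; lra.
apply: le_trans step1 _; apply: (le_trans (lerD h1 (ler_sum _ (fun l _ => step2 l)))).
rewrite !big_split /= -!mulr_sumr !mk -/x.
have x0 : 0 <= x by apply: p2_ge0.
have Dx : x <= D0 * x by rewrite ler_peMl.
have g1 := ler_wpM2l (addr_ge0 (sqr_ge0 s) (sqr_ge0 s')) (five a).
have g2 := ler_wpM2l (exprn_ge0 3 (ltW t'0)) (five b).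
by move: h2; rewrite -mulr_suml; lra.
Qed.

(** * Rectangles weighted by the inverse of a side length *)

(* [w e c c'] stands for the inverse lattice distance of the lines [c], [c'] orthogonal to [e]. *)
Variable w : E -> K -> K -> R.
Hypothesis w_ge0 : forall e c c', 0 <= w e c c'.
Hypothesis w_sym : forall e c c', w e c c' = w e c' c.
Hypothesis w_le1 : forall e x y, x != y -> key e x = key e y ->
  w e (key (perp e) x) (key (perp e) y) <= 1.
Hypothesis w_sum : forall e x (P : pred T),
  (forall y, P y -> (y != x) && (key e y == key e x)) ->
  \sum_(y | P y) w e (key (perp e) x) (key (perp e) y) <= 2 * Num.sqrt #|P|%:R.

Definition kp e x := key (perp e) x.
(** Pairs with two special ends are left out: a rectangle with at most one special vertex has no
    such side, and for the remaining pairs one end always gives a poor line. *)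
Definition pairok a b e x y := [&& lev x == a, lev y == b, x != y, key e x == key e y
  & ~~ (special x e && special y e)].
Definition group : finType := (E * (K * K))%type.
(* A group [(e, (c1, c2))] collects the pairs spanning the same side direction [e] between the
   same two perpendiculars; two pairs of one group are opposite sides of a rectangle. *)
Definition np a b (g : group) : nat := #|[set z : T * T |
  [&& pairok a b g.1 z.1 z.2, kp g.1 z.1 == g.2.1 & kp g.1 z.2 == g.2.2]]|.
Definition grp e x y : group := (e, (kp e x, kp e y)).
Definition wg (g : group) := w g.1 g.2.1 g.2.2.

Lemma sum_groups a b (F : group -> R) : \sum_g (np a b g)%:R * F g
  = \sum_e \sum_(z : T * T) (pairok a b e z.1 z.2)%:R * F (grp e z.1 z.2).
Proof.
rewrite (eq_bigr (fun g : group => (np a b (g.1, g.2))%:R * F (g.1, g.2))); last by case.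
rewrite -(pair_bigA _ (fun e c => (np a b (e, c))%:R * F (e, c))) /=.
apply: eq_bigr => e _.
transitivity (\sum_c \sum_(z : T * T) (pairok a b e z.1 z.2 &&
    ((kp e z.1, kp e z.2) == c))%:R * F (e, c)).
  apply: eq_bigr => c _; rewrite -mulr_suml; congr (_ * _).
  rewrite /np -sum1_card natr_sum big_mkcond /=; apply: eq_bigr => z _.
  by rewrite inE /=; case: c => c1 c2; rewrite xpair_eqE; case: ifP.
rewrite exchange_big /=; apply: eq_bigr => z _.
rewrite (bigD1 (kp e z.1, kp e z.2)) //= eqxx andbT big1 ?addr0 // => c.
by rewrite eq_sym => /negbTE ->; rewrite andbF mul0r.
Qed.

(** Within a group a pair is fixed by its first point, which runs over one perpendicular line. *)
Lemma np_le_l a b g : (np a b g <= k a (perp g.1, g.2.1))%N.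
Proof.
rewrite /np /k -(card_in_imset (f := fst)).
  apply: subset_leq_card; apply/fintype.subsetP => _ /imsetP[z + ->].
  by rewrite !inE /on /= => /and3P[/and5P[-> _ _ _ _] /eqP h _]; rewrite /kp in h; rewrite h eqxx.
move=> [x y] [x' y']; rewrite !inE /= => /and3P[/and5P[_ _ _ /eqP h1 _] /eqP h2 /eqP h3].
case/and3P=> /and5P[_ _ _ /eqP h1' _] /eqP h2' /eqP h3' xx; subst x'.
by congr pair; apply: (@meet_perp g.1); [rewrite -h1 -h1' | rewrite -/(kp _ _) h3 -h3'].
Qed.

Lemma np_le_r a b g : (np a b g <= k b (perp g.1, g.2.2))%N.
Proof.
rewrite /np /k -(card_in_imset (f := snd)).
  apply: subset_leq_card; apply/fintype.subsetP => _ /imsetP[z + ->].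
  by rewrite !inE /on /= => /and3P[/and5P[_ -> _ _ _] _ /eqP h]; rewrite /kp in h; rewrite h eqxx.
move=> [x y] [x' y']; rewrite !inE /= => /and3P[/and5P[_ _ _ /eqP h1 _] /eqP h2 /eqP h3].
case/and3P=> /and5P[_ _ _ /eqP h1' _] /eqP h2' /eqP h3' xx; subst y'.
by congr pair; apply: (@meet_perp g.1); [rewrite h1 h1' | rewrite -/(kp _ _) h2 -h2'].
Qed.

(** Over the pairs of a group with n members and weight w this adds up to w n^2 + n^(3/2), the mass
    of the group; the threshold [h] keeps large groups only. *)
Definition heavy a b (h : R) e x y : R :=
  (pairok a b e x y && (h <= (np a b (grp e x y))%:R))%:R
  * (wg (grp e x y) * (np a b (grp e x y))%:R + rt (np a b (grp e x y))).

Lemma heavy_ge0 a b h e x y : 0 <= heavy a b h e x y.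
Proof. by rewrite mulr_ge0 // addr_ge0 ?rt_ge0 // mulr_ge0 // w_ge0. Qed.

(** By [w_sum] the weights of the companions add up to the square root of their number: this is the
    half power gained over the unweighted case. *)
Lemma sum_heavy_le a b h e y (kappa : R) : 0 <= kappa ->
  (forall x, pairok a b e x y -> (np a b (grp e x y))%:R <= kappa) ->
  \sum_x heavy a b h e x y <= (h <= kappa)%R%:R *
     (kappa * (2 * rt (kn a e y)) + Num.sqrt kappa * (kn a e y)%:R).
Proof.
move=> k0 kle; case: (lerP h kappa) => hk /=; last first.
  rewrite mul0r big1 // => x _; rewrite /heavy.
  case: (boolP (pairok a b e x y)) => ok; last by rewrite mul0r.
  by rewrite (_ : (_ <= _) = false) ?mul0r //; apply/negbTE; rewrite -ltNge (le_lt_trans (kle _ ok)).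
rewrite mul1r.
pose P x := [&& lev x == a, x != y & key e x == key e y].
apply: le_trans (_ : \sum_(x | P x) (kappa * w e (kp e y) (kp e x) + Num.sqrt kappa * 1) <= _).
  rewrite [X in _ <= X]big_mkcond /=; apply: ler_sum => x _; rewrite /heavy.
  case: (boolP (pairok a b e x y)) => ok /=; last first.
    rewrite mul0r; case: ifP => // _; rewrite addr_ge0 ?mulr_ge0 ?sqrtr_ge0 ?w_ge0 //.
  have Px : P x by case/and5P: ok => h1 _ h2 h3 _; rewrite /P h1 h2.
  rewrite Px mulr1; case: (h <= _)%R; rewrite /= ?mul0r ?mul1r.
    rewrite lerD ?ler_wsqrtr ?kle // mulrC; apply: ler_pM; rewrite ?w_ge0 ?kle //.
    by rewrite /wg /= w_sym.
  by rewrite addr_ge0 ?mulr_ge0 ?sqrtr_ge0 ?w_ge0.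
have cP : #|P| = kn a e y by rewrite /kn; apply: eq_card => x; rewrite !inE.
rewrite big_split /= -!mulr_sumr lerD //.
  apply: ler_wpM2l => //; rewrite /rt -cP; apply: w_sum => x /and3P[_ -> ->] //.
by rewrite sumr_const -cP.
Qed.

(** If poor lines of level c can reach the threshold [p2 t ^+ 12], then c >= 24 t - 2, so that
    2^(-c/4) is more than enough gain. *)
Lemma le_p2_quarter (t c : R) : 0 <= t -> p2 t ^+ 12 <= 2 * p2 (c / 2) ->
  p2 (- (c / 4)) <= 2 * p2 (- t).
Proof.
move=> t0 h.
have h6 : p2 t ^+ 6 <= 2 * p2 (c / 4).
  rewrite -(@ler_pXn2r _ 2) ?nnegrE ?exprn_ge0 ?mulr_ge0 ?p2_ge0 //.
  rewrite -exprM; apply: le_trans h _; rewrite exprMn p2_sqr (_ : 2 * (c / 4) = c / 2); last by field.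
  by rewrite ler_wpM2r ?p2_ge0 //; lra.
have h1 : p2 t <= 2 * p2 (c / 4).
  by apply: le_trans h6; rewrite -[X in X <= _]expr1 ler_weXn2l // p2_ge1.
have := ler_wpM2r (mulr_ge0 (p2_ge0 (- (c / 4))) (p2_ge0 (- t))) h1.
have e1 : p2 t * (p2 (- (c / 4)) * p2 (- t)) = p2 (- (c / 4)).
  by rewrite -!p2D; congr p2; ring.
have e2 : 2 * p2 (c / 4) * (p2 (- (c / 4)) * p2 (- t)) = 2 * p2 (- t).
  by rewrite -mulrA -!p2D; congr (_ * p2 _); ring.
by rewrite e1 e2.
Qed.

Lemma sqrt_2p2 (c : R) : Num.sqrt (2 * p2 (c / 2)) <= 3 / 2 * p2 (c / 4).
Proof.
rewrite -(@ler_pXn2r _ 2) ?nnegrE ?mulr_ge0 ?p2_ge0 ?sqrtr_ge0 //; last by lra.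
rewrite sqr_sqrtr ?mulr_ge0 ?p2_ge0 // exprMn p2_sqr (_ : 2 * (c / 4) = c / 2); last by field.
by rewrite ler_wpM2r ?p2_ge0 //; lra.
Qed.

(** The condition [1 <= t] puts both mixed products under the same bound. *)
Lemma young_pair (t s x y : R) : 0 <= x -> 0 <= y -> 1 <= t -> s * t = 1 ->
  x ^+ 2 * y <= t ^+ 2 * x ^+ 3 + s * y ^+ 3 /\ x * y ^+ 2 <= t ^+ 2 * x ^+ 3 + s * y ^+ 3.
Proof.
move=> x0 y0 t1 st; have t0 : 0 < t by apply: lt_le_trans t1.
have s0 : 0 < s by rewrite -(pmulr_lgt0 _ t0) st.
have s1 : s <= 1 by rewrite -st ler_peMr // ltW.
have x3 : 0 <= x ^+ 3 by rewrite exprn_ge0.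
have y3 : 0 <= y ^+ 3 by rewrite exprn_ge0.
have q1 : 0 <= t ^+ 2 * x ^+ 3 by rewrite mulr_ge0 ?sqr_ge0.
have q2 : 0 <= s * y ^+ 3 by rewrite mulr_ge0 // ltW.
have [h|h] := leP y (t * x).
  split.
    have h1 := ler_wpM2l (sqr_ge0 x) h.
    have h2 : t * x ^+ 3 <= t ^+ 2 * x ^+ 3.
      by rewrite ler_wpM2r // expr2 ler_peMl // ltW.
    by move: h1; rewrite (_ : x ^+ 2 * (t * x) = t * x ^+ 3); [lra | ring].
  have : y ^+ 2 <= (t * x) ^+ 2 by apply: lerXn2r => //; rewrite nnegrE // mulr_ge0 // ltW.
  by move=> /(ler_wpM2l x0); rewrite (_ : x * (t * x) ^+ 2 = t ^+ 2 * x ^+ 3); [lra | ring].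
have hx : x <= s * y by move: h => /ltW /(ler_wpM2l (ltW s0)); rewrite mulrA st mul1r.
split.
  have : x ^+ 2 <= (s * y) ^+ 2 by apply: lerXn2r => //; rewrite nnegrE // mulr_ge0 // ltW.
  move=> /(ler_wpM2r y0); rewrite (_ : (s * y) ^+ 2 * y = s ^+ 2 * y ^+ 3); [move=> h1 | ring].
  have : s ^+ 2 * y ^+ 3 <= s * y ^+ 3 by rewrite ler_wpM2r // expr2 ler_piMr // ltW.
  by lra.
by have := ler_wpM2r (sqr_ge0 y) hx; rewrite (_ : s * y * y ^+ 2 = s * y ^+ 3); [lra | ring].
Qed.

(** In the first term neither the side nor the perpendicular through [y] is rich. In the second the
    side is rich for [a], which makes every [x] on it special and hence [y] not; in the third the
    perpendicular is rich for [b], which makes [y] special and hence [x] not. The end that is not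
    special then bounds the size of the group by that of a poor line. *)
Lemma flag_heavy a b (t : R) e y : (b <= a)%N -> lev y = b ->
  let h := p2 t ^+ 12 in let m2 := (perp e, kp e y) in let hh := (e, key e y) in
  is_true (\sum_x heavy a b h e x y <=
     ([&& ~~ rich b m2, (h <= (k b m2)%:R)%R & ~~ rich a hh])%:R *
        ((k b m2)%:R * (2 * rt (kn a e y)) + rt (k b m2) * (kn a e y)%:R)
   + (h <= 2 * p2 (b%:R / 2))%R%:R *
        ((rich a hh && ~~ rich b hh)%:R * (k a hh)%:R * (6 * p2 (b%:R / 4)))
   + (h <= 2 * p2 (a%:R / 2))%R%:R * ((rich b m2)%:R * (9 * p2 (3 / 4 * a%:R)))).
Proof.
move=> ba yb h m2 hh; have baR : b%:R <= a%:R :> R by rewrite ler_nat.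
have S0 x : 0 <= heavy a b h e x y by apply: heavy_ge0.
set B1 := (X in _ <= X + _ + _); set B2 := (X in _ <= _ + X + _); set B3 := (X in _ <= _ + X).
have B10 : 0 <= B1 by rewrite /B1 mulr_ge0 // addr_ge0 ?mulr_ge0 ?rt_ge0.
have B20 : 0 <= B2 by rewrite /B2 !mulr_ge0 ?p2_ge0.
have B30 : 0 <= B3 by rewrite /B3 !mulr_ge0 ?p2_ge0.
have none : (forall x, ~~ pairok a b e x y) -> \sum_x heavy a b h e x y <= B1 + B2 + B3.
  move=> hn; rewrite big1 ?addr_ge0 // => x _.
  by rewrite /heavy (negbTE (hn x)) mul0r.
have okE x : pairok a b e x y -> [/\ lev x = a, key e x = key e y
    & ~~ (special x e && special y e)].
  by case/and5P=> /eqP ? _ _ /eqP ? ?.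
have knk : (kn a e y <= k a hh)%N by apply: kn_le.
case: (boolP (rich b m2)) => rb.
  have sy : special y e by rewrite /special yb -/m2 rb orbT.
  case: (boolP (rich a hh)) => ra.
    apply: none => x; apply/negP => /okE[xa kx].
    by rewrite sy /special xa kx -/hh ra.
  apply: le_trans (@sum_heavy_le a b h e y (2 * p2 (a%:R / 2)) _ _) _.
  - by rewrite mulr_ge0 ?p2_ge0.
  - move=> x /okE[xa kx]; rewrite sy andbT /special xa negb_or => /andP[_ nr].
    by apply: le_trans (k_poor nr); rewrite ler_nat np_le_l.
  suff : (h <= 2 * p2 (a%:R / 2))%R%:R * (2 * p2 (a%:R / 2) * (2 * rt (kn a e y))
      + Num.sqrt (2 * p2 (a%:R / 2)) * (kn a e y)%:R) <= B3 by lra.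
  rewrite /B3 rb mul1r; apply: ler_wpM2l => //.
  have kk : (kn a e y)%:R <= 2 * p2 (a%:R / 2) :> R.
    by apply: le_trans (k_poor ra); rewrite ler_nat.
  have rk : rt (kn a e y) <= Num.sqrt (2 * p2 (a%:R / 2)) by rewrite ler_wsqrtr.
  have s0 : 0 <= Num.sqrt (2 * p2 (a%:R / 2)) by apply: sqrtr_ge0.
  have p0 : 0 <= 2 * p2 (a%:R / 2) by rewrite mulr_ge0 ?p2_ge0.
  have h1 := ler_wpM2l p0 rk; have h2 := ler_wpM2l s0 kk.
  have h3 := ler_wpM2l p0 (sqrt_2p2 a%:R).
  have e3 : p2 (a%:R / 2) * p2 (a%:R / 4) = p2 (3 / 4 * a%:R).
    by rewrite -p2D; congr p2; field.
  by rewrite -e3; lra.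
case: (boolP (rich a hh)) => ra.
  case: (boolP (rich b hh)) => rbh.
    apply: none => x; apply/negP => /okE[xa kx].
    by rewrite /special xa kx yb -/hh ra rbh.
  apply: le_trans (@sum_heavy_le a b h e y (2 * p2 (b%:R / 2)) _ _) _.
  - by rewrite mulr_ge0 ?p2_ge0.
  - by move=> x _; apply: le_trans (k_poor rb); rewrite ler_nat np_le_r.
  suff : (h <= 2 * p2 (b%:R / 2))%R%:R * (2 * p2 (b%:R / 2) * (2 * rt (kn a e y))
      + Num.sqrt (2 * p2 (b%:R / 2)) * (kn a e y)%:R) <= B2 by lra.
  rewrite /B2 ra rbh /= mul1r; apply: ler_wpM2l => //.
  have kk : (kn a e y)%:R <= (k a hh)%:R :> R by rewrite ler_nat.
  (* A rich line has more than 2^(a/2) points, so the square root of their number is smaller by at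
     least 2^(-a/4). *)
  have rk : rt (kn a e y) <= (k a hh)%:R * p2 (- (a%:R / 4)).
    apply: le_trans (rt_le knk) _.
    have lo : p2 (a%:R / 4) <= rt (k a hh).
      rewrite -(@ler_pXn2r _ 4) ?nnegrE ?p2_ge0 ?rt_ge0 //.
      rewrite (exprM (rt _) 2 2) rt_sqr (exprM (p2 _) 2 2) !p2_sqr.
      rewrite (_ : 2 * (2 * (a%:R / 4)) = a%:R); last by field.
      rewrite p2_nat -!natrX ler_nat ltnW //; apply: leq_ltn_trans ra.
      by rewrite leq_pmull.
    have := ler_wpM2r (mulr_ge0 (p2_ge0 (- (a%:R / 4))) (rt_ge0 (k a hh))) lo.
    by rewrite mulrA -p2D subrr p2_0 mul1r -(rt_sqr (k a hh)) expr2; lra.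
  have p0 : 0 <= 2 * p2 (b%:R / 2) by rewrite mulr_ge0 ?p2_ge0.
  have h1 := ler_wpM2l p0 rk.
  have h2 := ler_pM (sqrtr_ge0 _) (ler0n R _) (sqrt_2p2 b%:R) kk.
  have h3 : p2 (b%:R / 2) * p2 (- (a%:R / 4)) <= p2 (b%:R / 4).
    by rewrite -p2D p2_le //; lra.
  have h4 := ler_wpM2l (ler0n R (k a hh)) h3.
  have h5 : 0 <= (k a hh)%:R * p2 (b%:R / 4) by rewrite mulr_ge0 ?p2_ge0.
  by lra.
apply: le_trans (@sum_heavy_le a b h e y (k b m2)%:R _ _) _ => //.
  by move=> x _; rewrite ler_nat np_le_r.
by rewrite /B1 rb ra andbT -addrA lerDl addr_ge0.
Qed.

Lemma sum_heavy_total a b (t : R) : (b <= a)%N -> 1 / 12 <= t ->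
  \sum_e \sum_(y | lev y == b) \sum_x heavy a b (p2 t ^+ 12) e x y
    <= 3300 * D0 * p2 (a%:R + b%:R - t).
Proof.
move=> ba t12; have baR : b%:R <= a%:R :> R by rewrite ler_nat.
have D1 := D0_ge1; have D00 := D0_ge0.
have t0 : 0 <= t by lra.
set h := p2 t ^+ 12; pose z := p2 (a%:R + b%:R - t).
have z0 : 0 <= z by apply: p2_ge0.
(* The part (a - b) / 2 balances the levels. The part [t] gives back two thirds of the gain
   [p2 t ^- 3] of [sum_poor_rt], so that the other term, which has no threshold, gains [p2 (- t)]
   through [v]. *)
pose u := p2 ((a%:R - b%:R) / 2 + t); pose v := p2 (- ((a%:R - b%:R) / 2 + t)).
have vu : v * u = 1 by rewrite /v /u -p2D addNr p2_0.
have u1 : 1 <= u by apply: p2_ge1; lra.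
have v0 : 0 <= v by apply: p2_ge0.
pose F1 (l : E * K) : R := (~~ rich b l && (h <= (k b l)%:R)%R)%:R * rt (k b l) ^+ 3.
pose F2 e y : R := (~~ rich a (e, key e y))%:R * rt (kn a e y) ^+ 3.
pose F3 (l : E * K) : R := (rich a l && ~~ rich b l)%:R * (k a l)%:R.
pose F4 (l : E * K) : R := (rich b l)%:R.
pose c3 : R := (h <= 2 * p2 (b%:R / 2))%R%:R * (6 * p2 (b%:R / 4)).
pose c4 : R := (h <= 2 * p2 (a%:R / 2))%R%:R * (9 * p2 (3 / 4 * a%:R)).
apply: le_trans (_ : \sum_(y | lev y == b) \sum_e
   (3 * u ^+ 2 * F1 (perp e, kp e y) + 3 * v * F2 e y + c3 * F3 (e, key e y)
    + c4 * F4 (perp e, kp e y)) <= _).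
  rewrite exchange_big /=; apply: ler_sum => y /eqP yb; apply: ler_sum => e _.
  apply: le_trans (@flag_heavy a b t e y ba yb) _; rewrite -/h.
  rewrite /c3 /c4 /F3 /F4; set m2 := (perp e, kp e y); set hh := (e, key e y).
  rewrite lerD // ?lerD //; last by rewrite mulrCA mulrA mulrC mulrA [X in _ <= X]mulrC; lra.
    rewrite /F1 /F2 -/m2 -/hh.
    have q1 : 0 <= rt (k b m2) ^+ 3 by rewrite exprn_ge0 ?rt_ge0.
    have q2 : 0 <= rt (kn a e y) ^+ 3 by rewrite exprn_ge0 ?rt_ge0.
    have Y1 : 0 <= 3 * u ^+ 2 * rt (k b m2) ^+ 3 by rewrite mulr_ge0 // mulr_ge0 ?sqr_ge0.
    have Y2 : 0 <= 3 * v * rt (kn a e y) ^+ 3 by rewrite mulr_ge0 // mulr_ge0.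
    case: (rich b m2); case: (rich a hh); case: (h <= _)%R;
      rewrite /= ?mul0r ?mul1r ?mulr0 ?addr0 ?add0r //; rewrite ?addr_ge0 //.
    have [y1 y2] := young_pair (rt_ge0 (k b m2)) (rt_ge0 (kn a e y)) u1 vu.
    by move: y1 y2; rewrite !rt_sqr; lra.
  by rewrite !mulrA; lra.
under eq_bigr do rewrite !big_split /= -!mulr_sumr.
rewrite !big_split /= -!mulr_sumr.
have s1 : \sum_(y | lev y == b) \sum_e F1 (perp e, kp e y) <= 240 * D0 * p2 (2 * b%:R) / p2 t ^+ 3.
  under eq_bigr => y _ do rewrite (sum_perp (fun e => F1 (e, key e y))).
  rewrite sum_flags; apply: le_trans (sum_poor_rt b (p2_gt0 t)).
  rewrite [X in _ <= X]big_mkcond /=; apply: ler_sum => l _; rewrite /F1 -/h.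
  case: (rich b l) => /=; first by rewrite mul0r mulr0.
  case: (lerP h (k b l)%:R) => hk /=; last by rewrite mul0r mulr0 andbF.
  (* The condition [1 / 12 <= t] makes the threshold at least 2. *)
  have -> : (2 <= k b l)%N.
    rewrite -(ler_nat R); apply: le_trans hk; rewrite /h /p2 -powR_mulrn ?powR_ge0 // -powRrM.
    by rewrite -[X in X <= _]powRr1 // ler_powR ?ler1n //; lra.
  by rewrite mul1r -[(k b l)%:R]rt_sqr -exprD.
have s2 : \sum_(y | lev y == b) \sum_e F2 e y <= 800 * D0 * p2 (3 / 2 * a%:R + b%:R / 2).
  exact: K32_le.
have s3 : \sum_(y | lev y == b) \sum_e F3 (e, key e y) <= 2 * p2 (b%:R / 2) * (2 * p2 a%:R).
  rewrite sum_flags.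
  have pb : 0 <= 2 * p2 (b%:R / 2) by rewrite mulr_ge0 ?p2_ge0.
  apply: le_trans (ler_wpM2l pb (sum_rich_p2 a)); rewrite mulr_sumr [X in _ <= X]big_mkcond /=.
  apply: ler_sum => l _; rewrite /F3; case: (rich a l) => /=; last by rewrite mul0r mulr0.
  case: (boolP (rich b l)) => rb /=; first by rewrite mul0r mulr0 !mulr_ge0 ?p2_ge0.
  by rewrite mul1r ler_wpM2r // k_poor.
have s4 : \sum_(y | lev y == b) \sum_e F4 (perp e, kp e y) <= 2 * p2 b%:R.
  under eq_bigr => y _ do rewrite (sum_perp (fun e => F4 (e, key e y))).
  rewrite sum_flags; apply: le_trans (sum_rich_p2 b).
  rewrite [X in _ <= X]big_mkcond /=; apply: ler_sum => l _; rewrite /F4.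
  by case: (rich b l); rewrite ?mulr1 ?mulr0.
have r1 : 3 * u ^+ 2 * (240 * D0 * p2 (2 * b%:R) / p2 t ^+ 3) = 720 * D0 * z.
  have -> : z = u ^+ 2 * p2 (2 * b%:R) / p2 t ^+ 3.
    by rewrite /z /u [p2 t ^+ 3]exprS !p2_sqr -!p2D -p2N -p2D; congr p2; field.
  ring.
have r2 : 3 * v * (800 * D0 * p2 (3 / 2 * a%:R + b%:R / 2)) = 2400 * D0 * z.
  have -> : z = v * p2 (3 / 2 * a%:R + b%:R / 2).
    by rewrite /z /v -!p2D; congr p2; field.
  ring.
have r3 : c3 * (2 * p2 (b%:R / 2) * (2 * p2 a%:R)) <= 48 * z.
  rewrite /c3; case: (lerP h _) => hb; last by rewrite !mul0r mulr_ge0.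
  have := le_p2_quarter t0 hb; rewrite mul1r => q.
  have e1 : p2 (b%:R / 4) * p2 (b%:R / 2) * p2 a%:R = p2 (a%:R + b%:R) * p2 (- (b%:R / 4)).
    by rewrite -!p2D; congr p2; field.
  have := ler_wpM2l (p2_ge0 (a%:R + b%:R)) q.
  have -> : p2 (a%:R + b%:R) * (2 * p2 (- t)) = 2 * z by rewrite mulrCA -p2D.
  by rewrite -e1; lra.
have r4 : c4 * (2 * p2 b%:R) <= 36 * z.
  rewrite /c4; case: (lerP h _) => hb; last by rewrite !mul0r mulr_ge0.
  have := le_p2_quarter t0 hb; rewrite mul1r => q.
  have e1 : p2 (3 / 4 * a%:R) * p2 b%:R = p2 (a%:R + b%:R) * p2 (- (a%:R / 4)).
    by rewrite -!p2D; congr p2; field.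
  have := ler_wpM2l (p2_ge0 (a%:R + b%:R)) q.
  have -> : p2 (a%:R + b%:R) * (2 * p2 (- t)) = 2 * z by rewrite mulrCA -p2D.
  by rewrite -e1; lra.
have u20 : 0 <= 3 * u ^+ 2 by rewrite mulr_ge0 ?sqr_ge0.
have v30 : 0 <= 3 * v by rewrite mulr_ge0.
have c30 : 0 <= c3 by rewrite /c3 !mulr_ge0 ?p2_ge0.
have c40 : 0 <= c4 by rewrite /c4 !mulr_ge0 ?p2_ge0.
have k1 := ler_wpM2l u20 s1; have k2 := ler_wpM2l v30 s2.
have k3 := ler_wpM2l c30 s3; have k4 := ler_wpM2l c40 s4.
have Dz : z <= D0 * z by rewrite ler_peMl.
by move: k1 k2; rewrite r1 r2 -/z; lra.
Qed.

Lemma pairok_sym a b e x y : pairok a b e x y = pairok b a e y x.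
Proof.
rewrite /pairok [y == x]eq_sym [key e y == _]eq_sym [special y e && _]andbC.
by case: (lev x == a); case: (lev y == b); rewrite ?andbF.
Qed.

Definition flipg (g : group) : group := (g.1, (g.2.2, g.2.1)).

Lemma np_flip a b g : np a b (flipg g) = np b a g.
Proof.
pose sw (z : T * T) := (z.2, z.1).
have swK : cancel sw sw by case.
rewrite /np -(card_imset _ (can_inj swK)); apply: eq_card => z.
apply/imsetP/idP => [[z' + ->]|hz].
  by rewrite !inE /= pairok_sym andbCA andbC -andbA => /and3P[-> -> ->].
exists (sw z); last by rewrite swK.
by move: hz; rewrite !inE /= pairok_sym => /and3P[-> -> ->].
Qed.

Lemma sum_heavy_groups a b t : 1 / 12 <= t ->
  \sum_g ((p2 t ^+ 12 <= (np a b g)%:R)%R)%:R * (wg g * (np a b g)%:R ^+ 2 + rt (np a b g) ^+ 3)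
    <= 3300 * D0 * p2 (a%:R + b%:R - t).
Proof.
move=> t12; wlog ba : a b / (b <= a)%N => [hw|].
  case: (leqP b a) => [/hw //|/ltnW /hw h].
  rewrite [a%:R + _]addrC; apply: le_trans h.
  have flipK : involutive flipg by case=> ? [].
  rewrite (reindex_inj (inv_inj flipK)) /=; apply: ler_sum => g _.
  by rewrite np_flip /wg /= w_sym.
apply: le_trans (sum_heavy_total ba t12).
set h := p2 t ^+ 12.
rewrite (eq_bigr (fun g => (np a b g)%:R * (((h <= (np a b g)%:R)%R)%:R
   * (wg g * (np a b g)%:R + rt (np a b g))))); last first.
  by move=> g _; rewrite -[(np a b g)%:R in LHS]rt_sqr -[(np a b g)%:R in RHS]rt_sqr; ring.
rewrite sum_groups; apply: ler_sum => e _.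
rewrite -(pair_bigA _ (fun x y => (pairok a b e x y)%:R * (((h <= (np a b (grp e x y))%:R)%R)%:R
   * (wg (grp e x y) * (np a b (grp e x y))%:R + rt (np a b (grp e x y)))))) /=.
rewrite exchange_big /= [X in _ <= X]big_mkcond /=; apply: ler_sum => y _.
case: (boolP (lev y == b)) => yb; last first.
  by rewrite big1 // => x _; rewrite /pairok (negbTE yb) andbF mul0r.
by apply: ler_sum => x _; rewrite /heavy -mulnb natrM mulrA.
Qed.

Lemma wg_le1 a b g : (0 < np a b g)%N -> wg g <= 1.
Proof.
rewrite /np card_gt0 => /set0Pn[z]; rewrite inE.
by case/and3P=> /and5P[_ _ xy /eqP kxy _] /eqP h1 /eqP h2; rewrite /wg -h1 -h2; apply: w_le1.
Qed.

Lemma sum_np a b : \sum_g (np a b g)%:R <= p2 (a%:R + b%:R).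
Proof.
rewrite (eq_bigr (fun g => (np a b g)%:R * (fun=> 1) g)); last by move=> g _; rewrite mulr1.
rewrite sum_groups.
have := sum_kn_flags a b; rewrite -!p2_nat -p2D addrC; apply: le_trans.
rewrite [X in _ <= X]exchange_big /=; apply: ler_sum => e _.
rewrite -(pair_bigA _ (fun x y => (pairok a b e x y)%:R * 1)) exchange_big /=.
rewrite [X in _ <= X]big_mkcond /=; apply: ler_sum => y _.
case: (boolP (lev y == b)) => yb; last first.
  by rewrite big1 // => x _; rewrite /pairok (negbTE yb) andbF mul0r.
rewrite knE big_mkcond /= [X in _ <= X]big_mkcond /=; apply: ler_sum => x _.
rewrite mulr1 /pairok; case: (lev x == a) => //=; case: (lev y == b) => //.
by case: (x != y) => //=; case: (key e x == key e y) => //=; case: (_ && _).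
Qed.

(** At t = 1 / 12 the threshold is exactly 2, and a group with a single pair contributes at most 2
    because its weight is at most 1. *)
Lemma sum_groups_all a b :
  \sum_g (wg g * (np a b g)%:R ^+ 2 + rt (np a b g) ^+ 3) <= 3400 * D0 * p2 (a%:R + b%:R).
Proof.
have D1 := D0_ge1; have D00 := D0_ge0.
have h := sum_heavy_groups a b (lexx (1 / 12)).
have z0 := p2_ge0 (a%:R + b%:R).
have h2 : p2 (1 / 12) ^+ 12 = 2.
  by rewrite /p2 -powR_mulrn ?powR_ge0 // -powRrM (_ : 1 / 12 * 12 = 1) ?powRr1 //; field.
rewrite h2 in h.
apply: le_trans (_ : \sum_g (2 * (np a b g)%:R) + 3300 * D0 * p2 (a%:R + b%:R - 1 / 12) <= _).
  apply: le_trans (lerD (lexx _) h); rewrite -big_split /=; apply: ler_sum => g _.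
  have [n1|n2] := leqP (np a b g) 1.
    rewrite (_ : (2 <= (np a b g)%:R)%R = false) ?mul0r ?addr0; last first.
      by apply/negbTE; rewrite -ltNge ltr_nat.
    case: (posnP (np a b g)) => [->|n0]; first by rewrite /rt sqrtr0 !expr0n /= !mulr0 addr0.
    have -> : np a b g = 1%N by apply/eqP; rewrite eqn_leq n1.
    by rewrite /rt sqrtr1 !expr1n !mulr1 (_ : 2 = 1 + 1) // lerD ?(wg_le1 n0).
  by rewrite ler_nat n2 mul1r lerDr mulr_ge0.
rewrite -mulr_sumr.
have h3 := ler_wpM2l (ler0n R 2) (sum_np a b).
have h4 : p2 (a%:R + b%:R - 1 / 12) <= p2 (a%:R + b%:R) by apply: p2_le; lra.
have h5 := ler_wpM2l (mulr_ge0 (ler0n R 3300) D00) h4.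
have h6 : p2 (a%:R + b%:R) <= D0 * p2 (a%:R + b%:R) by rewrite ler_peMl.
lra.
Qed.

(* Indices with [Q i] below the threshold [p2 t ^+ 12] are bounded trivially, the others gain a
   factor [p2 (- t)]; the threshold balances the two, whence the exponent 1/96. *)
Lemma interpolation1 (I : finType) (P Q U V W : I -> R) (x y c : R) :
  x <= y -> 0 <= c -> (forall i, 0 <= P i) -> (forall i, 0 <= U i) -> (forall i, 0 <= V i) ->
  (forall i h, 1 <= h -> Q i <= h -> W i <= 2 * h * P i) ->
  (forall i t s, 0 < t -> s * t = 1 -> W i <= 2 * (t * U i + s * V i)) ->
  \sum_i P i <= p2 x -> \sum_i U i <= c * p2 x ->
  (forall t, 1 / 12 <= t -> \sum_i ((p2 t ^+ 12 <= Q i)%R)%:R * V i <= c * p2 (y - t)) ->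
  \sum_i W i <= (4 + 4 * c) * p2 ((x + y) / 2 - (y - x) / 96).
Proof.
move=> xy c0 P0 U0 V0 W1 W2 SP SU SV.
pose t := 1 / 12 + (y - x) / 48; have t12 : 1 / 12 <= t by rewrite /t; lra.
pose tau := p2 ((y - x) / 2 - t / 2); pose sig := p2 (- ((y - x) / 2 - t / 2)).
have ts : sig * tau = 1 by rewrite /sig /tau -p2D addNr p2_0.
have tau0 : 0 < tau by apply: p2_gt0. have sig0 : 0 < sig by apply: p2_gt0.
have hE : p2 t ^+ 12 = 2 * p2 ((y - x) / 4).
  rewrite /p2 -powR_mulrn ?powR_ge0 // -powRrM -{2}[2]powRr1 // -/(p2 _) -/(p2 _) -/(p2 _) -p2D.
  by congr p2; rewrite /t; field.
have h1 : 1 <= p2 t ^+ 12 by apply: exprn_ege1; apply: p2_ge1; lra.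
apply: le_trans (_ : \sum_i (2 * p2 t ^+ 12 * P i
   + 2 * (tau * U i + sig * (((p2 t ^+ 12 <= Q i)%R)%:R * V i))) <= _).
  apply: ler_sum => i _; case: (lerP (p2 t ^+ 12) (Q i)) => hQ /=.
    have := W2 i tau sig tau0 ts; have : 0 <= 2 * p2 t ^+ 12 * P i.
      by apply: mulr_ge0 => //; apply: mulr_ge0 => //; exact: le_trans h1.
    by rewrite mul1r; lra.
  have := W1 i _ h1 (ltW hQ); have : 0 <= tau * U i by rewrite mulr_ge0 // ltW.
  by rewrite mul0r mulr0; lra.
rewrite big_split /= -!mulr_sumr big_split /= -!mulr_sumr.
have k1 := ler_wpM2l (le_trans ler01 h1) SP.
have k2 := ler_wpM2l (ltW tau0) SU; have k3 := ler_wpM2l (ltW sig0) (SV t t12).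
pose z := p2 ((x + y) / 2 - (y - x) / 96).
have g1 : p2 t ^+ 12 * p2 x <= 2 * z.
  by rewrite hE -mulrA ler_wpM2l // -p2D p2_le //; lra.
have g2 : tau * p2 x <= z by rewrite -p2D p2_le // /t; lra.
have g3 : sig * p2 (y - t) <= z by rewrite -p2D p2_le // /t; lra.
have := ler_wpM2l c0 g2; have := ler_wpM2l c0 g3; rewrite -/z.
by move: k1 k2 k3; lra.
Qed.

Lemma interpolation (I : finType) (P Q U V W : I -> R) (x y c : R) :
  0 <= c -> (forall i, 0 <= P i) -> (forall i, 0 <= Q i) ->
  (forall i, 0 <= U i) -> (forall i, 0 <= V i) ->
  (forall i h, 1 <= h -> Q i <= h -> W i <= 2 * h * P i) ->
  (forall i h, 1 <= h -> P i <= h -> W i <= 2 * h * Q i) ->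
  (forall i t s, 0 < t -> s * t = 1 -> W i <= 2 * (t * U i + s * V i)) ->
  \sum_i P i <= p2 x -> \sum_i Q i <= p2 y -> \sum_i U i <= c * p2 x -> \sum_i V i <= c * p2 y ->
  (forall t, 1 / 12 <= t -> \sum_i ((p2 t ^+ 12 <= P i)%R)%:R * U i <= c * p2 (x - t)) ->
  (forall t, 1 / 12 <= t -> \sum_i ((p2 t ^+ 12 <= Q i)%R)%:R * V i <= c * p2 (y - t)) ->
  \sum_i W i <= (4 + 4 * c) * p2 ((x + y) / 2 - `|x - y| / 96).
Proof.
move=> c0 P0 Q0 U0 V0 W1 W1' W2 SP SQ SU SV hU hV; case: (lerP x y) => xy.
  exact: (@interpolation1 I P Q U V W).
rewrite [x + y]addrC; apply: (@interpolation1 I Q P V U W) => //; first exact: ltW.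
move=> i t s t0 st; rewrite [t * _ + _]addrC; apply: W2; last by rewrite mulrC.
by rewrite -(pmulr_lgt0 _ t0) st.
Qed.

Definition levels a b c d (q : quad) :=
  [&& lev q.1.1 == a, lev q.1.2 == b, lev q.2.1 == c & lev q.2.2 == d].
Definition wrects a b c d := \sum_e \sum_(q | good_rect e q && levels a b c d q)
  w e (kp e q.1.1) (kp e q.1.2).
Definition ingroup a b (g : group) (z : T * T) :=
  [&& pairok a b g.1 z.1 z.2, kp g.1 z.1 == g.2.1 & kp g.1 z.2 == g.2.2].

Lemma np_sum a b g : (np a b g)%:R = \sum_z (ingroup a b g z)%:R :> R.
Proof.
rewrite /np -sum1_card natr_sum big_mkcond /=; apply: eq_bigr => z _.
by rewrite inE -/(ingroup a b g z); case: ifP.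
Qed.

Lemma wrects_le_pairs a b c d :
  wrects a b c d <= \sum_g wg g * ((np a b g)%:R * (np d c g)%:R).
Proof.
rewrite (eq_bigr (fun g => (np a b g)%:R * (wg g * (np d c g)%:R))); last first.
  by move=> g _; ring.
rewrite sum_groups; apply: ler_sum => e _.
pose s (q : quad) : quad := (q.1, (q.2.2, q.2.1)).
have sK : involutive s by move=> [[? ?] [? ?]].
rewrite (reindex_inj (inv_inj sK)) big_mkcond /=.
rewrite -(pair_bigA _ (fun z z' : T * T => if good_rect e (z, (z'.2, z'.1)) &&
   levels a b c d (z, (z'.2, z'.1)) then w e (kp e z.1) (kp e z.2) else 0)) /=.
apply: ler_sum => z _; rewrite np_sum !mulr_sumr; apply: ler_sum => z' _.
case: ifP => [|_]; last by rewrite mulr_ge0 // mulr_ge0 // w_ge0.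
case/andP=> /and3P[/and4P[/= h1 h2 h3 h4] /and4P[/= n1 n2 n3 n4] /= ns] /and4P[/= l1 l2 l3 l4].
rewrite /ingroup /pairok /= l1 l2 l3 l4 n1 n2 h1 h2 /kp.
rewrite [key _ z'.1 == _]eq_sym [key _ z'.2 == _]eq_sym h3 h4 /= !andbT.
move: ns; rewrite /nspecial /=; case: (special z.1 e); case: (special z.2 e);
  case: (special z'.1 e); case: (special z'.2 e) => //= _; by rewrite !mul1r !mulr1.
Qed.

(* The same rectangles, grouped by their other pair of opposite sides, along [perp e]. *)
Definition cross_weight a b c d (g : group) : R := \sum_z \sum_z'
  ([&& ingroup a d g z, ingroup b c g z' & z.1 != z'.1])%:R
    * w (perp g.1) (key g.1 z.1) (key g.1 z'.1).

Lemma special_perp x e : special x (perp e) = special x e.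
Proof. by rewrite /special perpK orbC. Qed.

Lemma wrects_le_cross a b c d : wrects a b c d <= \sum_g cross_weight a b c d g.
Proof.
rewrite (eq_bigr (fun g : group => cross_weight a b c d (g.1, g.2))); last by case.
rewrite -(pair_bigA _ (fun e h => cross_weight a b c d (e, h))) /=.
rewrite -(sum_perp (fun e => \sum_h cross_weight a b c d (e, h))).
apply: ler_sum => e _; rewrite /cross_weight exchange_big /=.
pose s (q : quad) : quad := ((q.1.1, q.2.1), (q.2.2, q.1.2)).
have s_bij : bijective s.
  by exists (fun q : quad => ((q.1.1, q.2.2), (q.1.2, q.2.1))); move=> [[? ?] [? ?]].
rewrite (reindex s) /=; last exact: onW_bij.
rewrite big_mkcond /=.
rewrite -(pair_bigA _ (fun z z' : T * T => if good_rect e ((z.1, z'.1), (z'.2, z.2)) &&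
   levels a b c d ((z.1, z'.1), (z'.2, z.2)) then w e (kp e z.1) (kp e z'.1) else 0)) /=.
apply: ler_sum => z _; rewrite exchange_big /=; apply: ler_sum => z' _.
rewrite perpK (bigD1 (key e z.1, key e z.2)) //=; apply: ler_wpDr.
  by apply: sumr_ge0 => h _; rewrite mulr_ge0 // w_ge0.
case: ifP => [|_]; last by rewrite mulr_ge0 // w_ge0.
case/andP=> /and3P[/and4P[/= h1 h2 h3 h4] /and4P[/= n1 n2 n3 n4] /= ns] /and4P[/= l1 l2 l3 l4].
rewrite /ingroup /pairok /= l1 l2 l3 l4 n1 n3 n4 h3 h4 /kp perpK !eqxx.
rewrite [key _ z'.1 == _]eq_sym [key _ z'.2 == _]eq_sym h1 [_ == key e z'.2]eq_sym.
rewrite [key _ z'.2 == _]eq_sym h2 !special_perp /=.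
move: ns; rewrite /nspecial /=; case: (special z.1 e); case: (special z.2 e);
  case: (special z'.1 e); case: (special z'.2 e) => //= _; by rewrite !mul1r.
Qed.

(** For a fixed side the weights of its parallel companions are inverse distances from one point
    along a line, and [w_sum] takes the square root of their number. *)
Lemma cross_weight_le_l a b c d g :
  cross_weight a b c d g <= 2 * (np a d g)%:R * rt (np b c g).
Proof.
rewrite np_sum [2 * _]mulrC -mulrA mulr_suml /cross_weight.
apply: ler_sum => z _.
case: (boolP (ingroup a d g z)) => zg /=; last first.
  by rewrite mul0r big1 // => z' _; rewrite mul0r.
rewrite mul1r.
pose A := [set z' | ingroup b c g z' & z.1 != z'.1].
have inj : {in A &, injective (fst : T * T -> T)}.
  move=> [x y] [x' y']; rewrite !inE /= => /andP[/and3P[/and5P[_ _ _ /eqP h1 _] _ /eqP h2] _].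
  move=> /andP[/and3P[/and5P[_ _ _ /eqP h1' _] _ /eqP h2'] _] /= xx; subst x'; congr pair.
  rewrite /= in h1 h1' h2 h2'.
  by apply: (@meet_perp g.1); [rewrite -h1 -h1' | rewrite -!/(kp _ _) h2 h2'].
rewrite (eq_bigr (fun z' : T * T => if z' \in A then w (perp g.1) (key g.1 z.1) (key g.1 z'.1) else 0)); last first.
  by move=> z' _; rewrite inE; case: (_ && _); rewrite ?mul1r ?mul0r.
rewrite -big_mkcond /= -(big_imset (fun x => w (perp g.1) (key g.1 z.1) (key g.1 x)) inj) /=.
have := w_sum (e := perp g.1) (x := z.1) (P := [in [set z.1 | z in A]]).
rewrite perpK => h; apply: le_trans (h _) _ => {h}.
  move=> _ /imsetP[z' + ->]; rewrite !inE => /andP[/and3P[_ h1 _] h2].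
  case/and3P: zg => _ h3 _; rewrite eq_sym h2 -!/(kp _ _) /=.
  by rewrite (eqP h1) (eqP h3).
rewrite ler_wpM2l //; apply: rt_le; rewrite card_in_imset // /np.
by apply: subset_leq_card; apply/fintype.subsetP => z'; rewrite !inE => /andP[].
Qed.

Lemma cross_weight_sym a b c d g : cross_weight a b c d g = cross_weight b a d c g.
Proof.
rewrite /cross_weight exchange_big /=; apply: eq_bigr => z _; apply: eq_bigr => z' _.
by rewrite w_sym eq_sym andbCA andbA andbC [_ && ingroup a d g z']andbC andbC andbA.
Qed.

(** The cross weight is below both r^2 s and s^2 r up to a factor 2, so either alternative is
    enough. *)
Lemma mul_rt_young (r s t u : R) : 0 <= r -> 0 <= s -> 0 < t -> u * t = 1 ->
  r ^+ 2 * s <= t * r ^+ 3 + u * s ^+ 3 \/ s ^+ 2 * r <= t * r ^+ 3 + u * s ^+ 3.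
Proof.
move=> r0 s0 t0 ut; have u0 : 0 < u by rewrite -(pmulr_lgt0 _ t0) ut.
have a0 : 0 <= t * r ^+ 3 by rewrite mulr_ge0 ?exprn_ge0 // ltW.
have b0 : 0 <= u * s ^+ 3 by rewrite mulr_ge0 ?exprn_ge0 // ltW.
have [h|h] := leP s (t * r); [left|right].
  have := ler_wpM2l (sqr_ge0 r) h.
  by rewrite (_ : r ^+ 2 * (t * r) = t * r ^+ 3); [lra | ring].
have := ler_wpM2l (ltW u0) (ltW h); rewrite mulrA ut mul1r => /(ler_wpM2l (sqr_ge0 s)).
by rewrite (_ : s ^+ 2 * (u * s) = u * s ^+ 3); [lra | ring].
Qed.

Lemma rt_le_ge1 j (h : R) : 1 <= h -> j%:R <= h -> rt j <= h.
Proof.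
move=> h1 nh; have h0 : 0 <= h by apply: le_trans h1.
rewrite -(@ler_pXn2r _ 2) ?nnegrE ?rt_ge0 // rt_sqr; apply: le_trans nh _.
by rewrite expr2 ler_peMl.
Qed.

Lemma cross_weight_le a b c d g (t s : R) : 0 < t -> s * t = 1 ->
  cross_weight a b c d g <= 2 * (t * (wg g * (np a d g)%:R ^+ 2 + rt (np a d g) ^+ 3)
    + s * (wg g * (np b c g)%:R ^+ 2 + rt (np b c g) ^+ 3)).
Proof.
move=> t0 st; have s0 : 0 < s by rewrite -(pmulr_lgt0 _ t0) st.
have h1 := cross_weight_le_l a b c d g; have h2 := cross_weight_le_l b a d c g.
rewrite -cross_weight_sym in h2.
have p1 : 0 <= t * (wg g * (np a d g)%:R ^+ 2).
  by apply: mulr_ge0; [exact: ltW | apply: mulr_ge0; [exact: w_ge0 | exact: sqr_ge0]].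
have p2' : 0 <= s * (wg g * (np b c g)%:R ^+ 2).
  by apply: mulr_ge0; [exact: ltW | apply: mulr_ge0; [exact: w_ge0 | exact: sqr_ge0]].
have e1 := rt_sqr (np a d g); have e2 := rt_sqr (np b c g).
rewrite -e1 in h1 p1 *; rewrite -e2 in h2 p2' *.
case: (mul_rt_young (rt_ge0 (np a d g)) (rt_ge0 (np b c g)) t0 st); lra.
Qed.

Definition CR : R := 4 + 4 * (3400 * D0).
Lemma CR_ge0 : 0 <= CR. Proof. by have := D0_ge0; rewrite /CR; lra. Qed.

Lemma group_mass_ge0 a b g : 0 <= wg g * (np a b g)%:R ^+ 2 + rt (np a b g) ^+ 3.
Proof. by rewrite addr_ge0 ?exprn_ge0 ?rt_ge0 // mulr_ge0 ?sqr_ge0 ?w_ge0. Qed.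

Lemma sum_heavy_groups' a b t : 1 / 12 <= t ->
  \sum_g ((p2 t ^+ 12 <= (np a b g)%:R)%R)%:R * (wg g * (np a b g)%:R ^+ 2 + rt (np a b g) ^+ 3)
    <= 3400 * D0 * p2 (a%:R + b%:R - t).
Proof.
move=> t12; apply: le_trans (sum_heavy_groups a b t12) _.
apply: ler_wpM2r; first exact: p2_ge0.
by have := D0_ge0; lra.
Qed.

Lemma wrects_le1 a b c d : wrects a b c d <= CR *
  p2 ((a%:R + b%:R + (d%:R + c%:R)) / 2 - `|a%:R + b%:R - (d%:R + c%:R)| / 96).
Proof.
apply: le_trans (wrects_le_pairs a b c d) _; have D00 := D0_ge0.
have wm g : wg g * ((np a b g)%:R * (np d c g)%:R) <= (np a b g)%:R * (np d c g)%:R.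
  have [->|/wg_le1 h] := posnP (np a b g); first by rewrite mul0r mulr0.
  by rewrite ler_piMl // mulr_ge0.
apply: (@interpolation _ (fun g => (np a b g)%:R) (fun g => (np d c g)%:R)
  (fun g => wg g * (np a b g)%:R ^+ 2 + rt (np a b g) ^+ 3)
  (fun g => wg g * (np d c g)%:R ^+ 2 + rt (np d c g) ^+ 3)) => //.
- by rewrite mulr_ge0.
- by move=> g; exact: group_mass_ge0.
- by move=> g; exact: group_mass_ge0.
- move=> g h h1 hQ; have := wm g; have := ler_wpM2l (ler0n R (np a b g)) hQ.
  have : 0 <= h * (np a b g)%:R by rewrite mulr_ge0 // (le_trans ler01).
  lra.
- move=> g h h1 hP; have := wm g; have := ler_wpM2r (ler0n R (np d c g)) hP.
  have : 0 <= h * (np d c g)%:R by rewrite mulr_ge0 // (le_trans ler01).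
  lra.
- move=> g t s t0 st; have s0 : 0 < s by rewrite -(pmulr_lgt0 _ t0) st.
  have u1 : 0 <= t * rt (np a b g) ^+ 3 by rewrite mulr_ge0 ?exprn_ge0 ?rt_ge0 // ltW.
  have u2 : 0 <= s * rt (np d c g) ^+ 3 by rewrite mulr_ge0 ?exprn_ge0 ?rt_ge0 // ltW.
  have w0 : 0 <= wg g by exact: w_ge0.
  have : (np a b g)%:R * (np d c g)%:R <= 2 * (t * (np a b g)%:R ^+ 2 + s * (np d c g)%:R ^+ 2) :> R.
    have x0 : 0 <= (np a b g)%:R :> R by []. have y0 : 0 <= (np d c g)%:R :> R by [].
    have := mulr_ge0 (ltW t0) (sqr_ge0 ((np a b g)%:R - s * (np d c g)%:R : R)).
    have -> : t * ((np a b g)%:R - s * (np d c g)%:R) ^+ 2 = t * (np a b g)%:R ^+ 2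
      - 2 * (s * t) * ((np a b g)%:R * (np d c g)%:R) + (s * t) * s * (np d c g)%:R ^+ 2 by ring.
    have z0 : 0 <= (np a b g)%:R * (np d c g)%:R :> R by rewrite mulr_ge0.
    rewrite st; lra.
  move=> /(ler_wpM2l w0); lra.
- exact: sum_np.
- exact: sum_np.
- exact: sum_groups_all.
- exact: sum_groups_all.
- by move=> t; exact: sum_heavy_groups'.
- by move=> t; exact: sum_heavy_groups'.
Qed.

Lemma wrects_le2 a b c d : wrects a b c d <= CR *
  p2 ((a%:R + d%:R + (b%:R + c%:R)) / 2 - `|a%:R + d%:R - (b%:R + c%:R)| / 96).
Proof.
apply: le_trans (wrects_le_cross a b c d) _; have D00 := D0_ge0.
apply: (@interpolation _ (fun g => (np a d g)%:R) (fun g => (np b c g)%:R)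
  (fun g => wg g * (np a d g)%:R ^+ 2 + rt (np a d g) ^+ 3)
  (fun g => wg g * (np b c g)%:R ^+ 2 + rt (np b c g) ^+ 3)) => //.
- by rewrite mulr_ge0.
- by move=> g; exact: group_mass_ge0.
- by move=> g; exact: group_mass_ge0.
- move=> g h h1 hQ; apply: le_trans (cross_weight_le_l _ _ _ _ _) _.
  rewrite mulrAC; apply: ler_wpM2r => //; apply: ler_wpM2l => //; exact: rt_le_ge1.
- move=> g h h1 hP; rewrite cross_weight_sym; apply: le_trans (cross_weight_le_l _ _ _ _ _) _.
  rewrite mulrAC; apply: ler_wpM2r => //; apply: ler_wpM2l => //; exact: rt_le_ge1.
- by move=> g t s; exact: cross_weight_le.
- exact: sum_np.
- exact: sum_np.
- exact: sum_groups_all.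
- exact: sum_groups_all.
- by move=> t; exact: sum_heavy_groups'.
- by move=> t; exact: sum_heavy_groups'.
Qed.

Definition decay (a c : nat) := p2 (- `|a%:R - c%:R| / 96).

(* The two groupings give decay in [|a + b - c - d|] and [|a + d - b - c|], the larger of which
   is [|a - c| + |b - d|]. *)
Lemma wrects_le a b c d : phi a * phi b * phi c * phi d * wrects a b c d <=
  CR * (lam a * lam c * decay a c) * (lam b * lam d * decay b d).
Proof.
have C0 := CR_ge0.
have -> : CR * (lam a * lam c * decay a c) * (lam b * lam d * decay b d)
   = phi a * phi b * phi c * phi d * (CR * p2 ((a%:R + b%:R + c%:R + d%:R) / 2
      - (`|a%:R - c%:R| + `|b%:R - d%:R|) / 96)).
  have -> : p2 ((a%:R + b%:R + c%:R + d%:R) / 2 - (`|a%:R - c%:R| + `|b%:R - d%:R|) / 96)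
    = p2 (a%:R / 2) * p2 (b%:R / 2) * p2 (c%:R / 2) * p2 (d%:R / 2) * (decay a c * decay b d).
    by rewrite /decay -!p2D; congr p2; lra.
  have inv j : phi j * p2 (j%:R / 2) = lam j by rewrite /phi -mulrA -p2D addNr p2_0 mulr1.
  rewrite -(inv a) -(inv b) -(inv c) -(inv d); ring.
apply: ler_wpM2l.
  by do 3! (apply: mulr_ge0; last exact: phi_ge0); exact: phi_ge0.
have h1 := wrects_le1 a b c d; have h2 := wrects_le2 a b c d.
case: (lerP `|a%:R + b%:R - (d%:R + c%:R)| `|a%:R + d%:R - (b%:R + c%:R) : R|) => hle.
  apply: le_trans h2 _; apply: ler_wpM2l => //; apply: p2_le; move: hle.
  move: (a%:R : R) (b%:R : R) (c%:R : R) (d%:R : R) => x y z u.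
  by case: (ger0P (x - z)); case: (ger0P (y - u)); case: (ger0P (x + y - _));
    case: (ger0P (x + u - _)); lra.
apply: le_trans h1 _; apply: ler_wpM2l => //; apply: p2_le; move: hle.
move: (a%:R : R) (b%:R : R) (c%:R : R) (d%:R : R) => x y z u.
by case: (ger0P (x - z)); case: (ger0P (y - u)); case: (ger0P (x + y - _));
  case: (ger0P (x + u - _)); lra.
Qed.

(** The symmetric kernel is covered by its two triangles, each bounded by Schur's test. *)
Lemma sum_decay : \sum_(a < m) \sum_(c < m) lam a * lam c * decay a c <= 2 * geo (1 / 96) * N2.
Proof.
have S := @schur_kernel (1 / 96) m lam; rewrite -/N2 in S.
have c0 : 0 < 1 / 96 :> R by lra.
apply: le_trans (_ : \sum_(a < m) \sum_(c < m | (c <= a)%N) lam a * lam c * kern (1 / 96) a c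
  + \sum_(c < m) \sum_(a < m | (a <= c)%N) lam c * lam a * kern (1 / 96) c a <= _); last first.
  by have := S c0; lra.
rewrite [X in _ <= _ + X](exchange_big_dep xpredT) //= -big_split /=; apply: ler_sum => a _.
rewrite big_mkcond [X in _ <= X + _]big_mkcond [X in _ <= _ + X]big_mkcond /= -big_split /=.
apply: ler_sum => c _; rewrite /decay /kern.
have e0 (x : R) : 0 <= lam a * lam c * p2 x by rewrite !mulr_ge0 ?p2_ge0.
have e1 (x : R) : 0 <= lam c * lam a * p2 x by rewrite !mulr_ge0 ?p2_ge0.
case: (leqP c a) => ca.
  apply: ler_wpDr; first by case: ifP.
  by rewrite ler_wpM2l ?mulr_ge0 // p2_le // ger0_norm ?subr_ge0 ?ler_nat //; lra.
rewrite (ltnW ca) add0r [lam a * _]mulrC ler_wpM2l ?mulr_ge0 // p2_le //.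
by rewrite ltr0_norm ?subr_lt0 ?ltr_nat //; lra.
Qed.

(** The decay involves each pair of opposite vertices separately, so the fourfold sum over levels
    factors into two copies of [sum_decay], and [m] does not enter. *)
Theorem weighted_rect_sum_le :
  \sum_e \sum_(q | is_rect e q && nondeg q) w e (kp e q.1.1) (kp e q.1.2) * prodf q
    <= (24 + 4 * CR * geo (1 / 96) ^+ 2) * N2 ^+ 2.
Proof.
apply: le_trans (_ : \sum_e \sum_(q | is_rect e q && (2 <= nspecial e q)%N) prodf q
    + \sum_e \sum_(q | good_rect e q) w e (kp e q.1.1) (kp e q.1.2) * prodf q <= _).
  rewrite -big_split /=; apply: ler_sum => e _.
  rewrite big_mkcond [X in X + _]big_mkcond [X in _ + X]big_mkcond /= -big_split /=.
  apply: ler_sum => q _; have p0 := prodf_ge0 q.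
  have wp0 : 0 <= w e (kp e q.1.1) (kp e q.1.2) * prodf q by apply: mulr_ge0 => //; exact: w_ge0.
  rewrite /good_rect [(_ <= 1)%N]leqNgt.
  case: (boolP (is_rect e q)) => hr; case: (boolP (nondeg q)) => hn /=; last 3 first.
  - by case: (1 < _)%N => /=; lra.
  - by lra.
  - by lra.
  case: (1 < _)%N => /=; last by lra.
  rewrite addr0; apply: ler_piMl => //.
  by case/and4P: hr => /eqP h1 _ _ _; case/and4P: hn => h2 _ _ _; apply: w_le1.
suff hg : \sum_e \sum_(q | good_rect e q) w e (kp e q.1.1) (kp e q.1.2) * prodf q
   <= CR * (2 * geo (1 / 96) * N2) ^+ 2.
  have := two_special; rewrite exprMn exprMn in hg.
  by rewrite (_ : (24 + 4 * CR * geo (1 / 96) ^+ 2) * N2 ^+ 2 = 24 * N2 ^+ 2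
    + CR * (2 ^+ 2 * geo (1 / 96) ^+ 2 * N2 ^+ 2)); [lra | ring].
pose o x := Ordinal (lev_lt x).
pose p (q : quad) := ((o q.1.1, o q.2.1), (o q.1.2, o q.2.2)).
apply: le_trans (_ : \sum_(j : 'I_m * 'I_m * ('I_m * 'I_m))
   phi j.1.1 * phi j.2.1 * phi j.1.2 * phi j.2.2 * wrects j.1.1 j.2.1 j.1.2 j.2.2 <= _).
  under eq_bigr => e _ do rewrite (partition_big p xpredT) //=.
  rewrite exchange_big /=; apply: ler_sum => j _; rewrite /wrects mulr_sumr.
  apply: ler_sum => e _.
  rewrite (eq_bigl (fun q => good_rect e q && levels j.1.1 j.2.1 j.1.2 j.2.2 q)); last first.
    move=> q; case: j => [[a c] [b d]] /=; congr (_ && _).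
    by rewrite /p !xpair_eqE /levels /= -!val_eqE /= -!andbA; do !bool_congr.
  rewrite mulr_sumr; apply: ler_sum => q /andP[_ /and4P[/eqP h1 /eqP h2 /eqP h3 /eqP h4]].
  rewrite mulrC; apply: ler_wpM2r; first exact: w_ge0.
  have fp x : f x <= phi (lev x) by exact: f_le.
  by rewrite /prodf -h1 -h2 -h3 -h4 !ler_pM // !mulr_ge0.
apply: le_trans (ler_sum _ (fun j _ => wrects_le _ _ _ _)) _.
rewrite -(pair_bigA _ (fun j j' : 'I_m * 'I_m => CR * (lam j.1 * lam j.2 * decay j.1 j.2)
   * (lam j'.1 * lam j'.2 * decay j'.1 j'.2))) /=.
under eq_bigr do rewrite -mulr_sumr.
rewrite -mulr_suml -mulr_sumr -mulrA -expr2 ler_wpM2l ?CR_ge0 //.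
have s0 : 0 <= \sum_(j : 'I_m * 'I_m) lam j.1 * lam j.2 * decay j.1 j.2.
  by apply: sumr_ge0 => j _; rewrite !mulr_ge0 ?p2_ge0.
have hs : \sum_(j : 'I_m * 'I_m) lam j.1 * lam j.2 * decay j.1 j.2 <= 2 * geo (1 / 96) * N2.
  by rewrite -(pair_bigA _ (fun a c : 'I_m => lam a * lam c * decay a c)); exact: sum_decay.
by apply: lerXn2r => //; rewrite nnegrE // (le_trans s0).
Qed.
End Rect.

(** * Lattice directions *)

Section Directions.
Implicit Types e z : int * int.

Definition cross e z : int := e.1 * z.2 - e.2 * z.1.
Definition dot e z : int := e.1 * z.1 + e.2 * z.2.
Definition sqn e : int := e.1 ^+ 2 + e.2 ^+ 2.
Definition multiple (s : int) e : int * int := (s * e.1, s * e.2).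
(* Primitive vectors, one of each pair [e], [- e]. *)
Definition direction e :=
  coprimez e.1 e.2 && ((0 < e.1) || (e.1 == 0) && (0 < e.2)).
(** Rotation by a right angle, with the sign that stays among the chosen representatives. *)
Definition rotate e : int * int := if e.2 <= 0 then (- e.2, e.1) else (e.2, - e.1).

Lemma direction_sqr_gt0 e : direction e -> 0 < sqn e.
Proof. by case: e => a b /andP[_] /=; rewrite /sqn /= !expr2; nia. Qed.

Lemma direction_rotate e : direction e -> direction (rotate e).
Proof.
case: e => a b; rewrite /direction /rotate /= => /andP[co h].
have co' : coprimez b a by rewrite coprimez_sym.
by case: ifP => hb; rewrite /= ?coprimezN ?coprimeNz co' /=; lia.
Qed.

Lemma rotateK e : direction e -> rotate (rotate e) = e.
Proof.
case: e => a b; rewrite /direction /rotate /= => /andP[co h].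
case: (lerP b 0) => hb /=; case: ifP => ha; rewrite ?opprK //.
  by exfalso; lia.
by exfalso; lia.
Qed.

Lemma rotate_neq e : direction e -> rotate e != e.
Proof.
case: e => a b; rewrite /direction /rotate /= => /andP[co h].
by case: ifP => hb; rewrite xpair_eqE; lia.
Qed.

Lemma cross_rotate e z : cross (rotate e) z = (if e.2 <= 0 then -1 else 1) * dot e z.
Proof. by rewrite /cross /rotate /dot; case: ifP => _ /=; ring. Qed.

Lemma rotate_le e n : `|e.1| <= n -> `|e.2| <= n -> `|(rotate e).1| <= n /\ `|(rotate e).2| <= n.
Proof. by rewrite /rotate; case: ifP => _ /=; rewrite ?normrN. Qed.

Lemma direction_inj e e' : direction e -> direction e' -> e.1 * e'.2 = e'.1 * e.2 -> e = e'.
Proof.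
case: e e' => [a b] [c d]; rewrite /direction /= => /andP[co h] /andP[co' h'] eqx.
have d1 : (a %| c)%Z by rewrite -(Gauss_dvdzl _ co) -eqx dvdz_mulr.
have d2 : (c %| a)%Z by rewrite -(Gauss_dvdzl _ co') eqx dvdz_mulr.
have ac : a = c.
  have : `|a|%N = `|c|%N by apply/eqP; rewrite eqn_dvd; apply/andP; split.
  by lia.
subst c; congr pair; have [a0|a0] := eqVneq a 0.
  by subst a; move: co co' h h'; rewrite /coprimez !gcd0z; lia.
by apply/esym/(mulfI a0).
Qed.

Lemma dot_multiple s e : dot e (multiple s e) = s * sqn e.
Proof. by rewrite /dot /multiple /sqn /=; ring. Qed.

Lemma direction_multiple e z : direction e -> cross e z = 0 ->
  exists s : int, z = multiple s e.
Proof.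
case: e z => [a b] [x y]; rewrite /direction /cross /= => /andP[co h] eqx.
have hx : a * y = b * x by lia.
have d1 : (a %| x)%Z by rewrite -(Gauss_dvdzr _ co) -hx dvdz_mulr.
have d2 : (b %| y)%Z by rewrite -(@Gauss_dvdzr _ a) 1?coprimez_sym // hx dvdz_mulr.
case/dvdzP: d1 => s hs; case/dvdzP: d2 => t ht; subst x y.
have [a0|a0] := eqVneq a 0.
  by exists t; rewrite /multiple; subst a; rewrite !mulr0.
exists s; congr pair; have [b0|b0] := eqVneq b 0; first by subst b; rewrite !mulr0.
congr (_ * _); apply: (mulfI a0); apply: (mulfI b0); lia.
Qed.

Lemma direction_exists z : z != 0 -> exists e (s : int),
  [/\ direction e, z = multiple s e, `|s| = gcdz z.1 z.2
    & `|e.1| <= `|z.1| /\ `|e.2| <= `|z.2|].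
Proof.
case: z => x y z0; pose g := gcdz x y.
have g0 : 0 < g.
  by rewrite /g /gcdz ltz_nat gcdn_gt0 !absz_gt0 -negb_and; move: z0; rewrite xpair_eqE.
have [/dvdzP[a ha] /dvdzP[b hb]] := (dvdz_gcdl x y, dvdz_gcdr x y).
rewrite -/g in ha hb.
have co : coprimez a b.
  have : gcdz x y = g by [].
  by rewrite ha hb -mulz_gcdl /coprimez => h; apply/eqP; nia.
have [dir|ndir] := boolP (direction (a, b)).
  exists (a, b), g; split => //=; first by rewrite ha hb ![_ * g]mulrC.
  by rewrite ha hb !normrM; nia.
exists (- a, - b), (- g); split => //=.
- move: ndir; rewrite /direction /= !coprimezN !coprimeNz co /= => ndir.
  have : ~~ ((a == 0) && (b == 0)).
    by apply: contra z0 => /andP[/eqP a0 /eqP b0]; rewrite ha hb a0 b0 !mul0r.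
  lia.
- by rewrite /multiple ha hb /= !mulrNN ![_ * g]mulrC.
- by rewrite normrN gtr0_norm.
- by rewrite ha hb !normrM !normrN; nia.
Qed.

Lemma parallel_trans e e' z : z != 0 -> cross e z = 0 -> cross e' z = 0 ->
  e.1 * e'.2 = e'.1 * e.2.
Proof.
case: e e' z => [a b] [c d] [x y]; rewrite /cross xpair_eqE /= => z0 h1 h2.
have [x0|x0] := eqVneq x 0.
  have y0 : y != 0 by move: z0; rewrite x0 eqxx.
  apply: (mulfI y0); apply/eqP; rewrite -subr_eq0; apply/eqP.
  transitivity ((a * y - b * x) * d - (c * y - d * x) * b + x * 0); first by rewrite x0; ring.
  by rewrite h1 h2 !mul0r mulr0 subr0 addr0.
apply: (mulfI x0); apply/eqP; rewrite -subr_eq0; apply/eqP.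
transitivity (c * (a * y - b * x) - a * (c * y - d * x)); first by ring.
by rewrite h1 h2 !mulr0 subr0.
Qed.

End Directions.

(** * Schur's test for matchings *)

Section Matching.
Variable R : realType.

(** Grouped by the common value, the left side is a scalar product of two mass vectors, which 2 x y
    <= x^2 + y^2 separates. *)
Lemma sum_match_le (I : finType) (J : choiceType) (a b : I -> J) (h : I -> R) :
  \sum_i \sum_i' (a i == b i')%:R * (h i * h i')
    <= (\sum_i \sum_i' (a i == a i')%:R * (h i * h i')
        + \sum_i \sum_i' (b i == b i')%:R * (h i * h i')) / 2.
Proof.
pose js := codom a ++ codom b.
pose mass (c : I -> J) (j : seq_sub js) := \sum_i (c i == val j)%:R * h i.
have massE c c' : (forall i, c i \in js) ->
    \sum_i \sum_i' (c i == c' i')%:R * (h i * h i') = \sum_j mass c j * mass c' j.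
  move=> cin; transitivity (\sum_(j : seq_sub js) \sum_i \sum_i'
      ((c i == val j)%:R * h i) * ((c' i' == val j)%:R * h i')).
    rewrite [RHS]exchange_big /=; apply: eq_bigr => i _; rewrite [RHS]exchange_big /=; apply: eq_bigr => i' _.
    rewrite (bigD1 (SeqSub (cin i))) //= eqxx mul1r mulrCA eq_sym big1 ?addr0 // => j.
    by rewrite -val_eqE /= eq_sym => /negbTE ->; rewrite !mul0r.
  by apply: eq_bigr => j _; rewrite /mass big_distrlr.
have ain i : a i \in js by rewrite mem_cat codom_f.
have bin i : b i \in js by rewrite mem_cat codom_f orbT.
rewrite !massE // -big_split /= mulr_suml; apply: ler_sum => j _.
by have := sqr_ge0 (mass a j - mass b j); rewrite sqrrB -!expr2; lra.
Qed.

(** The index [j] encodes the integer j - M, which is confined to [-q, q] with q the integer part of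
    M / (2 g). *)
Lemma count_near (M g : nat) : (0 < g)%N ->
  \sum_(j < (2 * M).+1) ((`|(j : nat)%:Z - M%:Z| * g%:Z *+ 2 < M%:Z)%R)%:R <= M%:R / g%:R + 1 :> R.
Proof.
move=> g0; pose q := (M %/ (2 * g))%N.
have qM : (q * (2 * g) <= M)%N by apply: leq_divM.
have hq : (2 * q)%:R <= M%:R / g%:R :> R.
  by rewrite ler_pdivlMr ?ltr0n // -natrM ler_nat; lia.
apply: le_trans (lerD hq (lexx 1)); rewrite natr1.
rewrite -natr_sum ler_nat -[X in (_ <= X)%N]card_ord.
rewrite (eq_bigr (fun j : 'I_(2 * M).+1 => if (`|(j : nat)%:Z - M%:Z| * g%:Z *+ 2 < M%:Z)%R then 1%N else 0%N)); last first.
  by move=> j _; case: (_ < _).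
rewrite -big_mkcond sum1_card.
pose sh (j : 'I_(2 * M).+1) : 'I_(2 * q).+1 := inord (j + q - M).
have near j : j \in [pred j : 'I_(2 * M).+1 | (`|(j : nat)%:Z - M%:Z| * g%:Z *+ 2 < M%:Z)%R] ->
    (M <= j + q)%N /\ (j + q - M < (2 * q).+1)%N.
  rewrite inE => h.
  have : (`|(j : nat)%:Z - M%:Z|%N <= q)%N by rewrite leq_divRL; lia.
  by lia.
apply: (@leq_card_in _ _ sh) => i j /near[i1 i2] /near[j1 j2] /(congr1 (@nat_of_ord _)).
by rewrite !inordK // => h; apply: val_inj => /=; lia.
Qed.

End Matching.

(** * Dyadic levels of the decreasing rearrangement *)

Section DyadicLevels.
Variables (R : realType) (T : finType) (f : T -> R).
Hypothesis f_ge0 : forall x, 0 <= f x.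

Let s := sort (fun x y => f y <= f x) (enum T).
(** Counting ranks from 0, level j consists of the ranks 2^j - 1 to 2^(j+1) - 2, and its largest
    value has rank 2^j - 1. *)
Definition dyadic_level x := trunc_log 2 (index x s).+1.
Definition ranked (i : nat) : R := nth 0 [seq f x | x <- s] i.
Definition level_size (j : nat) : R := p2 (j%:R / 2) * ranked (2 ^ j).-1.

Let size_s : size s = #|T|. Proof. by rewrite size_sort cardE. Qed.
Let mem_s x : x \in s. Proof. by rewrite mem_sort mem_enum. Qed.

Lemma ranked_index x : ranked (index x s) = f x.
Proof. by rewrite /ranked (nth_map x) ?index_mem // nth_index. Qed.

Lemma ranked_ge0 i : 0 <= ranked i.
Proof.
have [h|h] := ltnP i (size [seq f x | x <- s]); last by rewrite /ranked nth_default.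
by rewrite /ranked; case/mapP: (mem_nth 0 h) => x _ ->.
Qed.

Lemma ranked_anti i j : (i <= j)%N -> ranked j <= ranked i.
Proof.
move=> ij; have [h|h] := ltnP j (size [seq f x | x <- s]); last first.
  by rewrite {1}/ranked nth_default // ranked_ge0.
have srt : sorted (fun a b : R => b <= a) [seq f x | x <- s].
  by rewrite sorted_map; apply: sort_sorted => x y; exact: le_total.
apply: (sorted_leq_nth _ _ 0 srt) => //; rewrite ?inE //.
- by move=> y x z h1 h2; apply: le_trans h2 h1.
- exact: leq_ltn_trans ij h.
Qed.

Lemma sum_ranked : \sum_(i < #|T|) ranked i ^+ 2 = \sum_x f x ^+ 2.
Proof.
rewrite -(big_mkord xpredT (fun i => ranked i ^+ 2)) -size_s -(size_map f s).
rewrite -(big_nth 0 xpredT (fun y => y ^+ 2)) big_map /=.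
by rewrite (perm_big (enum T)) ?perm_sort //= big_enum.
Qed.

Lemma card_dyadic_level j : (#|[set x | dyadic_level x == j]| <= 2 ^ j)%N.
Proof.
rewrite -[X in (_ <= X)%N](size_iota (2 ^ j).-1) cardE -(size_map (fun x => index x s)).
apply: uniq_leq_size => [|i /mapP[x + ->]].
  rewrite map_inj_in_uniq ?enum_uniq // => x y _ _ h.
  by rewrite -(nth_index x (mem_s x)) h nth_index.
rewrite mem_enum inE => /eqP xj.
have := @trunc_log_bounds 2 (index x s).+1 isT isT; rewrite /= -/(dyadic_level x) xj expnS mem_iota.
by move: (2 ^ j)%N (index x s) => P n; lia.
Qed.

Lemma dyadic_level_lt x : (dyadic_level x < (trunc_log 2 #|T|).+1)%N.
Proof. by rewrite ltnS leq_trunc_log // -size_s index_mem. Qed.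

Lemma level_size_ge0 j : 0 <= level_size j.
Proof. by rewrite mulr_ge0 ?p2_ge0 // ranked_ge0. Qed.

Lemma le_level_size x :
  f x <= level_size (dyadic_level x) * p2 (- ((dyadic_level x)%:R / 2)).
Proof.
rewrite /level_size mulrAC -p2D subrr p2_0 mul1r -ranked_index; apply: ranked_anti.
have := @trunc_logP 2 (index x s).+1 isT isT; rewrite -/(dyadic_level x).
by case: (2 ^ _)%N.
Qed.

Lemma level_size_sqr j : level_size j ^+ 2 = (2 ^ j)%:R * ranked (2 ^ j).-1 ^+ 2.
Proof.
by rewrite exprMn p2_sqr natrX -p2_nat; congr (p2 _ * _); field.
Qed.

(** The largest value on level n + 1 is at most each of the values of ranks 2^n to 2^(n+1) - 1;
    these are 2^n in number, half of what [level_size_sqr] asks for, hence the factor 2. *)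
Lemma sum_level_size n :
  \sum_(j < n.+1) level_size j ^+ 2 <= ranked 0 ^+ 2 + 2 * \sum_(1 <= i < 2 ^ n) ranked i ^+ 2.
Proof.
elim: n => [|n IH].
  by rewrite big_ord_recr big_ord0 /= add0r level_size_sqr big_geq // mulr0 addr0 mul1r.
rewrite big_ord_recr /=; apply: le_trans (lerD IH (lexx _)) _.
have p0 : (0 < 2 ^ n)%N by rewrite expn_gt0.
have pS : (2 ^ n.+1 = 2 ^ n + 2 ^ n)%N by rewrite expnS mul2n addnn.
rewrite [X in _ <= _ + _ * X](big_cat_nat p0) /=; last by rewrite pS leq_addr.
rewrite mulrDr addrA lerD2l level_size_sqr pS natrD -mulr2n -[X in X * _]mulr_natl -mulrA.
apply: ler_wpM2l => //; rewrite -{1}[(2 ^ n)%N](addnK (2 ^ n)%N) -sumr_const_nat.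
rewrite mulr_suml; apply: ler_sum_nat => i /andP[_ hi]; rewrite mul1r.
by apply: lerXn2r; rewrite ?nnegrE ?ranked_ge0 //; apply: ranked_anti; lia.
Qed.

Lemma sum_level_size_le :
  \sum_(j < (trunc_log 2 #|T|).+1) level_size j ^+ 2 <= 3 * \sum_x f x ^+ 2.
Proof.
apply: le_trans (sum_level_size _) _; rewrite -sum_ranked.
have r0 i : 0 <= ranked i ^+ 2 by rewrite sqr_ge0.
have h1 : ranked 0 ^+ 2 <= \sum_(i < #|T|) ranked i ^+ 2.
  case: #|T| size_s => [/size0nil|n _]; last by rewrite big_ord_recl lerDl sumr_ge0.
  by rewrite big_ord0 /ranked => -> /=; rewrite expr0n.
have h2 : \sum_(1 <= i < 2 ^ trunc_log 2 #|T|) ranked i ^+ 2 <= \sum_(i < #|T|) ranked i ^+ 2.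
  have [->|N0] := posnP #|T|; first by rewrite big_ord0 big_geq.
  have hN : (2 ^ trunc_log 2 #|T| <= #|T|)%N by apply: trunc_logP.
  rewrite -(big_mkord xpredT (fun i => ranked i ^+ 2)) (big_cat_nat (leq0n _) hN) /=.
  rewrite (@big_cat_nat _ _ _ 1 0) ?expn_gt0 //= -addrA [X in _ <= X]addrCA lerDl.
  by rewrite addr_ge0 ?sumr_ge0.
by lra.
Qed.
End DyadicLevels.

Lemma digits_inj (N a b c d : int) : `|b| *+ 2 < N -> `|d| *+ 2 < N ->
  N * a + b = N * c + d -> a = c.
Proof.
move=> hb hd; have N0 : 0 <= N by lia.
case: (ltrgtP a c) => // ac.
  have : N * 1 <= N * (c - a) by rewrite ler_wpM2l //; lia.
  by rewrite mulrBr; lia.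
have : N * 1 <= N * (a - c) by rewrite ler_wpM2l //; lia.
by rewrite mulrBr; lia.
Qed.

(** * Near-resonant parallelograms *)

Section Grid.
Variables (R : realType) (T : finType) (p : T -> int * int) (B : nat).
Hypothesis p_inj : injective p.
Hypothesis p_le : forall x, `|(p x).1| <= B%:Z /\ `|(p x).2| <= B%:Z.

(** Differences of points of the set have coordinates up to 2 B in absolute value, so this box
    contains every direction that occurs. *)
Definition box : seq (int * int) :=
  [seq (i%:Z - (2 * B)%:Z, j%:Z - (2 * B)%:Z) | i <- iota 0 (4 * B).+1, j <- iota 0 (4 * B).+1].
Definition directions := [seq e <- box | direction e].
Definition dir_type : finType := seq_sub directions.

Lemma mem_directions e : direction e -> `|e.1| <= (2 * B)%:Z -> `|e.2| <= (2 * B)%:Z ->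
  e \in directions.
Proof.
case: e => a b de /= ha hb; rewrite mem_filter de; apply/allpairsP.
exists (`|(a + (2 * B)%:Z)%R|%N, `|(b + (2 * B)%:Z)%R|%N).
split; [by rewrite mem_iota -[fst _]/(`|(a + (2 * B)%:Z)%R|%N); lia
       | by rewrite mem_iota -[snd _]/(`|(b + (2 * B)%:Z)%R|%N); lia |].
by apply/eqP; rewrite xpair_eqE /=; lia.
Qed.

Lemma dirP (e : dir_type) : direction (val e).
Proof. by have := valP e; rewrite mem_filter => /andP[]. Qed.

Lemma dir_le (e : dir_type) : `|(val e).1| <= (2 * B)%:Z /\ `|(val e).2| <= (2 * B)%:Z.
Proof.
have := valP e; rewrite mem_filter => /andP[_ /allpairsP[[i j]]].
by rewrite !mem_iota => -[/= hi hj ->] /=; split; lia.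
Qed.

Lemma rotate_mem (e : dir_type) : rotate (val e) \in directions.
Proof.
have [h1 h2] := dir_le e; have [h3 h4] := rotate_le h1 h2.
exact: (mem_directions (direction_rotate (dirP e)) h3 h4).
Qed.

Definition perp_dir (e : dir_type) : dir_type := SeqSub (rotate_mem e).

Lemma perp_dirK : involutive perp_dir.
Proof. by move=> e; apply: val_inj; rewrite /= rotateK // dirP. Qed.

Lemma perp_dir_neq e : perp_dir e != e.
Proof. by rewrite -val_eqE /= rotate_neq // dirP. Qed.

Let L := (4 * B * B)%N.
(** A line of direction [e] is a level set of [cross (val e)]; the shift by [L], a bound for its
    absolute value, makes the level an ordinal. *)
Definition line_key (e : dir_type) (x : T) : 'I_(2 * L).+1 :=
  inord `|(cross (val e) (p x) + L%:Z)%R|%N.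

Lemma cross_bound (e : dir_type) x : `|cross (val e) (p x)| <= L%:Z.
Proof.
have [h1 h2] := dir_le e; have [h3 h4] := p_le x; rewrite /cross.
have m1 : `|(val e).1 * (p x).2| <= (2 * B)%:Z * B%:Z by rewrite normrM ler_pM.
have m2 : `|(val e).2 * (p x).1| <= (2 * B)%:Z * B%:Z by rewrite normrM ler_pM.
by apply: le_trans (ler_normB _ _) _; apply: le_trans (lerD m1 m2) _; rewrite /L; lia.
Qed.

Lemma line_keyE e x : (line_key e x : nat)%:Z = cross (val e) (p x) + L%:Z.
Proof.
have h := cross_bound e x; rewrite /line_key inordK; last by rewrite ltnS; lia.
by rewrite gez0_abs //; lia.
Qed.

Lemma line_key_eq e x y : (line_key e x == line_key e y) =
  (cross (val e) (p x) == cross (val e) (p y)).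
Proof.
apply/eqP/eqP => h; last by apply: val_inj; apply/eqP; rewrite -eqz_nat !line_keyE h.
by have := line_keyE e x; rewrite h line_keyE => /addIr.
Qed.

Lemma crossB e z z' : cross e (z - z') = cross e z - cross e z'.
Proof. by rewrite /cross /=; ring. Qed.

Lemma dotB e z z' : dot e (z - z') = dot e z - dot e z'.
Proof. by rewrite /dot /=; ring. Qed.

Lemma p_diff_neq0 x y : x != y -> p x - p y != 0.
Proof. by move=> xy; rewrite subr_eq0 (inj_eq p_inj). Qed.

Lemma line_key_dir x y e e' : x != y ->
  line_key e x = line_key e y -> line_key e' x = line_key e' y -> e = e'.
Proof.
move=> /p_diff_neq0 xy /eqP; rewrite line_key_eq -subr_eq0 -crossB => /eqP h1.
move=> /eqP; rewrite line_key_eq -subr_eq0 -crossB => /eqP h2.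
by apply: val_inj; apply: direction_inj; rewrite ?dirP //; apply: parallel_trans xy h1 h2.
Qed.

(* For [N] large the coordinate [X = N x_1 + x_2] is injective on the box, and no direction
   is vertical with respect to it. *)
Lemma grid_few_rich_lines (P : {set T}) (t : nat) : (2 <= t)%N ->
  #|[set l | (t <= #|[set x in P | on line_key l x]|)%N]|%:R
    <= 2304 * (#|P|%:R ^+ 2 / t%:R ^+ 3 + #|P|%:R / t%:R) :> R.
Proof.
move=> t2; pose N : int := (2 * B)%:Z + 1.
pose X x : R := (N * (p x).1 + (p x).2)%:~R; pose Y x : R := (p x).1%:~R.
pose den (l : dir_type * 'I_(2 * L).+1) : int := N * (val l.1).1 + (val l.1).2.
have den_neq0 l : den l != 0.
  have [h1 h2] := dir_le l.1; have := dirP l.1; case/andP=> _.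
  case/orP=> [e1|/andP[/eqP e1 e2]]; last by rewrite /den e1 mulr0 add0r gt_eqF.
  have : N * 1 <= N * (val l.1).1 by rewrite ler_wpM2l // /N; lia.
  by rewrite /den mulr1; move: (N * _) => u; rewrite /N; lia.
pose mu (l : dir_type * 'I_(2 * L).+1) : R := (val l.1).1%:~R / (den l)%:~R.
pose nu (l : dir_type * 'I_(2 * L).+1) : R := - ((nat_of_ord l.2)%:Z - L%:Z)%:~R / (den l)%:~R.
have denR l : (den l)%:~R != 0 :> R by rewrite intr_eq0.
have Xinj : injective X.
  move=> x y /intr_inj; have [h1 h2] := p_le x; have [h3 h4] := p_le y => hxy.
  have e1 : (p x).1 = (p y).1 by apply: (digits_inj (N := N)) hxy; rewrite /N; lia.
  apply: p_inj; move: hxy; rewrite e1 => /addrI e2.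
  by case: (p x) (p y) e1 e2 => [? ?] [? ?] /= -> ->.
have linj l l' : mu l = mu l' -> nu l = nu l' -> l = l'.
  move=> /eqP; rewrite /mu eqr_div // -!intrM eqr_int => /eqP h1.
  have ee : l.1 = l'.1.
    apply: val_inj; apply: direction_inj; rewrite ?dirP //.
    apply/eqP; rewrite -subr_eq0; apply/eqP.
    transitivity ((val l.1).1 * den l' - (val l'.1).1 * den l); first by rewrite /den; ring.
    by rewrite h1 subrr.
  move=> /eqP; rewrite /nu /den ee eqr_div // ?denR //.
  have := denR l'; rewrite /den => d0.
  move=> /eqP /(mulIf d0) /oppr_inj /intr_inj /addIr [] h2.
  by case: l l' ee h2 {h1 d0} => [e k1] [e' k2] /= -> /val_inj ->.
apply: le_trans (@szemeredi_trotter R T X Y Xinj P _ mu nu linj t t2).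
rewrite ler_nat; apply: subset_leq_card; apply/fintype.subsetP => l; rewrite !inE => h.
apply: leq_trans h _; apply: subset_leq_card; apply/fintype.subsetP => x; rewrite !inE => /andP[-> /eqP hx].
have hk := line_keyE l.1 x; rewrite hx in hk.
rewrite /nu hk addrK /mu; apply/eqP/(mulIf (denR l)); rewrite mulrDl divfK //.
rewrite [_ / _ * X x]mulrAC divfK // /X /Y -!intrM -intrN -intrD; congr (_%:~R).
by rewrite /den /cross; ring.
Qed.

(** The perpendiculars through two points that differ by s times [e] have keys differing by s |e|^2
    up to sign, so this is 1 / |s| ([line_weightE]). *)
Definition line_weight (e : dir_type) (c c' : 'I_(2 * L).+1) : R :=
  (sqn (val e))%:~R / `|(nat_of_ord c)%:Z - (nat_of_ord c')%:Z|%:~R.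

Lemma line_weight_ge0 e c c' : 0 <= line_weight e c c'.
Proof. by rewrite divr_ge0 // ler0z // addr_ge0 ?sqr_ge0. Qed.

Lemma line_weight_sym e c c' : line_weight e c c' = line_weight e c' c.
Proof. by rewrite /line_weight distrC. Qed.

Lemma line_weightE (e : dir_type) x y (s : int) :
  p y - p x = multiple s (val e) ->
  line_weight e (line_key (perp_dir e) x) (line_key (perp_dir e) y) = `|s%:~R|^-1.
Proof.
move=> hs; have d0 := direction_sqr_gt0 (dirP e).
rewrite /line_weight !line_keyE /= opprD addrACA subrr addr0 -crossB -opprB hs.
rewrite cross_rotate !normrM [`|if _ then _ else _|](_ : _ = 1) ?mul1r; last by case: ifP.
have -> : dot (val e) (- multiple s (val e)) = - (s * sqn (val e)).
  by rewrite -dot_multiple /dot /=; ring.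
rewrite normrN normrM [`|sqn _|]gtr0_norm // intrM invfM mulrCA divff ?mulr1 ?intr_norm //.
by rewrite intr_eq0 gt_eqF.
Qed.

Lemma same_line (e : dir_type) x y : line_key e x = line_key e y ->
  exists s, p y - p x = multiple s (val e).
Proof.
move=> /eqP; rewrite line_key_eq => /eqP h; apply: direction_multiple; first exact: dirP.
by rewrite crossB h subrr.
Qed.

Lemma step_neq0 (e : dir_type) x y (s : int) : x != y ->
  p y - p x = multiple s (val e) -> s != 0.
Proof.
rewrite eq_sym => /p_diff_neq0 + h; rewrite h; apply: contra => /eqP ->.
by rewrite /multiple !mul0r.
Qed.

Lemma line_weight_le1 e x y : x != y -> line_key e x = line_key e y ->
  line_weight e (line_key (perp_dir e) x) (line_key (perp_dir e) y) <= 1.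
Proof.
move=> xy /same_line[s hs]; rewrite (line_weightE hs).
have s0 := step_neq0 xy hs.
rewrite invf_le1 -?intr_norm ?ltr0z ?normr_gt0 // ler1z; lia.
Qed.

(** The term i = 0 vanishes by the convention for the inverse of 0; the others telescope. *)
Lemma sum_inv_sqr n : \sum_(i < n) ((i : nat)%:R ^+ 2)^-1 <= 2 :> R.
Proof.
have h j : \sum_(i < j.+2) ((i : nat)%:R ^+ 2)^-1 <= 2 - (j.+1%:R)^-1 :> R.
  elim: j => [|j IH]; first by rewrite !big_ord_recr big_ord0 /= expr0n invr0 expr1n invr1; lra.
  rewrite big_ord_recr /=; apply: le_trans (lerD IH (lexx _)) _.
  have j0 : 0 < j.+1%:R :> R by rewrite ltr0n.
  have e1 : j.+2%:R = j.+1%:R + 1 :> R by rewrite -natr1.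
  rewrite e1; move: (j.+1%:R) j0 => z z0.
  have z1 : 0 < z + 1 by lra.
  have : (z + 1)^-1 ^+ 2 <= z^-1 * (z + 1)^-1.
    by rewrite expr2 ler_wpM2r ?invr_ge0 ?(ltW z1) // lef_pV2 ?posrE //; lra.
  have -> : z^-1 * (z + 1)^-1 = z^-1 - (z + 1)^-1 by field; rewrite !gt_eqF.
  by rewrite exprVn; lra.
case: n => [|[|n]]; first by rewrite big_ord0.
  by rewrite big_ord1 expr0n invr0.
by apply: le_trans (h n) _; rewrite gerBl invr_ge0.
Qed.

Lemma sum_inv_sqr_inj (P : pred T) (s : T -> nat) : {in P &, injective s} ->
  \sum_(y | P y) ((s y)%:R ^+ 2)^-1 <= 2 :> R.
Proof.
move=> inj; pose n := (\max_y s y)%N.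
have le_n y : (s y < n.+1)%N by rewrite ltnS leq_bigmax.
apply: le_trans (sum_inv_sqr n.+1).
apply: (@sum_inj_le R T 'I_n.+1 P (fun y => Ordinal (le_n y)) (fun i => ((i : nat)%:R ^+ 2)^-1)).
  by move=> x y Px Py [/inj]; apply.
by move=> j; rewrite invr_ge0 sqr_ge0.
Qed.

(** Distinct points of the line have distinct multiples s. Cauchy-Schwarz meets the sum of 1 / s^2,
    at most 2 for each sign, and 2 is the square root of 4. *)
Lemma line_weight_sum (e : dir_type) x (P : pred T) :
  (forall y, P y -> (y != x) && (line_key e y == line_key e x)) ->
  \sum_(y | P y) line_weight e (line_key (perp_dir e) x) (line_key (perp_dir e) y)
    <= 2 * Num.sqrt #|P|%:R.
Proof.
move=> hP; have d0 := direction_sqr_gt0 (dirP e).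
pose s y := (dot (val e) (p y - p x) %/ (sqn (val e)))%Z.
have hs y : P y -> p y - p x = multiple (s y) (val e).
  move=> /hP /andP[_ /eqP h]; have [t ht] := same_line (esym h).
  by rewrite /s ht dot_multiple mulzK // gt_eqF.
rewrite (eq_bigr (fun y => 1 * `|(s y)%:~R|^-1)); last by move=> y Py; rewrite mul1r (line_weightE (hs y Py)).
apply: le_trans (sum_CauchySchwarz_sqrt _ _ _) _.
rewrite (eq_bigr (fun=> 1)); last by move=> y _; rewrite expr1n.
rewrite sumr_const mulrC -[#|_|]/(#|P|); apply: ler_wpM2r; first exact: sqrtr_ge0.
rewrite (_ : 2 = Num.sqrt 4); last by rewrite (_ : 4 = 2 ^+ 2) ?sqrtr_sqr ?normr_nat //; ring.
apply: ler_wsqrtr.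
have inj y y' : P y -> P y' -> s y = s y' -> y = y'.
  move=> Py Py' h; apply: p_inj; apply: (addIr (- p x)); by rewrite (hs y Py) (hs y' Py') h.
rewrite (bigID (fun y => 0 <= s y)) /= (_ : 4 = 2 + 2); last by ring.
by apply: lerD; rewrite (eq_bigr (fun y => (`|s y|%N%:R ^+ 2)^-1)); 
  try (by move=> y _; rewrite exprVn -intr_norm -[`|s y|]abszE);
  apply: sum_inv_sqr_inj => y y'; rewrite !unfold_in => /andP[Py s1] /andP[Py' s2] h;
  apply: inj => //; lia.
Qed.

Variables (f : T -> R) (M : nat).
Hypothesis f_ge0 : forall x, 0 <= f x.
Hypothesis M_gt0 : (0 < M)%N.

(* [resonant] is [x_1 + x_3 = x_2 + x_4] with the order of vertices [(x_1, x_2, (x_3, x_4))];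
   then [|x_1|^2 - |x_2|^2 + |x_3|^2 - |x_4|^2 = 2 (x_4 - x_1) . (x_2 - x_1)]. *)
Definition resonant (q : quad T) := (p q.1.1 + p q.2.1 == p q.1.2 + p q.2.2) &&
  (`|sqn (p q.1.1) - sqn (p q.1.2) + sqn (p q.2.1) - sqn (p q.2.2)| < M%:Z).
Definition energy := \sum_(q | resonant q) prodf f q.
Let n2 := \sum_x f x ^+ 2.

Definition step (z : T * T) := p z.2 - p z.1.
Definition slab (z : T * T) := dot (step z) (p z.1).
Definition content (z : T * T) : nat := gcdn `|(step z).1| `|(step z).2|.
Definition mass (z : T * T) := f z.1 * f z.2.

Lemma mass_ge0 z : 0 <= mass z. Proof. exact: mulr_ge0. Qed.

Lemma n2_sqr : \sum_z mass z ^+ 2 = n2 ^+ 2.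
Proof.
by rewrite expr2 big_distrlr pair_bigA; apply: eq_bigr => z _; rewrite /mass exprMn.
Qed.

Lemma content_gt0 z : step z != 0 -> (0 < content z)%N.
Proof.
rewrite /content gcdn_gt0 !absz_gt0 -negb_and; case: (step z) => a b.
by rewrite xpair_eqE.
Qed.

Lemma content_dvd z x : exists k, dot (step z) x = k * (content z)%:Z.
Proof.
apply/dvdzP; rewrite /content /dot; apply: rpredD; apply: dvdz_mulr.
  exact: dvdz_gcdl.
exact: dvdz_gcdr.
Qed.

Lemma resonant_slab (z z' : T * T) : step z = step z' ->
  sqn (p z.1) - sqn (p z.2) + sqn (p z'.2) - sqn (p z'.1) = (slab z' - slab z) *+ 2.
Proof.
move=> h; have e2 : p z.2 = p z.1 + step z by rewrite /step addrC subrK.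
have e2' : p z'.2 = p z'.1 + step z by rewrite h /step addrC subrK.
rewrite /slab -h e2 e2'; move: (p z.1) (p z'.1) (step z) => [? ?] [? ?] [? ?].
by rewrite /sqn /dot /=; ring.
Qed.

Definition near z z' := (`|slab z - slab z'| *+ 2 < M%:Z)%R.

Lemma energyE : energy = \sum_z \sum_z' ((step z == step z') && near z z')%:R * (mass z * mass z').
Proof.
pose sw (q : quad T) : quad T := (q.1, (q.2.2, q.2.1)).
have swK : involutive sw by case=> ? [].
rewrite /energy (reindex_inj (inv_inj swK)) pair_bigA big_mkcond /=; apply: eq_bigr => -[z z'] _.
rewrite /resonant /prodf /mass /=.
have -> : (p z.1 + p z'.2 == p z.2 + p z'.1) = (step z == step z').
  rewrite -subr_eq0 -[RHS]subr_eq0 -oppr_eq0 /step; congr (_ == _).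
  by move: (p z.1) (p z.2) (p z'.1) (p z'.2) => [? ?] [? ?] [? ?] [? ?]; congr pair => /=; ring.
have [h|_] := eqVneq (step z) (step z'); last by rewrite mul0r.
rewrite /= resonant_slab // /near normrMn distrC.
by case: ifP => _; rewrite ?mul0r // mul1r; ring.
Qed.

(* [slab z - slab z'] is a multiple of the content of the common step, so a pair is near at
   most [M / content + 1] slabs, and Schur's test reduces to pairs in equal slabs. *)
Lemma sum_near_le :
  \sum_z \sum_z' ([&& step z != 0, step z == step z' & near z z'])%:R * (mass z * mass z')
  <= \sum_z \sum_z' ([&& step z != 0, step z == step z' & slab z == slab z'])%:R *
       ((M%:R / (content z)%:R + 1) * (mass z * mass z')).
Proof.
pose sh (j : 'I_(2 * M).+1) : int := (j : nat)%:Z - M%:Z.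
pose key0 z := (step z, slab z).
pose keyj j z := (step z, slab z + sh j * (content z)%:Z).
pose h j z := ((step z != 0) && (`|sh j| * (content z)%:Z *+ 2 < M%:Z)%R)%:R * mass z.
have h0 j z : 0 <= h j z by rewrite mulr_ge0 ?mass_ge0.
apply: le_trans (_ : \sum_j \sum_z \sum_z' (key0 z == keyj j z')%:R * (h j z * h j z') <= _).
  rewrite [X in _ <= X]exchange_big /=; apply: ler_sum => z _.
  rewrite [X in _ <= X]exchange_big /=; apply: ler_sum => z' _.
  case: (boolP [&& _, _ & _]) => [|_]; last by rewrite mul0r sumr_ge0 // => j _; rewrite !mulr_ge0.
  case/and3P=> z0 /eqP zz nr; have z0' : step z' != 0 by rewrite -zz.
  have cc : content z = content z' by rewrite /content zz.
  have [k hk] := content_dvd z (p z.1 - p z'.1).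
  have hk' : slab z - slab z' = k * (content z)%:Z by rewrite -hk dotB /slab zz.
  have g0 := content_gt0 z0.
  move: nr; rewrite /near hk' normrM [`|(content z)%:Z|]ger0_norm // => nr.
  have kM : `|k| < M%:Z.
    have : `|k| * 1 <= `|k| * (content z)%:Z by rewrite ler_wpM2l.
    lia.
  have jlt : (`|(k + M%:Z)%R|%N < (2 * M).+1)%N by lia.
  rewrite (bigD1 (Ordinal jlt)) //=; apply: ler_wpDr.
    by apply: sumr_ge0 => j _; rewrite !mulr_ge0.
  have shk : sh (Ordinal jlt) = k by rewrite /sh /=; lia.
  rewrite /key0 /keyj /h shk -cc xpair_eqE zz eqxx z0' nr /=.
  by rewrite -hk' [_ + (_ - _)]addrC subrK eqxx !mul1r.
apply: le_trans (_ : \sum_j \sum_z \sum_z' (key0 z == key0 z')%:R * (h j z * h j z') <= _).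
  (* Pairs with a common step have a common content, so their shifted slabs agree exactly when the
     slabs do, and both halves of the bound coincide. *)
  apply: ler_sum => j _; apply: le_trans (sum_match_le _ _ _) _.
  rewrite [X in (_ + X) / 2](_ : _ = \sum_z \sum_z' (key0 z == key0 z')%:R * (h j z * h j z')).
    by lra.
  apply: eq_bigr => z _; apply: eq_bigr => z' _; congr ((_ : bool)%:R * _).
  rewrite /keyj /key0 [LHS]xpair_eqE [RHS]xpair_eqE; have [zz|//] := eqVneq (step z) (step z').
  by rewrite /content zz (inj_eq (addIr _)).
rewrite exchange_big /=; apply: ler_sum => z _; rewrite exchange_big /=; apply: ler_sum => z' _.
rewrite /key0 xpair_eqE; have [zz|zz] := eqVneq (step z) (step z'); last first.
  by rewrite big1 ?andbF ?mul0r // => j _; rewrite mul0r.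
have [ss|ss] := eqVneq (slab z) (slab z'); last first.
  by rewrite big1 ?andbF ?mul0r // => j _; rewrite mul0r.
have [z0|z0] := eqVneq (step z) 0.
  by rewrite big1 ?mul0r // => j _; rewrite /h z0 eqxx !mul0r mulr0.
rewrite /= mul1r; apply: le_trans (ler_wpM2r _ (count_near R M (content_gt0 z0))); last first.
  by rewrite mulr_ge0 // mass_ge0.
rewrite mulr_suml; apply: ler_sum => j _.
have cc : content z' = content z by rewrite /content zz.
rewrite /h -zz z0 cc mul1r /=.
by case: (_ < _); rewrite !(mul0r, mul1r).
Qed.

Lemma zero_step_le :
  \sum_z \sum_z' ([&& step z == 0, step z == step z' & near z z'])%:R * (mass z * mass z') <= n2 ^+ 2.
Proof.
pose diag (z : T * T) := (z.1 == z.2)%:R * mass z.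
have step0 z : (step z == 0) = (z.1 == z.2) by rewrite /step subr_eq0 (inj_eq p_inj) eq_sym.
have dsum : \sum_z diag z = \sum_x f x ^+ 2.
  rewrite -(pair_bigA _ (fun x y => diag (x, y))) /=; apply: eq_bigr => x _.
  rewrite (bigD1 x) //= /diag /mass /= eqxx mul1r -expr2 big1 ?addr0 // => y.
  by rewrite eq_sym => /negbTE ->; rewrite mul0r.
apply: le_trans (_ : \sum_z \sum_z' diag z * diag z' <= _).
  apply: ler_sum => z _; apply: ler_sum => z' _.
  have m0 : 0 <= mass z * mass z' by rewrite mulr_ge0 ?mass_ge0.
  rewrite /diag [X in _ <= X]mulrACA -natrM mulnb -!step0.
  have [z0|_] := eqVneq (step z) 0; rewrite /= ?mul0r // eq_sym.
  by rewrite z0; case: (step z' == _); case: (near _ _); rewrite /= ?mul0r ?mul1r.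
by rewrite -big_distrlr /= dsum expr2.
Qed.

(** Equal slabs make the translation between the two pairs orthogonal to their common step, so the
    pairs are opposite sides of a rectangle; since they are distinct, it does not degenerate. *)
Lemma slab_rect z z' : z != z' -> step z != 0 -> step z = step z' -> slab z = slab z' ->
  exists e : dir_type, let q : quad T := ((z.1, z.2), (z'.2, z'.1)) in
    [/\ is_rect line_key perp_dir e q, nondeg q
      & line_weight e (kp line_key perp_dir e z.1) (kp line_key perp_dir e z.2) = (content z)%:R^-1].
Proof.
move=> zn z0 zz ss; have [e [s [de hs sg [e1 e2]]]] := direction_exists z0.
have s_neq0 : s != 0 by apply: contra z0 => /eqP s0; rewrite hs s0 /multiple !mul0r.
have b1 : `|(step z).1| <= (2 * B)%:Z.
  by have [h1 _] := p_le z.1; have [h2 _] := p_le z.2;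
    have -> : (step z).1 = (p z.2).1 - (p z.1).1 by []; lia.
have b2 : `|(step z).2| <= (2 * B)%:Z.
  by have [_ h1] := p_le z.1; have [_ h2] := p_le z.2;
    have -> : (step z).2 = (p z.2).2 - (p z.1).2 by []; lia.
have eD := mem_directions de (le_trans e1 b1) (le_trans e2 b2).
have ht1 : p z.2 - p z.1 = multiple s e by exact: hs.
have ht2 : p z'.2 - p z'.1 = multiple s e by rewrite -hs zz.
have cr x y : p y - p x = multiple s e -> cross e (p x) = cross e (p y).
  by move=> h; apply/esym/eqP; rewrite -subr_eq0 -crossB h /cross /multiple /=; apply/eqP; ring.
have dt : dot e (p z.1) = dot e (p z'.1).
  apply: (mulfI s_neq0); move: ss; rewrite /slab -zz hs /dot /multiple /=.
  by rewrite !mulrDr !mulrA.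
have dt2 : dot e (p z.2) = dot e (p z'.2).
  apply/eqP; rewrite -subr_eq0 -dotB.
  have -> : p z.2 - p z'.2 = p z.1 - p z'.1.
    have -> : p z.2 = multiple s e + p z.1 by rewrite -ht1 subrK.
    have -> : p z'.2 = multiple s e + p z'.1 by rewrite -ht2 subrK.
    by rewrite opprD addrACA subrr add0r.
  by rewrite dotB dt subrr.
have ne x y : p y - p x = multiple s e -> x != y.
  move=> h; apply: contra z0 => /eqP xy; rewrite hs -h xy subrr //.
have n1 : z.1 != z'.1.
  apply: contra zn => /eqP h; rewrite -pair_eqE /= h eqxx /=.
  by apply/eqP/p_inj; apply: (addIr (- p z.1)); rewrite ht1 h ht2.
have n2' : z.2 != z'.2.
  apply: contra zn => /eqP h; rewrite -pair_eqE /= h eqxx andbT.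
  by apply/eqP/p_inj/oppr_inj; apply: (addrI (p z.2)); rewrite ht1 h ht2.
exists (SeqSub eD); split.
- rewrite /is_rect /= !line_key_eq /= !cross_rotate dt dt2 (cr _ _ ht1) (cr _ _ ht2) !eqxx //.
- by rewrite /nondeg /= (ne _ _ ht1) (ne _ _ ht2) n1 n2'.
- by rewrite /kp (@line_weightE _ _ _ s) // -intr_norm sg.
Qed.

Let CW : R := 24 + 4 * CR 2304 * geo (1 / 96) ^+ 2.
Let CU : R := 8000 * 2304 * geo (1 / 8) ^+ 2.
(** The 3 absorbs the zero steps and the coinciding pairs; each 9 is the square of the 3 in
    [sum_level_size_le], and 2304 is the Szemeredi-Trotter constant. *)
Definition energy_const : R := 3 + 9 * CW + 9 * CU.

Let CU_ge0 : 0 <= CU.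
Proof. by apply: mulr_ge0; [rewrite mulr_ge0 | exact: sqr_ge0]. Qed.
Let CW_ge0 : 0 <= CW.
Proof.
rewrite addr_ge0 //; apply: mulr_ge0; last exact: sqr_ge0.
by rewrite mulr_ge0 // /CR; lra.
Qed.

Lemma energy_const_ge0 : 0 <= energy_const.
Proof. by have := CU_ge0; have := CW_ge0; rewrite /energy_const; lra. Qed.

(** The weighted rectangles carry the factor [M] and a bound independent of the number of levels,
    the unweighted ones the factor 1 and a bound proportional to it: hence a sum and not a
    product. *)
Lemma energy_le : energy <= energy_const * (M + (trunc_log 2 #|T|).+1)%:R * n2 ^+ 2.
Proof.
pose m := (trunc_log 2 #|T|).+1.
have D1 : 1 <= 2304 :> R by rewrite ler1n.
have N2le := sum_level_size_le f_ge0; rewrite -/m -/n2 in N2le.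
have N20 : 0 <= N2 m (level_size f) by apply: sumr_ge0 => j _; rewrite sqr_ge0.
have N2sq : N2 m (level_size f) ^+ 2 <= 9 * n2 ^+ 2.
  have -> : 9 * n2 ^+ 2 = (3 * n2) ^+ 2 :> R by ring.
  by apply: lerXn2r; rewrite ?nnegrE // (le_trans N20).
have CU0 := CU_ge0; have CW0 := CW_ge0.
have HU : \sum_e \sum_(q | is_rect line_key perp_dir e q && nondeg q) prodf f q <= CU * m%:R * (9 * n2 ^+ 2).
  apply: le_trans (ler_wpM2l _ N2sq); last by rewrite mulr_ge0.
  exact: (rect_sum_le D1 perp_dirK perp_dir_neq line_key_dir (@grid_few_rich_lines)
     (card_dyadic_level f) (dyadic_level_lt f) isT (level_size_ge0 f_ge0) f_ge0 (le_level_size f_ge0)).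
have HW : \sum_e \sum_(q | is_rect line_key perp_dir e q && nondeg q)
     line_weight e (kp line_key perp_dir e q.1.1) (kp line_key perp_dir e q.1.2) * prodf f q
     <= CW * (9 * n2 ^+ 2).
  apply: le_trans (ler_wpM2l CW0 N2sq).
  exact: (weighted_rect_sum_le D1 perp_dirK perp_dir_neq line_key_dir (@grid_few_rich_lines)
     (card_dyadic_level f) (dyadic_level_lt f) (level_size_ge0 f_ge0) f_ge0 (le_level_size f_ge0)
     line_weight_ge0 line_weight_sym line_weight_le1 line_weight_sum).
have m0 (z z' : T * T) : 0 <= mass z * mass z' by rewrite mulr_ge0 ?mass_ge0.
have split_step : energy <= n2 ^+ 2 + \sum_z \sum_z'
   ([&& step z != 0, step z == step z' & slab z == slab z'])%:R *
       ((M%:R / (content z)%:R + 1) * (mass z * mass z')).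
  apply: le_trans (lerD zero_step_le sum_near_le).
  rewrite energyE -big_split; apply: ler_sum => z _; rewrite -big_split; apply: ler_sum => z' _ /=.
  by case: (step z == 0) => /=; rewrite ?mul0r ?addr0 ?add0r.
have diag_le : \sum_z (M%:R + 1) * mass z ^+ 2 = (M%:R + 1) * n2 ^+ 2.
  by rewrite -mulr_sumr n2_sqr.
have rects_le : \sum_z \sum_z'
   ([&& step z != 0, step z == step z' & slab z == slab z'])%:R *
       ((M%:R / (content z)%:R + 1) * (mass z * mass z'))
   <= \sum_z (M%:R + 1) * mass z ^+ 2 + \sum_e \sum_(q | is_rect line_key perp_dir e q && nondeg q)
     (M%:R * line_weight e (kp line_key perp_dir e q.1.1) (kp line_key perp_dir e q.1.2) + 1) * prodf f q.
  pose G e (q : quad T) := if is_rect line_key perp_dir e q && nondeg q then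
     (M%:R * line_weight e (kp line_key perp_dir e q.1.1) (kp line_key perp_dir e q.1.2) + 1) * prodf f q
     else 0.
  have G0 e q : 0 <= G e q.
    rewrite /G; case: ifP => // _; rewrite mulr_ge0 ?prodf_ge0 // addr_ge0 // mulr_ge0 //.
    exact: line_weight_ge0.
  pose sw (q : quad T) : quad T := (q.1, (q.2.2, q.2.1)).
  have swK : involutive sw by case=> ? [].
  rewrite [X in _ <= _ + X](_ : _ = \sum_z \sum_z' \sum_e G e (sw (z, z'))); last first.
    rewrite pair_bigA exchange_big /=; apply: eq_bigr => e _.
    rewrite big_mkcond (reindex_inj (inv_inj swK)) /=; apply: eq_bigr => -[z z'] _ //.
  rewrite -big_split; apply: ler_sum => z _ /=.
  have [zd|zd] := eqVneq (step z) 0.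
    rewrite big1; last by move=> z' _; rewrite /= mul0r.
    by rewrite addr_ge0 ?mulr_ge0 ?addr_ge0 ?sqr_ge0 // sumr_ge0 // => z' _; rewrite sumr_ge0.
  have c1 : (content z)%:R^-1 <= 1 :> R by rewrite invf_le1 ?ler1n ?ltr0n ?content_gt0.
  rewrite (bigD1 z) //= eqxx eqxx mul1r; apply: lerD.
    rewrite -expr2; apply: ler_wpM2r; first exact: sqr_ge0.
    by rewrite lerD2r ler_piMr.
  rewrite [X in _ <= X](bigD1 z) //=; apply: ler_wpDl; first by rewrite sumr_ge0.
  apply: ler_sum => z' zz'.
  have [hs|_] := eqVneq (step z) (step z'); last by rewrite mul0r sumr_ge0.
  have [hl|_] := eqVneq (slab z) (slab z'); last by rewrite mul0r sumr_ge0.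
  rewrite eq_sym in zz'; have [e /= [h1 h2 h3]] := slab_rect zz' zd hs hl.
  rewrite (bigD1 e) //=; apply: ler_wpDr; first by rewrite sumr_ge0.
  rewrite /G /sw /= -!surjective_pairing in h1 h2 h3 *.
  rewrite mul1r h1 h2 h3 le_eqVlt; apply/orP; left; apply/eqP.
  by rewrite /prodf /mass /=; ring.
have weights : \sum_e \sum_(q | is_rect line_key perp_dir e q && nondeg q)
     (M%:R * line_weight e (kp line_key perp_dir e q.1.1) (kp line_key perp_dir e q.1.2) + 1) * prodf f q
   <= M%:R * (CW * (9 * n2 ^+ 2)) + CU * m%:R * (9 * n2 ^+ 2).
  apply: le_trans (lerD (ler_wpM2l (ler0n R M) HW) HU).
  rewrite mulr_sumr -big_split; apply: ler_sum => e _.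
  rewrite /= mulr_sumr -big_split; apply: ler_sum => q _ /=.
  by rewrite mulrDl mul1r -mulrA.
have M1 : 1 <= M%:R :> R by rewrite ler1n.
have m1 : 1 <= m%:R :> R by rewrite ler1n.
have s0 : 0 <= n2 ^+ 2 by apply: sqr_ge0.
rewrite diag_le in rects_le; rewrite /energy_const natrD -/m.
have := ler_wpM2r s0 M1; have := ler_wpM2r s0 m1.
have := mulr_ge0 CW0 (mulr_ge0 (ler0n R m) s0); have := mulr_ge0 CU0 (mulr_ge0 (ler0n R M) s0).
lra.
Qed.
End Grid.

From HB Require Import structures.
From mathcomp Require Import finmap.
From mathcomp Require Import all_classical all_reals all_analysis.
From mathcomp Require Import measurable_realfun.
Import numFieldNormedType.Exports.
Local Open Scope classical_set_scope.

(** * Integrals of trigonometric polynomials *)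

Section BoundedMeasurable.
Variables (R : realType) (d : measure_display) (T : measurableType d).
Variable mu : {measure set T -> \bar R}.
Implicit Types f g : T -> R.

(** A class closed under sums and products that contains the trigonometric integrands and is
    integrable on every set of finite measure. *)
Definition bounded_measurable f :=
  measurable_fun [set: T] f /\ exists C, forall x, `|f x| <= C.

Lemma bm_cst c : bounded_measurable (fun=> c).
Proof. by split; [exact: measurable_cst | exists `|c|]. Qed.

Lemma bm_add f g : bounded_measurable f -> bounded_measurable g ->
  bounded_measurable (fun x => f x + g x).
Proof.
move=> [mf [C hC]] [mg [D hD]]; split; first exact: measurable_funD.
by exists (C + D) => x; apply: le_trans (ler_normD _ _) _; apply: lerD.
Qed.

Lemma bm_mul f g : bounded_measurable f -> bounded_measurable g ->
  bounded_measurable (fun x => f x * g x).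
Proof.
move=> [mf [C hC]] [mg [D hD]]; split; first exact: measurable_funM.
by exists (C * D) => x; rewrite normrM; apply: ler_pM.
Qed.

Lemma bm_sum (I : finType) (F : I -> T -> R) : (forall i, bounded_measurable (F i)) ->
  bounded_measurable (fun x => \sum_i F i x).
Proof.
move=> hF; elim: (index_enum I) => [|i s IH].
  by under [X in bounded_measurable X]eq_fun do rewrite big_nil; exact: bm_cst.
by under [X in bounded_measurable X]eq_fun do rewrite big_cons; apply: bm_add.
Qed.

Lemma bm_cos f : measurable_fun [set: T] f -> bounded_measurable (fun x => cos (f x)).
Proof.
move=> mf; split; last by exists 1 => x; exact: cos_max.
by apply: measurableT_comp => //; apply: continuous_measurable_fun; exact: continuous_cos.
Qed.

Lemma bm_sin f : measurable_fun [set: T] f -> bounded_measurable (fun x => sin (f x)).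
Proof.
move=> mf; split; last by exists 1 => x; exact: sin_max.
by apply: measurableT_comp => //; apply: continuous_measurable_fun; exact: continuous_sin.
Qed.

Variable D : set T.
Hypotheses (mD : measurable D) (Dfin : (mu D < +oo)%E).

Lemma bm_integrable f : bounded_measurable f -> mu.-integrable D (EFin \o f).
Proof.
move=> [mf [C hC]]; apply: measurable_bounded_integrable => //.
  exact: measurable_funTS.
exists C; split; first exact: num_real.
by move=> y Cy x _; exact: le_trans (hC x) (ltW Cy).
Qed.

Lemma integrable_Radd f g : mu.-integrable D (EFin \o f) -> mu.-integrable D (EFin \o g) ->
  mu.-integrable D (EFin \o (fun x => f x + g x)).
Proof.
move=> hf hg.
have -> : EFin \o (fun x => f x + g x) = ((EFin \o f) \+ (EFin \o g))%E by [].
exact: integrableD.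
Qed.

Lemma integrable_Rscale c f : mu.-integrable D (EFin \o f) ->
  mu.-integrable D (EFin \o (fun x => c * f x)).
Proof.
move=> hf; have -> : EFin \o (fun x => c * f x) = (fun x => c%:E * (EFin \o f) x)%E by [].
exact: integrableZl.
Qed.

Lemma integrable_Rdom f g : measurable_fun D f -> (forall x, `|f x| <= g x) ->
  mu.-integrable D (EFin \o g) -> mu.-integrable D (EFin \o f).
Proof.
move=> mf fg; apply: le_integrable => //; first exact/measurable_EFinP.
by move=> x _; rewrite /= lee_fin; apply: le_trans (fg x) (ler_norm _).
Qed.

Lemma integrable_Rsum (I : Type) (s : seq I) (F : I -> T -> R) :
  (forall i, mu.-integrable D (EFin \o F i)) ->
  mu.-integrable D (EFin \o (fun x => \sum_(i <- s) F i x)) /\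
  Rintegral mu D (fun x => \sum_(i <- s) F i x) = \sum_(i <- s) Rintegral mu D (F i).
Proof.
move=> hF; elim: s => [|i s [IH1 IH2]].
  have e : (fun x => \sum_(i <- [::]) F i x) = (fun=> 0) by apply/funext => x; rewrite big_nil.
  rewrite e big_nil Rintegral_cst // mul0r; split => //.
  exact: (bm_integrable (bm_cst 0)).
have e : (fun x => \sum_(j <- i :: s) F j x) = (fun x => F i x + \sum_(j <- s) F j x).
  by apply/funext => x; rewrite big_cons.
rewrite e big_cons -IH2 RintegralD //; split => //.
exact: integrable_Radd.
Qed.

Lemma Rintegral_sum (I : finType) (F : I -> T -> R) : (forall i, bounded_measurable (F i)) ->
  Rintegral mu D (fun x => \sum_i F i x) = \sum_i Rintegral mu D (F i).
Proof. by move=> hF; apply: (integrable_Rsum _ _).2 => i; exact: bm_integrable. Qed.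

Lemma bm_RintegralZl f c : bounded_measurable f ->
  Rintegral mu D (fun x => c * f x) = c * Rintegral mu D f.
Proof. by move=> hf; rewrite RintegralZl //; exact: bm_integrable. Qed.
End BoundedMeasurable.

Lemma product_sigma_finite (R : realType) (d1 d2 : measure_display)
    (T1 : measurableType d1) (T2 : measurableType d2)
    (m1 : {sigma_finite_measure set T1 -> \bar R}) (m2 : {sigma_finite_measure set T2 -> \bar R}) :
  sigma_finite [set: T1 * T2] (m1 \x m2)%E.
Proof.
have /sigma_finiteP[F [TF ndF Foo]] := sigma_finiteT m1.
have /sigma_finiteP[G [TG ndG Goo]] := sigma_finiteT m2.
exists (fun n => F n `*` G n).
  apply/esym/seteqP; split => // -[x y] _.
  have : (\bigcup_i F i) x by rewrite -TF.
  have : (\bigcup_i G i) y by rewrite -TG.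
  move=> [k _ Gky] [n _ Fnx]; exists (maxn n k) => //; split.
    by move: x Fnx; exact/subsetPset/ndF/leq_maxl.
  by move: y Gky; exact/subsetPset/ndG/leq_maxr.
move=> k; have [mF fF] := Foo k; have [mG fG] := Goo k; split; first exact: measurableX.
by rewrite product_measure1E // lte_mul_pinfty // ge0_fin_numE.
Qed.

(* A named copy of the product measure: the library's canonical sigma-finite structure on
   products is not found for [lebesgue_measure]. *)
Definition torus_measure (R : realType) :=
  (@lebesgue_measure R \x @lebesgue_measure R)%E.
HB.instance Definition _ (R : realType) := Measure.on (@torus_measure R).
HB.instance Definition _ (R : realType) :=
  Measure_isSigmaFinite.Build _ _ _ (@torus_measure R)
    (product_sigma_finite (@lebesgue_measure R) (@lebesgue_measure R)).

(** Integrable sections make the inner integrals finite, so that [fine] can be moved inside Fubini's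
    theorem. *)
Lemma Rintegral_prod (R : realType) (d1 d2 : measure_display)
    (T1 : measurableType d1) (T2 : measurableType d2)
    (m1 : {sigma_finite_measure set T1 -> \bar R}) (m2 : {sigma_finite_measure set T2 -> \bar R})
    (A : set T1) (B : set T2) (f : T1 * T2 -> R) :
  measurable A -> measurable B -> (m1 \x m2)%E.-integrable (A `*` B) (EFin \o f) ->
  (forall x, A x -> m2.-integrable B (EFin \o (fun y => f (x, y)))) ->
  Rintegral (m1 \x m2)%E (A `*` B) f
    = Rintegral m1 A (fun x => Rintegral m2 B (fun y => f (x, y))).
Proof.
move=> mA mB if12 if2; rewrite /Rintegral; congr fine.
have mAB : measurable (A `*` B) by exact: measurableX.
rewrite integral_mkcond -integral12_prod_meas1; last first.
  by apply/integrable_restrict => //; rewrite setTI.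
rewrite [RHS]integral_mkcond; apply: eq_integral => x _; rewrite /fubini_F patchE.
case: ifPn => [/set_mem xA|/negP xA].
  rewrite fineK; last by apply: integrable_fin_num => //; exact: if2.
  rewrite [RHS]integral_mkcond; apply: eq_integral => y _; rewrite !patchE.
  by congr (if _ then _ else _); rewrite in_setX (mem_set xA).
apply: integral0_eq => y _; rewrite patchE in_setX.
by case: (boolP (x \in A)) => // /xA.
Qed.

Section TrigIntegrals.
Variable R : realType.
Local Notation leb := (@lebesgue_measure R).
Local Notation leb2 := (leb \x leb)%E.
Local Notation leb3 := ((leb \x leb) \x leb)%E.
Local Notation J := (`[0, 2 * pi]%classic : set R).

Let pi2_gt0 : 0 < 2 * pi :> R. Proof. by rewrite mulr_gt0 // pi_gt0. Qed.

Lemma measure_itv0 (t : R) : 0 <= t -> leb `[0, t]%classic = t%:E.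
Proof.
by move=> t0; rewrite lebesgue_measure_itv /= lte_fin oppr0 adde0; case: ltgtP t0 => // <-.
Qed.

Lemma sinD2pin (x : R) (n : nat) : sin (x + 2 * pi *+ n) = sin x.
Proof.
have -> : 2 * pi *+ n = pi *+ 2 *+ n :> R by rewrite mulr_natl.
exact: (periodicn (@sinD2pi R)).
Qed.

Lemma sinD2piz (x : R) (k : int) : sin (k%:~R * (2 * pi) + x) = sin x.
Proof.
rewrite addrC mulrzl; case: k => n; first exact: sinD2pin.
by rewrite NegzE mulrNz -[LHS](sinD2pin _ n.+1) subrK.
Qed.

Lemma Rintegral_cos1 (k : int) (c : R) :
  Rintegral leb J (fun t => cos (k%:~R * t + c)) = (k == 0)%:R * (2 * pi) * cos c.
Proof.
have [->|k0] := eqVneq k 0.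
  under eq_Rintegral do rewrite mul0r add0r.
  by rewrite Rintegral_cst //= measure_itv0 ?(ltW pi2_gt0) //= mul1r mulrC.
have kR : k%:~R != 0 :> R by rewrite intr_eq0.
pose g (t : R) : R := k%:~R * t + c.
pose F (t : R) : R := k%:~R^-1 * sin (g t).
have dg t : is_derive t (1 : R) g k%:~R.
  by apply: is_derive_eq; rewrite !(mul0r, addr0, mulr1, scaler0, scale0r, add0r) -[RHS]mulr1.
have dF t : is_derive t (1 : R) F (cos (g t)).
  have := is_deriveZ (k%:~R^-1 : R) (is_derive1_comp (is_derive_sin (g t)) (dg t)).
  by move=> h; apply: (is_derive_eq h); rewrite /GRing.scale /= mulrC mulfK.
have cF t : {for t, continuous F}.
  by apply: differentiable_continuous; apply/derivable1_diffP; apply: ex_derive.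
have cg t : {for t, continuous g}.
  by apply: differentiable_continuous; apply/derivable1_diffP; apply: ex_derive.
rewrite /Rintegral (@continuous_FTC2 _ _ F) //=.
- by rewrite /F /g sinD2piz mulr0 add0r subrr mul0r mul0r.
- apply: continuous_in_subspaceT => x _; apply: continuous_comp; first exact: cg.
  exact: continuous_cos.
- split=> [x _| |].
  + exact: ex_derive.
  + by apply: cvg_at_right_filter; exact: cF.
  + by apply: cvg_at_left_filter; exact: cF.
- by move=> t _; rewrite derive1E; apply: derive_val.
Qed.

Lemma measurable_torus_box : measurable (@torus_box R).
Proof. by apply: measurableX; exact: measurable_itv. Qed.

Lemma measure_torus_box : leb2 (@torus_box R) = ((2 * pi) ^+ 2)%:E.
Proof.
rewrite /torus_box product_measure1E //.
by rewrite [X in (X * _)%E]measure_itv0 ?[X in (_ * X)%E]measure_itv0 ?(ltW pi2_gt0) // -EFinM expr2.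
Qed.

Lemma torus_box_finite : (leb2 (@torus_box R) < +oo)%E.
Proof. by rewrite measure_torus_box ltry. Qed.

Lemma cylinder_finite (t : R) : 0 <= t -> (leb3 (@torus_box R `*` `[0%R, t]%classic)%classic < +oo)%E.
Proof.
move=> t0; rewrite product_measure1E //; last exact: measurable_torus_box.
by rewrite [X in (X * _)%E]measure_torus_box [X in (_ * X)%E]measure_itv0 // -EFinM ltry.
Qed.

Lemma measurable_cylinder (t : R) : measurable (@torus_box R `*` `[0, t]).
Proof. by apply: measurableX; [exact: measurable_torus_box | exact: measurable_itv]. Qed.

Lemma J_finite : (leb J < +oo)%E.
Proof. by rewrite measure_itv0 ?ltry // ltW. Qed.

Lemma measurable_addr (d : measure_display) (T : measurableType d) (f g : T -> R) :
  measurable_fun [set: T] f -> measurable_fun [set: T] g ->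
  measurable_fun [set: T] (fun x => f x + g x).
Proof. exact: measurable_funD. Qed.

Lemma measurable_scale (d : measure_display) (T : measurableType d) (k : R) (f : T -> R) :
  measurable_fun [set: T] f -> measurable_fun [set: T] (fun x => k * f x).
Proof. by move=> mf; exact: measurable_funM. Qed.

Lemma measurable_zdot (xi : int * int) : measurable_fun [set: R * R] (zdot xi).
Proof. by apply: measurable_funD; apply: measurable_funM. Qed.

Lemma measurable_affine (k c : R) : measurable_fun [set: R] (fun t => k * t + c).
Proof. by apply: measurable_addr => //; exact: (measurable_scale _ (@measurable_id _ _ setT)). Qed.

Lemma Rintegral_cos2 (xi : int * int) (c : R) :
  Rintegral leb2 (@torus_box R) (fun x => cos (zdot xi x + c))
    = (xi == 0)%:R * (2 * pi) ^+ 2 * cos c.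
Proof.
have bm : bounded_measurable (fun x : R * R => cos (zdot xi x + c)).
  by apply: bm_cos; apply: measurable_addr => //; exact: measurable_zdot.
rewrite Rintegral_prod //; last 2 first.
- by apply: bm_integrable => //; [exact: measurable_torus_box|exact: torus_box_finite].
- move=> x _; apply: bm_integrable; [exact: measurable_itv|exact: J_finite|].
  apply: bm_cos; rewrite [X in measurable_fun _ X](_ : _ =
    (fun y : R => xi.2%:~R * y + (xi.1%:~R * x + c))); first exact: measurable_affine.
  by apply/funext => y; rewrite /zdot /=; ring.
transitivity (Rintegral leb J (fun t => (xi.2 == 0)%:R * (2 * pi) * cos (xi.1%:~R * t + c))).
  apply: eq_Rintegral => x _; rewrite -Rintegral_cos1.
  by apply: eq_Rintegral => y _; congr cos; rewrite /zdot /=; ring.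
rewrite bm_RintegralZl; [|exact: measurable_itv|exact: J_finite|]; last first.
  by apply: bm_cos; exact: measurable_affine.
have -> : (xi == 0) = (xi.1 == 0) && (xi.2 == 0) by case: (xi).
rewrite Rintegral_cos1 expr2; by case: (xi.1 == 0); case: (xi.2 == 0); rewrite /= ?mul0r ?mulr0 ?mul1r // !mulrA.
Qed.

Lemma Rintegral_cos3 (xi : int * int) (n : int) (c : R) :
  Rintegral leb3 (@torus_box R `*` J) (fun p => cos (zdot xi p.1 + n%:~R * p.2 + c))
    = ((xi == 0) && (n == 0))%:R * (2 * pi) ^+ 3 * cos c.
Proof.
have bm : bounded_measurable (fun p : R * R * R => cos (zdot xi p.1 + n%:~R * p.2 + c)).
  apply: bm_cos; apply: measurable_addr => //; apply: measurable_addr => //.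
    by apply: measurableT_comp; [exact: measurable_zdot | exact: measurable_fst].
  by apply: measurable_scale => //; exact: measurable_snd.
transitivity (Rintegral leb2 (@torus_box R) (fun x => (n == 0)%:R * (2 * pi) * cos (zdot xi x + c))).
  rewrite (Rintegral_prod (m1 := @torus_measure R) (m2 := leb) (A := @torus_box R) (B := J)); first last.
  - move=> x _; apply: bm_integrable; [exact: measurable_itv|exact: J_finite|].
    apply: bm_cos; rewrite [X in measurable_fun _ X](_ : _ =
      (fun y : R => n%:~R * y + (zdot xi x + c))); first exact: measurable_affine.
    by apply/funext => y; rewrite /=; ring.
  - by apply: bm_integrable => //; [exact: measurable_cylinder|exact/cylinder_finite/ltW].
  - exact: measurable_itv.
  - exact: measurable_torus_box.
  apply: eq_Rintegral => x _; rewrite -Rintegral_cos1.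
  by apply: eq_Rintegral => y _; congr cos; rewrite /=; ring.
rewrite bm_RintegralZl; [|exact: measurable_torus_box|exact: torus_box_finite|]; last first.
  by apply: bm_cos; apply: measurable_addr => //; exact: measurable_zdot.
rewrite Rintegral_cos2 (exprS _ 2).
by case: (xi == 0); case: (n == 0); rewrite /= ?mul0r ?mulr0 ?mul1r // !mulrA.
Qed.

(** The squared modulus of the exponential sum with moduli [rho] and arguments [alpha]. *)
Definition sqnorm_trig (I : finType) (rho alpha : I -> R) : R :=
  (\sum_i rho i * cos (alpha i)) ^+ 2 + (\sum_i rho i * sin (alpha i)) ^+ 2.

Lemma sqnorm_trigE (I : finType) (rho alpha : I -> R) :
  sqnorm_trig rho alpha = \sum_i \sum_j rho i * rho j * cos (alpha i - alpha j).
Proof.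
rewrite /sqnorm_trig !expr2 !big_distrlr -big_split; apply: eq_bigr => i _ /=.
by rewrite -big_split; apply: eq_bigr => j _ /=; rewrite cosB; ring.
Qed.

(** The modulus is multiplicative, so a product of exponential sums is again one, over pairs of
    indices. *)
Lemma sqnorm_trigM (I J : finType) (rho alpha : I -> R) (sigma beta : J -> R) :
  sqnorm_trig rho alpha * sqnorm_trig sigma beta =
  sqnorm_trig (fun z : I * J => rho z.1 * sigma z.2) (fun z => alpha z.1 + beta z.2).
Proof.
rewrite /sqnorm_trig.
set C := \sum_i _; set D := \sum_i _; set C' := \sum_i _; set D' := \sum_i _.
have -> : \sum_(z : I * J) rho z.1 * sigma z.2 * cos (alpha z.1 + beta z.2) = C * C' - D * D'.
  rewrite -(pair_bigA _ (fun i j => rho i * sigma j * cos (alpha i + beta j))) /=.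
  rewrite !big_distrlr -sumrB; apply: eq_bigr => i _; rewrite /= -sumrB; apply: eq_bigr => j _.
  by rewrite cosD; ring.
have -> : \sum_(z : I * J) rho z.1 * sigma z.2 * sin (alpha z.1 + beta z.2) = C * D' + D * C'.
  rewrite -(pair_bigA _ (fun i j => rho i * sigma j * sin (alpha i + beta j))) /=.
  rewrite !big_distrlr -big_split; apply: eq_bigr => i _; rewrite /= -big_split; apply: eq_bigr => j _.
  by rewrite /= sinD; ring.
ring.
Qed.

Lemma polar_form (a b : R) : exists psi, a = Num.sqrt (a ^+ 2 + b ^+ 2) * cos psi /\
  b = Num.sqrt (a ^+ 2 + b ^+ 2) * sin psi.
Proof.
set r := Num.sqrt _.
have s0 : 0 <= a ^+ 2 + b ^+ 2 by rewrite addr_ge0 ?sqr_ge0.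
have r2 : r ^+ 2 = a ^+ 2 + b ^+ 2 by rewrite sqr_sqrtr.
have [r0|r0] := eqVneq r 0.
  have : a ^+ 2 + b ^+ 2 = 0 by rewrite -r2 r0 expr0n.
  move/eqP; rewrite paddr_eq0 ?sqr_ge0 // !sqrf_eq0 => /andP[/eqP -> /eqP ->].
  by exists 0; rewrite r0 !mul0r.
have rp : 0 < r by rewrite lt_neqAle eq_sym r0 sqrtr_ge0.
pose x := a / r.
have hx : x ^+ 2 <= 1.
  by rewrite /x expr_div_n ler_pdivrMr ?exprn_gt0 // mul1r r2 lerDl sqr_ge0.
have x1 : -1 <= x <= 1 by rewrite -ler_norml -(@ler_pXn2r _ 2) ?nnegrE // expr1n real_normK ?num_real.
have ha : a = r * x by rewrite /x mulrC divfK.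
have hb : b ^+ 2 = r ^+ 2 * (1 - x ^+ 2) by rewrite mulrBr mulr1 -exprMn -ha r2; ring.
have hs : sin (acos x) = Num.sqrt (1 - x ^+ 2) by rewrite sin_acos.
have hrs : r * sin (acos x) = `|b|.
  by rewrite hs -sqrtr_sqr hb sqrtrM ?sqr_ge0 // sqrtr_sqr ger0_norm // ltW.
have hc : cos (acos x) = x by rewrite acosK // in_itv.
have [b0|b0] := leP 0 b.
  by exists (acos x); rewrite hc -ha hrs ger0_norm.
by exists (- acos x); rewrite cosN hc -ha sinN mulrN hrs ltr0_norm // opprK.
Qed.

Lemma zdot_sub (xi xi' : int * int) (x : R * R) : zdot (xi - xi') x = zdot xi x - zdot xi' x.
Proof.
have e1 : (xi - xi').1 = xi.1 - xi'.1 by []. have e2 : (xi - xi').2 = xi.2 - xi'.2 by [].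
by rewrite /zdot e1 e2 !intrB; ring.
Qed.

Lemma Rintegral_sqnorm2 (I : finType) (rho c : I -> R) (p : I -> int * int) :
  injective p ->
  Rintegral leb2 (@torus_box R) (fun x => sqnorm_trig rho (fun i => zdot (p i) x + c i))
    = (2 * pi) ^+ 2 * \sum_i rho i ^+ 2.
Proof.
move=> p_inj.
have zdotB i j x : zdot (p i) x + c i - (zdot (p j) x + c j) = zdot (p i - p j) x + (c i - c j) :> R.
  by rewrite zdot_sub ?intrB; ring.
have bm i j : bounded_measurable (fun x => cos (zdot (p i - p j) x + (c i - c j)) : R).
  by apply: bm_cos; apply: measurable_addr => //; exact: measurable_zdot.
transitivity (Rintegral leb2 (@torus_box R) (fun x => \sum_i \sum_j rho i * rho j *
    cos (zdot (p i - p j) x + (c i - c j)))).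
  apply: eq_Rintegral => x _; rewrite sqnorm_trigE; apply: eq_bigr => i _; apply: eq_bigr => j _.
  by rewrite zdotB.
have bm2 i j : bounded_measurable (fun x => rho i * rho j * cos (zdot (p i - p j) x + (c i - c j))).
  by apply: bm_mul => //; exact: bm_cst.
rewrite Rintegral_sum; [|exact: measurable_torus_box|exact: torus_box_finite|]; last first.
  by move=> i; apply: bm_sum => j; exact: bm2.
rewrite mulr_sumr; apply: eq_bigr => i _.
rewrite Rintegral_sum; [|exact: measurable_torus_box|exact: torus_box_finite|exact: bm2].
rewrite (bigD1 i) //= big1 ?addr0.
  rewrite bm_RintegralZl; [|exact: measurable_torus_box|exact: torus_box_finite|exact: bm].
  by rewrite Rintegral_cos2 !subrr eqxx cos0 mul1r mulr1 mulrC.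
move=> j ji; rewrite bm_RintegralZl; [|exact: measurable_torus_box|exact: torus_box_finite|exact: bm].
by rewrite Rintegral_cos2 subr_eq0 (inj_eq p_inj) eq_sym (negbTE ji) !mul0r mulr0.
Qed.

Lemma bm_sqnorm3 (I : finType) (rho c : I -> R) (p : I -> int * int) (n : I -> int) :
  bounded_measurable (fun q : R * R * R =>
    sqnorm_trig rho (fun i => zdot (p i) q.1 + (n i)%:~R * q.2 + c i)).
Proof.
have mm i : measurable_fun [set: R * R * R] (fun q => zdot (p i) q.1 + (n i)%:~R * q.2 + c i).
  apply: measurable_addr => //; apply: measurable_addr.
    by apply: measurableT_comp; [exact: measurable_zdot | exact: measurable_fst].
  by apply: measurable_scale; exact: measurable_snd.
apply: bm_add; apply: bm_mul; apply: bm_sum => i; apply: bm_mul;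
  by [exact: bm_cst | exact: bm_cos | exact: bm_sin].
Qed.

(** Only terms whose frequencies agree in space and time survive. Their phases may still differ,
    hence an inequality, with the cosine bounded by 1 and nonnegative [rho]. *)
Lemma Rintegral_sqnorm3 (I : finType) (rho c : I -> R) (p : I -> int * int) (n : I -> int) :
  (forall i, 0 <= rho i) ->
  Rintegral leb3 (@torus_box R `*` J)
    (fun q => sqnorm_trig rho (fun i => zdot (p i) q.1 + (n i)%:~R * q.2 + c i))
    <= (2 * pi) ^+ 3 * \sum_i \sum_j ((p i == p j) && (n i == n j))%:R * (rho i * rho j).
Proof.
move=> rho0.
have zdotB i j q : zdot (p i) q.1 + (n i)%:~R * q.2 + c i - (zdot (p j) q.1 + (n j)%:~R * q.2 + c j)
    = zdot (p i - p j) q.1 + (n i - n j)%:~R * q.2 + (c i - c j) :> R.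
  by rewrite zdot_sub ?intrB; ring.
have bm i j : bounded_measurable (fun q : R * R * R => cos (zdot (p i - p j) q.1 + (n i - n j)%:~R * q.2 + (c i - c j)) : R).
  apply: bm_cos; apply: measurable_addr => //; apply: measurable_addr.
    by apply: measurableT_comp; [exact: measurable_zdot | exact: measurable_fst].
  by apply: measurable_scale; exact: measurable_snd.
rewrite (_ : Rintegral _ _ _ = Rintegral leb3 (@torus_box R `*` J) (fun q => \sum_i \sum_j rho i * rho j *
    cos (zdot (p i - p j) q.1 + (n i - n j)%:~R * q.2 + (c i - c j)))); last first.
  apply: eq_Rintegral => x _; rewrite sqnorm_trigE; apply: eq_bigr => i _; apply: eq_bigr => j _.
  by rewrite zdotB.
have bm2 i j : bounded_measurable (fun q : R * R * R => rho i * rho j * cos (zdot (p i - p j) q.1 + (n i - n j)%:~R * q.2 + (c i - c j))).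
  by apply: bm_mul => //; exact: bm_cst.
have mC := measurable_cylinder (2 * pi); have fC := cylinder_finite (ltW pi2_gt0).
rewrite Rintegral_sum; [|exact: mC|exact: fC|by move=> i; apply: bm_sum => j; exact: bm2].
rewrite mulr_sumr; apply: ler_sum => i _; rewrite Rintegral_sum; [|exact: mC|exact: fC|exact: bm2].
rewrite mulr_sumr; apply: ler_sum => j _.
rewrite bm_RintegralZl; [|exact: mC|exact: fC|exact: bm].
rewrite Rintegral_cos3 !subr_eq0.
have P0 : 0 <= (2 * pi) ^+ 3 :> R by rewrite exprn_ge0 // ltW.
have r0 : 0 <= rho i * rho j by rewrite mulr_ge0.
case: (_ && _); last by rewrite !mul0r !mulr0.
by rewrite !mul1r mulrC -mulrA ler_wpM2l // ler_piMl // cos_le1.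
Qed.

(** * Bessel's inequality *)

Section Bessel.
Variables (T : finType) (p : T -> int * int) (u v : R * R -> R).
Hypothesis p_inj : injective p.
Hypothesis uv : L2_torus u v.
Local Notation box := (@torus_box R).
Let a i := fourier_re u v (p i).
Let b i := fourier_im u v (p i).
Let mass := Rintegral leb2 box (fun x => u x ^+ 2 + v x ^+ 2).

Let mbox : measurable box. Proof. exact: measurable_torus_box. Qed.
Let fbox : (leb2 box < +oo)%E. Proof. exact: torus_box_finite. Qed.

Let int_sq : leb2.-integrable box (EFin \o (fun x => u x ^+ 2 + v x ^+ 2)).
Proof. by have [_ [_ h]] := uv. Qed.

Let int_dom (h : R * R -> R) : measurable_fun box h ->
  (forall x, `|h x| <= 2 + (u x ^+ 2 + v x ^+ 2)) -> leb2.-integrable box (EFin \o h).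
Proof.
move=> mh hle; apply: integrable_Rdom; [exact: mbox|exact: mh|exact: hle|].
apply: integrable_Radd; [exact: mbox| |exact: int_sq].
by apply: bm_integrable; [exact: mbox|exact: fbox|exact: bm_cst].
Qed.

Let abs_le (s t x y : R) : `|s| <= 1 -> `|t| <= 1 -> `|x * s + y * t| <= 2 + (x ^+ 2 + y ^+ 2).
Proof.
move=> s1 t1; apply: le_trans (ler_normD _ _) _; rewrite !normrM.
have h1 : `|x| * `|s| <= `|x| by rewrite ler_piMr.
have h2 : `|y| * `|t| <= `|y| by rewrite ler_piMr.
have h3 : `|x| <= 1 + x ^+ 2 by rewrite -(real_normK (num_real x)); have := sqr_ge0 (`|x| - 1/2); lra.
have h4 : `|y| <= 1 + y ^+ 2 by rewrite -(real_normK (num_real y)); have := sqr_ge0 (`|y| - 1/2); lra.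
lra.
Qed.

Let mu_ : measurable_fun box u. Proof. by have [] := uv. Qed.
Let mv_ : measurable_fun box v. Proof. by have [_ []] := uv. Qed.

Let mcos i : measurable_fun box (fun x => cos (zdot (p i) x)).
Proof.
apply: measurable_funTS; exact: (bm_cos (measurable_zdot (p i))).1.
Qed.
Let msin i : measurable_fun box (fun x => sin (zdot (p i) x)).
Proof.
apply: measurable_funTS; exact: (bm_sin (measurable_zdot (p i))).1.
Qed.

Let int_re i : leb2.-integrable box
  (EFin \o (fun x => u x * cos (zdot (p i) x) + v x * sin (zdot (p i) x))).
Proof.
apply: int_dom => [|x]; last by apply: abs_le; [exact: cos_max | exact: sin_max].
by apply: measurable_funD; apply: measurable_funM.
Qed.
Let int_im i : leb2.-integrable box
  (EFin \o (fun x => v x * cos (zdot (p i) x) - u x * sin (zdot (p i) x))).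
Proof.
apply: int_dom => [|x].
  by apply: measurable_funB; apply: measurable_funM.
by rewrite -mulrN [X in 2 + X]addrC; apply: abs_le; rewrite ?normrN; [exact: cos_max | exact: sin_max].
Qed.

(** For the partial Fourier sum g the pointwise bound of 2 Re(phi conj(g)) by |phi|^2 + |g|^2 is
    integrated; the integrals of phi conj(g) and |g|^2 are the same multiple of the sum of
    squares. *)
Lemma bessel : \sum_i (a i ^+ 2 + b i ^+ 2) <= (2 * pi) ^- 2 * mass.
Proof.
have P0 : 0 < (2 * pi) ^+ 2 :> R by rewrite exprn_gt0.
pose r i := Num.sqrt (a i ^+ 2 + b i ^+ 2).
have [psi hpsi] : {psi : T -> R & forall i, a i = r i * cos (psi i) /\ b i = r i * sin (psi i)}.
  by apply: (@choice _ _ (fun i t => a i = r i * cos t /\ b i = r i * sin t)) => i; exact: polar_form.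
have r2 i : r i ^+ 2 = a i ^+ 2 + b i ^+ 2 by rewrite sqr_sqrtr // addr_ge0 ?sqr_ge0.
pose G x := sqnorm_trig r (fun i => zdot (p i) x + psi i).
pose H i x := a i * (u x * cos (zdot (p i) x) + v x * sin (zdot (p i) x))
   + b i * (v x * cos (zdot (p i) x) - u x * sin (zdot (p i) x)).
have intH i : leb2.-integrable box (EFin \o H i).
  apply: integrable_Radd; [exact: mbox| | ]; apply: integrable_Rscale; (try exact: mbox).
    exact: int_re.
  exact: int_im.
have HE i : Rintegral leb2 box (H i) = (2 * pi) ^+ 2 * (a i ^+ 2 + b i ^+ 2).
  rewrite RintegralD //; last 2 first.
  - by apply: integrable_Rscale; [exact: mbox|exact: int_re].
  - by apply: integrable_Rscale; [exact: mbox|exact: int_im].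
  rewrite RintegralZl // RintegralZl // /a /b /fourier_re /fourier_im.
  set x := Rintegral _ _ _; set y := Rintegral _ _ _; rewrite -/x -/y.
  by have := lt0r_neq0 pi2_gt0; move: (2 * pi) => P P1; field.
have sumH : leb2.-integrable box (EFin \o (fun x => \sum_i H i x)) /\
    Rintegral leb2 box (fun x => \sum_i H i x) = \sum_i Rintegral leb2 box (H i).
  by apply: integrable_Rsum; [exact: mbox|exact: fbox|exact: intH].
have bmG : bounded_measurable G.
  have mm i : measurable_fun [set: R * R] (fun x => zdot (p i) x + psi i).
    by apply: measurable_addr => //; exact: measurable_zdot.
  apply: bm_add; apply: bm_mul; apply: bm_sum => i; apply: bm_mul;
    by [exact: bm_cst | exact: bm_cos | exact: bm_sin].
have intG : leb2.-integrable box (EFin \o G).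
  by apply: bm_integrable; [exact: mbox|exact: fbox|exact: bmG].
have GE : Rintegral leb2 box G = (2 * pi) ^+ 2 * \sum_i (a i ^+ 2 + b i ^+ 2).
  by rewrite /G Rintegral_sqnorm2 //; under eq_bigr do rewrite r2.
have pointwise x : box x -> 2 * (\sum_i H i x) <= u x ^+ 2 + v x ^+ 2 + G x.
  move=> _; have -> : \sum_i H i x = u x * (\sum_i r i * cos (zdot (p i) x + psi i))
      + v x * (\sum_i r i * sin (zdot (p i) x + psi i)).
    rewrite !mulr_sumr -big_split; apply: eq_bigr => i _; rewrite /= /H cosD sinD.
    by have [-> ->] := hpsi i; ring.
  rewrite /G /sqnorm_trig; set X := \sum_i _; set Y := \sum_i _.
  by have := sqr_ge0 (u x - X); have := sqr_ge0 (v x - Y); rewrite !sqrrB; lra.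
have : Rintegral leb2 box (fun x => 2 * \sum_i H i x)
    <= Rintegral leb2 box (fun x => u x ^+ 2 + v x ^+ 2 + G x).
  apply: le_Rintegral; [exact: mbox| | |exact: pointwise].
    by apply: integrable_Rscale; [exact: mbox|exact: sumH.1].
  by apply: integrable_Radd; [exact: mbox|exact: int_sq|exact: intG].
rewrite RintegralD; [|exact: mbox|exact: int_sq|exact: intG].
rewrite RintegralZl; [|exact: mbox|exact: sumH.1].
rewrite sumH.2 GE -/mass; under eq_bigr do rewrite HE.
rewrite -mulr_sumr; set A := \sum_i _ => hA.
by rewrite mulrC ler_pdivlMr // mulrC; lra.
Qed.
End Bessel.

End TrigIntegrals.

(** * The L^4 estimate *)

Section Strichartz.
Variables (R : realType) (T : finType) (p : T -> int * int) (B M : nat) (u v : R * R -> R).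
Hypothesis p_inj : injective p.
Hypothesis p_le : forall x, `|(p x).1| <= B%:Z /\ `|(p x).2| <= B%:Z.
Hypothesis M_gt0 : (0 < M)%N.
Hypothesis uv : L2_torus u v.
Local Notation leb := (@lebesgue_measure R).
Local Notation leb2 := (leb \x leb)%E.
Local Notation leb3 := ((leb \x leb) \x leb)%E.

Let r i := Num.sqrt (fourier_re u v (p i) ^+ 2 + fourier_im u v (p i) ^+ 2).
Let r_ge0 i : 0 <= r i. Proof. exact: sqrtr_ge0. Qed.

Let psi_sig : {psi : T -> R & forall i, fourier_re u v (p i) = r i * cos (psi i) /\
  fourier_im u v (p i) = r i * sin (psi i)}.
Proof.
by apply: (@choice _ _ (fun i t => fourier_re u v (p i) = r i * cos t /\
  fourier_im u v (p i) = r i * sin t)) => i; exact: polar_form.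
Qed.
Let psi := projT1 psi_sig.

(** The squared modulus of the solution, with the Fourier coefficients in polar form. *)
Definition wave (q : R * R * R) : R := sqnorm_trig r
  (fun i => zdot (p i) q.1 + (- sqn (p i))%:~R * q.2 + psi i).

Lemma waveE q :
  (\sum_i (fourier_re u v (p i) * cos (zdot (p i) q.1 - q.2 * znorm2 R (p i))
         - fourier_im u v (p i) * sin (zdot (p i) q.1 - q.2 * znorm2 R (p i)))) ^+ 2
  + (\sum_i (fourier_re u v (p i) * sin (zdot (p i) q.1 - q.2 * znorm2 R (p i))
         + fourier_im u v (p i) * cos (zdot (p i) q.1 - q.2 * znorm2 R (p i)))) ^+ 2 = wave q.
Proof.
rewrite /wave /sqnorm_trig; congr (_ ^+ 2 + _ ^+ 2); apply: eq_bigr => i _;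
  have [-> ->] := projT2 psi_sig i; rewrite -/psi;
  have -> : (- sqn (p i))%:~R * q.2 = - (q.2 * znorm2 R (p i))
    by rewrite /sqn /znorm2 intrN intrD !rmorphXn /=; ring.
- by move: (zdot _ _ - _) => A; rewrite cosD; ring.
- by move: (zdot _ _ - _) => A; rewrite sinD; ring.
Qed.

(* [|sum_(n < M) e^(i n t)|^2] is at least [(M cos 1)^2] on [[0, 1/M]]; multiplying by it
   extends the time integral to a full period at the cost of averaging over [M] frequencies. *)
Definition kernel_sum (t : R) : R := sqnorm_trig (fun _ : 'I_M => 1) (fun n => (n : nat)%:~R * t).

Lemma cos_ge_cos1 (x : R) : 0 <= x <= 1 -> cos 1 <= cos x.
Proof.
move=> /andP[x0 x1]; have pi2 := @pi_ge2 R; rewrite le_eqVlt.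
have [->|xn] := eqVneq x 1; first by rewrite eqxx.
by rewrite ltr_cos ?in_itv /= ?lt_neqAle ?xn ?x1 ?orbT //; apply/andP; split; lra.
Qed.

Lemma kernel_sum_ge (t : R) : 0 <= t <= M%:R^-1 -> (M%:R * cos 1) ^+ 2 <= kernel_sum t.
Proof.
move=> /andP[t0 t1]; have c1 := @cos1_gt0 R.
have M0 : 0 < M%:R :> R by rewrite ltr0n.
have h : M%:R * cos 1 <= \sum_(n < M) 1 * cos ((n : nat)%:~R * t).
  rewrite -[X in X%:R * _]card_ord mulr_natl -sumr_const; apply: ler_sum => n _.
  rewrite mul1r; apply: cos_ge_cos1; rewrite mulr_ge0 //=.
  apply: le_trans (_ : M%:R * t <= _).
    by apply: ler_wpM2r => //; rewrite -pmulrn ler_nat ltnW.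
  by apply: le_trans (ler_wpM2l (ltW M0) t1) _; rewrite mulfV // gt_eqF.
rewrite /kernel_sum /sqnorm_trig; apply: le_trans (_ : (\sum_(n < M) 1 * cos ((n : nat)%:~R * t)) ^+ 2 <= _).
  by apply: lerXn2r => //; rewrite nnegrE ?mulr_ge0 ?(ltW c1) // (le_trans _ h) // mulr_ge0 // ltW.
by rewrite lerDl sqr_ge0.
Qed.

Let I := ((T * T) * 'I_M)%type.
Let rho (i : I) : R := r i.1.1 * r i.1.2 * 1.
Let freq (i : I) : int * int := p i.1.1 + p i.1.2.
Let tfreq (i : I) : int := (i.2 : nat)%:Z - sqn (p i.1.1) - sqn (p i.1.2).
Let phase (i : I) : R := psi i.1.1 + psi i.1.2.

Lemma wave_kernelE q : wave q ^+ 2 * kernel_sum q.2 =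
  sqnorm_trig rho (fun i => zdot (freq i) q.1 + (tfreq i)%:~R * q.2 + phase i).
Proof.
rewrite expr2 /wave /kernel_sum !sqnorm_trigM; congr sqnorm_trig; apply/funext => -[[i j] n] /=.
have -> : zdot (freq (i, j, n)) q.1 = zdot (p i) q.1 + zdot (p j) q.1 :> R.
  have e1 : (freq (i, j, n)).1 = (p i).1 + (p j).1 by [].
  have e2 : (freq (i, j, n)).2 = (p i).2 + (p j).2 by [].
  by rewrite /zdot e1 e2 !intrD; ring.
by rewrite /tfreq /phase /= !intrB !intrN; ring.
Qed.

(** For given vertices the equation n - n' = tau has at most one n' for each of the [M] values of n,
    and none unless |tau| < M. *)
Lemma count_resonant : \sum_(i : I) \sum_(j : I) ((freq i == freq j) && (tfreq i == tfreq j))%:R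
    * (rho i * rho j) <= M%:R * energy p r M.
Proof.
pose F (z z' : T * T) : R := r z.1 * r z.2 * (r z'.1 * r z'.2).
have F0 z z' : 0 <= F z z' by rewrite !mulr_ge0.
pose tau (z z' : T * T) : int := sqn (p z.1) - sqn (p z'.1) + sqn (p z.2) - sqn (p z'.2).
pose G (z z' : T * T) : bool := (p z.1 + p z.2 == p z'.1 + p z'.2) && (`|tau z z'| < M%:Z)%R.
have -> : energy p r M = \sum_z \sum_z' (G z z')%:R * F z z'.
  pose sw (q : quad T) : quad T := ((q.1.1, q.2.1), (q.1.2, q.2.2)).
  have swK : involutive sw by move=> [[? ?] [? ?]].
  rewrite /energy (reindex_inj (inv_inj swK)) pair_bigA big_mkcond /=; apply: eq_bigr => -[[a b] [c d]] _.
  rewrite /resonant /G /F /tau /prodf /=; case: ifP => _; rewrite ?mul0r ?mul1r //; ring.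
rewrite mulr_sumr -(pair_bigA _ (fun z n => \sum_(j : I) ((freq (z, n) == freq j) &&
   (tfreq (z, n) == tfreq j))%:R * (rho (z, n) * rho j))) /=; apply: ler_sum => z _.
under eq_bigr => n _ do rewrite -(pair_bigA _ (fun z' n' => ((freq (z, n) == freq (z', n')) &&
   (tfreq (z, n) == tfreq (z', n')))%:R * (rho (z, n) * rho (z', n')))).
rewrite exchange_big mulr_sumr /=; apply: ler_sum => z' _.
rewrite -[X in X%:R * _]card_ord mulr_natl -sumr_const; apply: ler_sum => n _.
rewrite (eq_bigr (fun n' : 'I_M => ((p z.1 + p z.2 == p z'.1 + p z'.2) &&
   ((n : nat)%:Z - (n' : nat)%:Z == tau z z'))%:R * F z z')); last first.
  move=> n' _; rewrite /rho /F /= !mulr1; congr ((_ : bool)%:R * _); congr (_ && _).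
  by rewrite /tfreq /tau /=; apply/eqP/eqP; lia.
rewrite -mulr_suml; apply: ler_wpM2r => //.
case: (boolP [exists n' : 'I_M, (p z.1 + p z.2 == p z'.1 + p z'.2) &&
   ((n : nat)%:Z - (n' : nat)%:Z == tau z z')]) => [/existsP[n' /andP[h1 /eqP h2]]|/existsPn h].
  rewrite (bigD1 n') //= big1 => [|n'' /eqP nn].
    rewrite addr0 /G h1 h2 eqxx /= -h2 (_ : `|_| < _) //.
    by have := ltn_ord n; have := ltn_ord n'; lia.
  rewrite (_ : _ && _ = false) //; apply/negbTE; rewrite negb_and; apply/orP; right.
  by apply/eqP => h3; apply: nn; apply: val_inj => /=; lia.
by rewrite big1 ?ler0n // => n' _; rewrite (negbTE (h n')).
Qed.

Let mass := Rintegral leb2 (@torus_box R) (fun x => u x ^+ 2 + v x ^+ 2).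
Let m := (trunc_log 2 #|T|).+1.

Lemma wave_integral_le (t : R) : 0 <= t <= M%:R^-1 ->
  Rintegral leb3 (@torus_box R `*` `[0, t]) (fun q => wave q ^+ 2)
   <= (M%:R * cos 1) ^- 2 * ((2 * pi) ^+ 3 * (M%:R * energy p r M)).
Proof.
move=> /andP[t0 t1]; have c1 := @cos1_gt0 R; have pp := @pi_ge2 R.
have M0 : 0 < M%:R :> R by rewrite ltr0n.
have M1 : M%:R^-1 <= 1 :> R by rewrite invf_le1 ?ler1n.
pose k : R := (M%:R * cos 1) ^- 2.
have k0 : 0 <= k by rewrite invr_ge0 exprn_ge0 // mulr_ge0 // ltW.
pose N q := sqnorm_trig rho (fun i => zdot (freq i) q.1 + (tfreq i)%:~R * q.2 + phase i).
have bmN : bounded_measurable N by exact: bm_sqnorm3.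
have bmW : bounded_measurable wave by exact: bm_sqnorm3.
have bmk : bounded_measurable (fun q => k * N q) by apply: bm_mul => //; exact: bm_cst.
have bmW2 : bounded_measurable (fun q => wave q ^+ 2) by exact: bm_mul.
have N0 q : 0 <= N q by rewrite addr_ge0 ?sqr_ge0.
apply: le_trans (_ : Rintegral leb3 (@torus_box R `*` `[0, t]) (fun q => k * N q) <= _).
  apply: le_Rintegral.
  - exact: measurable_cylinder.
  - by apply: bm_integrable; [exact: measurable_cylinder|exact: cylinder_finite|].
  - by apply: bm_integrable; [exact: measurable_cylinder|exact: cylinder_finite|].
  move=> q [_ /= hq]; rewrite /N -wave_kernelE.
  have qt : 0 <= q.2 <= M%:R^-1.
    by move: hq; rewrite in_itv /= => /andP[-> h]; apply: le_trans t1.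
  have w0 : 0 <= wave q ^+ 2 by apply: sqr_ge0.
  have := ler_wpM2l k0 (ler_wpM2l w0 (kernel_sum_ge qt)); apply: le_trans.
  by rewrite mulrCA /k mulVf ?mulr1 // expf_neq0 // mulf_neq0 // gt_eqF.
apply: le_trans (_ : Rintegral leb3 (@torus_box R `*` `[0, 2 * pi]) (fun q => k * N q) <= _).
  have sub : @torus_box R `*` `[0, t] `<=` @torus_box R `*` `[0, 2 * pi].
    move=> q [h1 /= h2]; split => //=; move: h2; rewrite !in_itv /= => /andP[-> h]; lra.
  have i2 : leb3.-integrable (@torus_box R `*` `[0, 2 * pi]) (EFin \o (fun q => k * N q)).
    apply: bm_integrable; [exact: measurable_cylinder| |exact: bmk].
    by apply: cylinder_finite; lra.
  have i1 : leb3.-integrable (@torus_box R `*` `[0, t]) (EFin \o (fun q => k * N q)).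
    by apply: bm_integrable; [exact: measurable_cylinder|exact: cylinder_finite|].
  apply: fine_le.
  - by apply: integrable_fin_num; [exact: measurable_cylinder|exact: i1].
  - by apply: integrable_fin_num; [exact: measurable_cylinder|exact: i2].
  apply: ge0_subset_integral; [exact: measurable_cylinder|exact: measurable_cylinder| | |exact: sub].
    exact: (measurable_int _ i2).
  by move=> q _; rewrite lee_fin mulr_ge0.
rewrite bm_RintegralZl; [|exact: measurable_cylinder|by apply: cylinder_finite; lra|exact: bmN].
apply: ler_wpM2l => //; apply: le_trans (Rintegral_sqnorm3 _ _ _ _) _.
  by move=> i; rewrite !mulr_ge0.
by apply: ler_wpM2l; [rewrite exprn_ge0 //; lra | exact: count_resonant].
Qed.

(** The powers of [M] cancel: M^-2 from the kernel, M from [count_resonant], and 6 M >= M + m from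
    the energy. The factor [(2 * pi) ^- 4] is the square of the one in [bessel]. *)
Definition strichartz_const : R := (cos 1) ^- 2 * ((2 * pi) ^+ 3 * (energy_const R * 6 * (2 * pi) ^- 4)).

Lemma wave_integral_le_mass (t : R) : 0 <= t <= M%:R^-1 -> (m <= 5 * M)%N ->
  Rintegral leb3 (@torus_box R `*` `[0, t]) (fun q => wave q ^+ 2) <= strichartz_const * mass ^+ 2.
Proof.
move=> ht hm; apply: le_trans (wave_integral_le ht) _.
have c1 := @cos1_gt0 R; have pp := @pi_ge2 R.
have M0 : 0 < M%:R :> R by rewrite ltr0n.
have EC0 : 0 <= energy_const R by exact: energy_const_ge0.
have S0 : 0 <= \sum_i r i ^+ 2 by apply: sumr_ge0 => i _; rewrite sqr_ge0.
have S1 : \sum_i r i ^+ 2 <= (2 * pi) ^- 2 * mass.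
  apply: le_trans (bessel p_inj uv); apply: ler_sum => i _.
  by rewrite sqr_sqrtr // addr_ge0 ?sqr_ge0.
have S2 : (\sum_i r i ^+ 2) ^+ 2 <= (2 * pi) ^- 4 * mass ^+ 2.
  rewrite (_ : (2 * pi) ^- 4 * mass ^+ 2 = ((2 * pi) ^- 2 * mass) ^+ 2); last first.
    by rewrite [RHS]exprMn exprVn -exprM.
  by apply: lerXn2r => //; rewrite nnegrE // (le_trans S0).
have E1 : energy p r M <= energy_const R * (6 * M%:R) * ((2 * pi) ^- 4 * mass ^+ 2).
  apply: le_trans (energy_le p_inj p_le r_ge0 M_gt0) _; rewrite -/m.
  apply: ler_pM => //; first by rewrite mulr_ge0.
    by rewrite sqr_ge0.
  by rewrite ler_wpM2l // -natrM ler_nat; lia.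
have -> : strichartz_const * mass ^+ 2 = (M%:R * cos 1) ^- 2 * ((2 * pi) ^+ 3 * (M%:R *
   (energy_const R * (6 * M%:R) * ((2 * pi) ^- 4 * mass ^+ 2)))).
  rewrite /strichartz_const; have M1 := lt0r_neq0 M0; have C1 := lt0r_neq0 c1.
  have P1 : 2 * pi != 0 :> R by rewrite gt_eqF //; lra.
  move: (2 * pi) P1 (cos 1) C1 (M%:R) M1 mass (energy_const R) => P P1 c C1 n M1 k e.
  by field; rewrite P1 C1.
apply: ler_wpM2l; first by rewrite invr_ge0 sqr_ge0.
apply: ler_wpM2l; first by rewrite exprn_ge0 //; lra.
by apply: ler_wpM2l; first exact: ltW.
Qed.
End Strichartz.

(** * From the integer scale M to the logarithm of #S *)

Lemma ln2_ge_half (R : realType) : 1 / 2 <= ln 2 :> R.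
Proof.
have := @le_ln1Dx R (- (1 / 2)); rewrite (_ : 1 + - (1 / 2) = 2^-1 :> R); last by field.
rewrite lnV ?posrE //; lra.
Qed.

Lemma level_count_le (k M : nat) : (k < 2 * M.+1)%N -> (0 < M)%N -> (k.+1 <= 5 * M)%N.
Proof. by lia. Qed.

Lemma fourth_root_le (R : realType) (k a c : R) : 0 <= k -> 0 <= a -> 0 <= c ->
  k <= c * a ^+ 2 -> powR k 4^-1 <= (powR c 4^-1 + 1) * powR a 2^-1.
Proof.
move=> k0 a0 c0 h; have ca0 : 0 <= c * a ^+ 2 by rewrite mulr_ge0 // sqr_ge0.
apply: le_trans (_ : powR (c * a ^+ 2) 4^-1 <= _).
  by apply: ge0_ler_powR; rewrite ?nnegrE ?invr_ge0.
rewrite powRM ?sqr_ge0 // -powR_mulrn // -powRrM (_ : 2%:R * 4^-1 = 2^-1 :> R); last by field.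
by rewrite mulrDl mul1r lerDl powR_ge0.
Qed.

Theorem theorem1p2 (R : realType) :
  exists c : R, 0 < c /\
    forall (S : {fset int * int}) (u v : R * R -> R),
      S != fset0 ->
      L2_torus u v ->
      L4norm_schrod_PS S u v (1 / logm (#|` S |)%:R)
        <= c * L2norm_torus u v.
Proof.
have c1 := @cos1_gt0 R; have pp := @pi_ge2 R; have EC0 := @energy_const_ge0 R.
have SC0 : 0 <= strichartz_const R.
  rewrite !mulr_ge0 ?invr_ge0 ?sqr_ge0 ?exprn_ge0 //; lra.
(* The summand 1 makes positivity immediate. *)
exists (powR (strichartz_const R) (4^-1) + 1); split.
  by rewrite ltr_wpDl ?powR_ge0.
move=> S u v S0 uv.
pose p (i : S) : int * int := val i.
pose B := (\max_(i : S) (`|(p i).1| + `|(p i).2|))%N.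
have p_le i : `|(p i).1| <= B%:Z /\ `|(p i).2| <= B%:Z.
  have := leq_bigmax (F := fun i : S => (`|(p i).1| + `|(p i).2|)%N) i; rewrite -/B; lia.
have p_inj : injective p by exact: val_inj.
pose X : R := logm (#|` S|)%:R.
have X1 : 1 <= X by rewrite /X /logm le_max lexx.
have X0 : 0 <= X by lra.
(* Rounding down makes 1 / X <= 1 / M, and X >= 1 keeps [M] positive. *)
pose M := Num.truncn X.
have M_gt0 : (0 < M)%N by rewrite truncn_gt_nat.
have /andP[MX XM] := truncn_itv X0; rewrite -/M in MX XM.
have M0 : 0 < M%:R :> R by rewrite ltr0n.
have cS : #|{: S}| = #|` S| by rewrite cardfE.
(* If 2^k <= #S, then k ln 2 <= X < M + 1, and ln 2 >= 1 / 2 gives k < 2 (M + 1). *)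
have hm : ((trunc_log 2 #|{: S}|).+1 <= 5 * M)%N.
  have N0 : (0 < #|{: S}|)%N by rewrite cS cardfs_gt0.
  have hN : (2 ^ trunc_log 2 #|{: S}| <= #|` S|)%N by rewrite -cS; apply: trunc_logP.
  have : (trunc_log 2 #|{: S}|)%:R * ln 2 <= X.
    apply: le_trans (_ : ln (#|` S|)%:R <= _); last by rewrite /X /logm le_max lexx orbT.
    rewrite mulr_natl -lnXn // ler_ln ?posrE ?exprn_gt0 // ?ltr0n -?cS //.
    by rewrite -natrX ler_nat; rewrite -cS in hN.
  have := ler_wpM2l (ler0n R (trunc_log 2 #|{: S}|)) (ln2_ge_half R).
  move=> h1 h2; have : (trunc_log 2 #|{: S}|)%:R < (2 * M.+1)%:R :> R by rewrite natrM; lra.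
  by rewrite ltr_nat => h3; exact: (level_count_le h3 M_gt0).
have ht : 0 <= 1 / X <= M%:R^-1.
  by rewrite div1r invr_ge0 X0 lef_pV2 ?posrE //; lra.
have main := wave_integral_le_mass p_inj p_le M_gt0 uv ht hm.
have L4E : L4norm_schrod_PS S u v (1 / X) =
  powR (Rintegral ((@lebesgue_measure R \x @lebesgue_measure R) \x @lebesgue_measure R)%E
     (@torus_box R `*` `[0, 1 / X]) (fun q => wave p u v q ^+ 2)) (4^-1).
  rewrite /L4norm_schrod_PS; congr powR; apply: eq_Rintegral => q _.
  by rewrite -waveE /schrod_PS_re /schrod_PS_im !big_seq_fsetE.
rewrite -/X L4E /L2norm_torus.
set K := Rintegral _ _ _ in main *; set mass := Rintegral _ _ _ in main *.
have K0 : 0 <= K by apply: Rintegral_ge0 => x _; rewrite sqr_ge0.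
have mass0 : 0 <= mass by apply: Rintegral_ge0 => x _; rewrite addr_ge0 ?sqr_ge0.
exact: fourth_root_le.
Qed.
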